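(* Let $M=\Gamma\backslash G$ be a $2n$-dimensional nilmanifold endowed with an invariant complex structure $J$, and let $\mathfrak g$ be the Lie algebra of $G$. If $(\mathfrak g,J)$ does not satisfy the $(n-1,n)$-th weak $\partial\bar\partial$-lemma, then $(M,J)$ does not satisfy the $(n-1,n)$-th weak $\partial\bar\partial$-lemma.
   Context: A nilmanifold is a compact quotient $\Gamma\backslash G$ of a simply-connected nilpotent Lie group $G$ by a lattice $\Gamma$ of maximal rank; an invariant complex structure on it is one induced by a left-invariant complex structure on $G$, i.e. by a complex structure $J$ on $\mathfrak g$. $\bigwedge^{p,q}(\mathfrak g^* )$ denotes the space of $(p,q)$-elements of $\bigwedge^*\mathfrak g^*_{\mathbb C}$ with respect to $J$, with differentials $\partial,\bar\partial$ induced by the Chevalley-Eilenberg differential $d=\partial+\bar\partial$. A compact complex $n$-dimensional manifold satisfies the $(n-1,n)$-th weak $\partial\bar\partial$-lemma if for each real form $\varphi$ of type $(n-1,n-1)$ such that $\bar\partial\varphi$ is $\partial$-exact (i.e. $\bar\partial\varphi=\partial\eta$ for some $(n-2,n)$-form $\eta$) there exists an $(n-2,n-1)$-form $\psi$ with $\bar\partial\varphi=i\,\partial\bar\partial\psi$. The pair $(\mathfrak g,J)$ satisfies the $(n-1,n)$-th weak $\partial\bar\partial$-lemma if the same holds with forms replaced by elements of $\bigwedge^{*,*}(\mathfrak g^* )$: for each real $\varphi\in\bigwedge^{n-1,n-1}(\mathfrak g^* )$ with $\bar\partial\varphi=\partial\eta$ for some $\eta\in\bigwedge^{n-2,n}(\mathfrak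 g^* )$, there is $\psi\in\bigwedge^{n-2,n-1}(\mathfrak g^* )$ with $\bar\partial\varphi=i\,\partial\bar\partial\psi$. *)

(* Defs.v *)
From HB Require Import structures.
From mathcomp Require Import all_boot all_order all_algebra generic_quotient.
From mathcomp Require Import all_classical all_reals all_analysis.
From mathcomp Require Import ring.

Set Implicit Arguments.
Unset Strict Implicit.
Unset Printing Implicit Defensive.

Import Order.TTheory GRing.Theory Num.Theory.
Import numFieldNormedType.Exports.

Local Open Scope classical_set_scope.
Local Open Scope ring_scope.

Section Smooth.
Context {R : realType} {V W : normedModType R}.
Implicit Types (U : set V) (f g : V -> W).

(* C^k on the open set U, with Frechet differentiability at each stage. *)
Fixpoint Ck (k : nat) U f : Prop :=
  if k is k'.+1 then
    (forall x, U x -> differentiable f x) /\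
    (forall v, Ck k' U (fun x => 'D_v f x))
  else forall x, U x -> {for x, continuous f}.

Definition smooth_on U f := forall k, Ck k U f.

Lemma differentiable_near_eq f g x :
  (\forall y \near x, f y = g y) -> differentiable f x -> differentiable g x.
Proof.
move=> fg df; have -> : g = f + (g - f) by rewrite addrC subrK.
apply: differentiableD => //.
set h := g - f; have h0 : \forall y \near x, h y = 0.
  by apply: filterS fg => y fgy; rewrite /h !fctE fgy subrr.
have hx : h x = 0 by exact: nbhs_singleton h0.
have dh : h \o shift x = cst (h x) + \0 +o_ 0 id.
  apply/eqaddoP => e e0; have := h0; rewrite (near_shift 0) subr0.
  apply: filterS => y /= hy.
  rewrite [X in `|X|](_ : _ = 0) ?normr0 ?mulr_ge0 ?normr_ge0 ?ltW //.
  by rewrite -[LHS]/(h (y + x) - (h x + 0)) hy hx addr0 subrr.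
have c0 : continuous (\0 : V -> W) by move=> y; exact: cvg_cst.
by apply/diff_locallyP; rewrite (diff_unique (df := \0) c0 dh).
Qed.

Lemma Ck_ext k U f g : open U -> (forall x, U x -> f x = g x) ->
  Ck k U f -> Ck k U g.
Proof.
move=> oU; elim: k f g => [|k IH] f g fg /=.
  move=> cf x Ux; have nfg : \forall y \near x, f y = g y.
    by apply: filterS (open_nbhs_nbhs (conj oU Ux)) => y /fg.
  have := cf x Ux; rewrite /prop_for /continuous_at (fg _ Ux).
  move=> cfx; apply: cvg_trans cfx; apply: near_eq_cvg.
  by apply: filterS nfg => y ->.
have nfg x : U x -> \forall y \near x, f y = g y.
  by move=> Ux; apply: filterS (open_nbhs_nbhs (conj oU Ux)) => y /fg.
case=> df Df; split=> [x Ux|v].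
  exact: differentiable_near_eq (nfg x Ux) (df x Ux).
by apply: IH (Df v) => x Ux; apply: near_eq_derive; exact: nfg.
Qed.

Lemma Ck_prev k U f : Ck k.+1 U f -> Ck k U f.
Proof.
elim: k f => [|k IH] f [df Df] /=.
  by move=> x /df /differentiable_continuous.
by split=> // v; exact/IH/Df.
Qed.

Lemma Ck_cst k U (a : W) : Ck k U (cst a).
Proof.
elim: k a => [|k IH] a /=; first by move=> x _; exact: cvg_cst.
split=> [x _|v]; first exact: differentiable_cst.
rewrite (_ : (fun x => _) = cst 0); first exact: IH.
by apply/funext => x; exact: derive_cst.
Qed.

Lemma Ck_lin k U f g (a : R) : open U -> Ck k U f -> Ck k U g ->
  Ck k U (a *: f + g).
Proof.
move=> oU; elim: k f g => [|k IH] f g /=.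
  move=> cf cg x Ux; apply: (@continuousD _ _ _ (a *: f) g); last exact: cg.
  by apply: (@continuousZl_tmp _ _ _ f a); exact: cf.
move=> [df Df] [dg Dg]; split=> [x Ux|v].
  by apply: differentiableD; [exact/differentiableZ/df|exact: dg].
apply: Ck_ext (IH _ _ (Df v) (Dg v)) => // x Ux.
have dfx : derivable f x v by exact/diff_derivable/df.
have dgx : derivable g x v by exact/diff_derivable/dg.
by rewrite deriveD ?deriveZ //; exact: derivableZ.
Qed.

End Smooth.

Lemma Ck_mul (R : realType) (V : normedModType R) k (U : set V) (f g : V -> R) :
  open U -> Ck k U f -> Ck k U g -> Ck k U (f * g).
Proof.
move=> oU; elim: k f g => [|k IH] f g /=.
  by move=> cf cg x Ux; apply: (@continuousM _ _ f g); [exact: cf|exact: cg].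
move=> [df Df] [dg Dg]; split=> [x Ux|v].
  by apply: differentiableM; [exact: df|exact: dg].
have Cf : Ck k U f by apply: Ck_prev; split.
have Cg : Ck k U g by apply: Ck_prev; split.
have := Ck_lin 1 oU (IH _ _ Cf (Dg v)) (IH _ _ Cg (Df v)).
apply: Ck_ext => // x Ux; rewrite scale1r deriveM //.
  exact/diff_derivable/df.
exact/diff_derivable/dg.
Qed.

(* chart_map and chart_inv are total; only their values on chart_dom and on
   its image are meaningful. *)
Record chart (R : realType) (m : nat) (T : topologicalType) := Chart {
  chart_dom : set T ;
  chart_map : T -> 'rV[R]_m ;
  chart_inv : 'rV[R]_m -> T ;
  chart_open : open chart_dom ;
  chart_img_open : open (chart_map @` chart_dom) ;
  chart_mapK : {in chart_dom, cancel chart_map chart_inv} ;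
  chart_map_cont : forall x, chart_dom x -> {for x, continuous chart_map} ;
  chart_inv_cont : forall y, (chart_map @` chart_dom) y ->
    {for y, continuous chart_inv}
}.

Arguments chart_img_open {R m T} c : rename.

Definition chart_img (R : realType) m T (c : chart R m T) : set 'rV[R]_m :=
  chart_map c @` chart_dom c.

Definition smooth_atlas (R : realType) m T (A : set (chart R m T)) : Prop :=
  (forall x, exists2 c, A c & chart_dom c x) /\
  (forall c d, A c -> A d ->
    smooth_on (chart_img c `&` chart_inv c @^-1` chart_dom d)
      (chart_map d \o chart_inv c)).

Definition smooth_unary (R : realType) m T (A : set (chart R m T))
    (f : T -> T) : Prop :=
  continuous f /\
  forall c d, A c -> A d ->
    smooth_on (chart_img c `&` (f \o chart_inv c) @^-1` chart_dom d)
      (chart_map d \o f \o chart_inv c).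

Definition smooth_binary (R : realType) m T (A : set (chart R m T))
    (f : T -> T -> T) : Prop :=
  continuous (fun z : T * T => f z.1 z.2) /\
  forall c1 c2 d, A c1 -> A c2 -> A d ->
    let h := fun z : 'rV[R]_m * 'rV[R]_m =>
      f (chart_inv c1 z.1) (chart_inv c2 z.2) in
    smooth_on (chart_img c1 `*` chart_img c2 `&` h @^-1` chart_dom d)
      (chart_map d \o h).

(* Real Lie groups of dimension m. The atlas need not be maximal: smoothness
   with respect to it and to the maximal atlas it generates agree. *)
HB.mixin Record isLieGroup (R : realType) (m : nat) G
    of Group G & Topological G := {
  lie_atlas : set (chart R m G) ;
  lie_atlasP : smooth_atlas lie_atlas ;
  lie_hausdorff : hausdorff_space G ;
  lie_second_countable : @second_countable G ;
  lie_mul_smooth : smooth_binary lie_atlas (fun x y : G => (x * y)%g) ;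
  lie_inv_smooth : smooth_unary lie_atlas (fun x : G => x^-1%g)
}.

#[short(type="lieGroupType")]
HB.structure Definition LieGroup (R : realType) (m : nat) :=
  { G of Group G & Topological G & isLieGroup R m G }.

Arguments lie_atlas {R m} s : rename.

Section SmoothFunctions.
Context {R : realType} {m : nat} {G : lieGroupType R m}.

Definition lie_smooth (f : G -> R) : Prop :=
  forall c, lie_atlas G c -> smooth_on (chart_img c) (f \o chart_inv c).

Lemma lie_smooth_cst (a : R) : lie_smooth (cst a).
Proof. by move=> c _ k; exact: Ck_cst. Qed.

Lemma lie_smooth_lin (a : R) (f g : G -> R) :
  lie_smooth f -> lie_smooth g -> lie_smooth (fun x => a * f x + g x).
Proof.
move=> sf sg c cA k.
exact: (Ck_lin a (chart_img_open c) (sf c cA k) (sg c cA k)).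
Qed.

Lemma lie_smooth_mul (f g : G -> R) :
  lie_smooth f -> lie_smooth g -> lie_smooth (fun x => f x * g x).
Proof.
move=> sf sg c cA k.
exact: (Ck_mul (chart_img_open c) (sf c cA k) (sg c cA k)).
Qed.

End SmoothFunctions.

Section SmoothAlgebra.
Context {R : realType} {m : nat} {G : lieGroupType R m} {T : Type}.
Variable p : G -> T.

(* The real algebra of the f : T -> R such that f \o p is smooth on G. For
   p = id this is C^oo(G); for p the covering map of G onto a quotient by a
   discrete subgroup it is C^oo of the quotient manifold. *)
Definition smooth_pred : {pred T -> R^o} :=
  fun f => `[< lie_smooth (f \o p) >].

Record smooth_fun := SmoothFun {
  smooth_val :> T -> R^o ;
  smooth_valP : smooth_val \in smooth_pred
}.

HB.instance Definition _ := [isSub for smooth_val].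
HB.instance Definition _ := [Choice of smooth_fun by <:].

Lemma smooth_valE (f : smooth_fun) : lie_smooth (f \o p).
Proof. exact/asboolP/(smooth_valP f). Qed.

Fact smooth_subring : subring_closed smooth_pred.
Proof.
split.
- exact/asboolP/lie_smooth_cst.
- move=> f g /asboolP sf /asboolP sg; apply/asboolP.
  have -> : (f - g) \o p = fun x => -1 * (g \o p) x + (f \o p) x.
    by apply/funext => x; rewrite /= mulN1r addrC.
  exact: lie_smooth_lin.
- by move=> f g /asboolP sf /asboolP sg; apply/asboolP; exact: lie_smooth_mul.
Qed.

HB.instance Definition _ :=
  GRing.isSubringClosed.Build (T -> R^o) smooth_pred smooth_subring.

HB.instance Definition _ :=
  GRing.SubChoice_isSubComPzRing.Build _ _ smooth_fun
    (GRing.subringClosedP smooth_pred).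

Fact smooth_scaler : GRing.scaler_closed smooth_pred.
Proof.
move=> a f /asboolP sf; apply/asboolP.
have -> : (a *: f) \o p = fun x => a * (f \o p) x + cst 0 x.
  by apply/funext => x; rewrite /= addr0.
by apply: lie_smooth_lin => //; exact: lie_smooth_cst.
Qed.

HB.instance Definition _ :=
  GRing.isScaleClosed.Build R (T -> R^o) smooth_pred smooth_scaler.

HB.instance Definition _ :=
  GRing.SubZmodule_isSubLmodule.Build _ _ _ smooth_fun
    (GRing.subsemimodClosedP smooth_pred).

Fact smooth_oner_neq0 : (1 : smooth_fun) != 0.
Proof.
apply/eqP => /(congr1 (fun f : smooth_fun => f (p 1%g))).
by apply/eqP; exact: oner_neq0.
Qed.

HB.instance Definition _ :=
  GRing.PzSemiRing_isNonZero.Build smooth_fun smooth_oner_neq0.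

Fact smooth_scalerAl (a : R) (f g : smooth_fun) : a *: (f * g) = (a *: f) * g.
Proof. by apply/val_inj/funext => x; exact: mulrA. Qed.

HB.instance Definition _ :=
  GRing.Lmodule_isLalgebra.Build R smooth_fun smooth_scalerAl.

Fact smooth_scalerAr (a : R) (f g : smooth_fun) : a *: (f * g) = f * (a *: g).
Proof. by apply/val_inj/funext => x; exact: mulrCA. Qed.

HB.instance Definition _ :=
  GRing.Lalgebra_isAlgebra.Build R smooth_fun smooth_scalerAr.

End SmoothAlgebra.

Section Derivations.
Context {K : comNzRingType} {A : comAlgType K}.

Definition is_derivation (D : A -> A) : Prop :=
  (forall (a : K) f g, D (a *: f + g) = a *: D f + D g) /\
  (forall f g, D (f * g) = D f * g + f * D g).

Definition commutator (D E : A -> A) : A -> A := fun f => D (E f) - E (D f).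

Lemma is_derivation_lin (a : A) (D E : A -> A) :
  is_derivation D -> is_derivation E ->
  is_derivation (fun f => a * D f + E f).
Proof.
move=> [lD mD] [lE mE]; split=> [k f g|f g].
  by rewrite lD lE scalerDr mulrDr scalerAr addrACA.
by rewrite mD mE; ring.
Qed.

Lemma is_derivation0 : is_derivation (fun=> 0).
Proof. by split=> *; rewrite ?scaler0 ?mul0r ?mulr0 addr0. Qed.

Lemma is_derivation_commutator (D E : A -> A) :
  is_derivation D -> is_derivation E -> is_derivation (commutator D E).
Proof.
move=> [lD mD] [lE mE].
have DD f g : D (f + g) = D f + D g by rewrite -[f]scale1r lD !scale1r.
have ED f g : E (f + g) = E f + E g by rewrite -[f]scale1r lE !scale1r.
split=> [k f g|f g]; rewrite /commutator.
  by rewrite lE lD lD lE scalerBr opprD addrACA.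
by rewrite mE mD DD ED !mD !mE; ring.
Qed.

(* For A = C^oo(M) the K-linear derivations of A are the smooth vector fields
   on M. The codomain A^o makes them an A-module rather than a K-module. *)
Definition derivation_pred : {pred A -> A^o} :=
  fun D => `[< is_derivation D >].

Record derivation := Derivation {
  derivation_val :> A -> A^o ;
  derivation_valP : derivation_val \in derivation_pred
}.

HB.instance Definition _ := [isSub for derivation_val].
HB.instance Definition _ := [Choice of derivation by <:].

Lemma derivationP (X : derivation) : is_derivation X.
Proof. exact/asboolP/(derivation_valP X). Qed.

Fact derivation_submod : submod_closed derivation_pred.
Proof.
split; first exact/asboolP/is_derivation0.
by move=> a D E /asboolP dD /asboolP dE; apply/asboolP; exact: is_derivation_lin.
Qed.

HB.instance Definition _ := GRing.isSubmodClosed.Build A (A -> A^o)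
  derivation_pred (GRing.submod_closed_semi derivation_submod).
HB.instance Definition _ := GRing.SubChoice_isSubLmodule.Build _ _ _ derivation
  (GRing.subsemimodClosedP derivation_pred).

Definition derivation_bracket (X Y : derivation) : derivation :=
  Derivation (introT (asboolP _)
    (is_derivation_commutator (derivationP X) (derivationP Y))).

End Derivations.
Arguments derivation {K} A.

Section LieAlgebra.
Context {R : realType} {m : nat} {G : lieGroupType R m}.
Local Notation CG := (smooth_fun (@id G)).

(* D commutes with f |-> f \o (a * _); h stands for the latter composite. *)
Definition left_invariant (D : CG -> CG) : Prop :=
  forall (a : G) (f h : CG), (forall x, h x = f (a * x)%g) ->
    forall x, D h x = D f (a * x)%g.

Definition lie_algebra_pred : {pred CG -> CG} :=
  fun D => `[< is_derivation D /\ left_invariant D >].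

Record lie_algebra := LieAlgebra {
  lie_algebra_val :> CG -> CG ;
  lie_algebra_valP : lie_algebra_val \in lie_algebra_pred
}.

HB.instance Definition _ := [isSub for lie_algebra_val].
HB.instance Definition _ := [Choice of lie_algebra by <:].

Lemma lie_algebraP (X : lie_algebra) : is_derivation X /\ left_invariant X.
Proof. exact/asboolP/(lie_algebra_valP X). Qed.

Fact lie_algebra_submod : submod_closed lie_algebra_pred.
Proof.
split; first by apply/asboolP; split=> //; exact: is_derivation0.
move=> a D E /asboolP[dD iD] /asboolP[dE iE]; apply/asboolP; split.
  have -> : a *: D + E = (fun f => a%:A * D f + E f).
    by apply/funext => f; rewrite mulr_algl.
  exact: is_derivation_lin.
move=> b f h hf x.
by rewrite -[LHS]/(a * D h x + E h x) (iD b f h hf) (iE b f h hf).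
Qed.

HB.instance Definition _ := GRing.isSubmodClosed.Build R (CG -> CG)
  lie_algebra_pred (GRing.submod_closed_semi lie_algebra_submod).
HB.instance Definition _ := GRing.SubChoice_isSubLmodule.Build _ _ _ lie_algebra
  (GRing.subsemimodClosedP lie_algebra_pred).

Fact lie_bracket_subproof (X Y : lie_algebra) :
  commutator X Y \in lie_algebra_pred.
Proof.
have [dX iX] := lie_algebraP X; have [dY iY] := lie_algebraP Y.
apply/asboolP; split; first exact: is_derivation_commutator.
move=> a f h hf x; have YX := iY a f h hf; have XY := iX a f h hf.
rewrite -[LHS]/(X (Y h) x - Y (X h) x).
by rewrite (iX a _ _ YX) (iY a _ _ XY).
Qed.

Definition lie_bracket (X Y : lie_algebra) : lie_algebra :=
  LieAlgebra (lie_bracket_subproof X Y).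

End LieAlgebra.
Arguments lie_algebra {R m} G.

Section GroupNotions.
Variable G : groupType.

(* Upper central series. *)
Fixpoint upper_center (k : nat) : set G :=
  if k is k'.+1 then [set x | forall y, upper_center k' [~ x, y]%g]
  else [set 1%g].

Definition nilpotent_group : Prop := exists k, upper_center k = setT.

Record subgroup := Subgroup {
  subgroup_set :> set G ;
  subgroup1 : subgroup_set 1%g ;
  subgroupM : forall x y,
    subgroup_set x -> subgroup_set y -> subgroup_set (x * y)%g ;
  subgroupV : forall x, subgroup_set x -> subgroup_set x^-1%g
}.

Variable H : subgroup.

(* x ~ y iff y \in H x, so that the quotient is H \ G. *)
Definition rcoset_rel (x y : G) : bool := `[< subgroup_set H (y * x^-1)%g >].

Fact rcoset_refl : reflexive rcoset_rel.
Proof. by move=> x; apply/asboolP; rewrite mulgV; exact: subgroup1. Qed.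

Fact rcoset_sym : symmetric rcoset_rel.
Proof.
suff h x y : rcoset_rel x y -> rcoset_rel y x by move=> x y; apply/idP/idP => /h.
by move=> /asboolP/(@subgroupV H) Hxy; apply/asboolP; rewrite invgM invgK in Hxy.
Qed.

Fact rcoset_trans : transitive rcoset_rel.
Proof.
move=> y x z /asboolP Hxy /asboolP Hyz; apply/asboolP.
by have := subgroupM Hyz Hxy; rewrite mulgA mulgVK.
Qed.

Canonical rcoset_equiv :=
  EquivRel rcoset_rel rcoset_refl rcoset_sym rcoset_trans.

Definition left_quotient := {eq_quot rcoset_equiv}%qT.

End GroupNotions.

Definition simply_connected (R : realType) (T : topologicalType) : Prop :=
  (forall x y : T, exists2 g : R -> T,
     {within `[0, 1], continuous g} & g 0 = x /\ g 1 = y) /\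
  (forall g : R -> T, {within `[0, 1], continuous g} -> g 0 = g 1 ->
     exists2 h : R * R -> T,
       {within `[0, 1] `*` `[0, 1], continuous h} &
       (forall t, 0 <= t <= 1 -> h (0, t) = g t /\ h (1, t) = g 0) /\
       (forall s, 0 <= s <= 1 -> h (s, 0) = g 0 /\ h (s, 1) = g 0)).

Section Nilmanifold.
Context {R : realType} {m : nat} {G : lieGroupType R m}.
Variable Gamma : subgroup G.

Definition nilmanifold := quotient_topology (left_quotient Gamma).

Definition nil_proj (x : G) : nilmanifold :=
  (\pi_(left_quotient Gamma) x)%qT.

(* Discrete and cocompact, i.e. a lattice of maximal rank. *)
Definition lattice : Prop :=
  (exists2 U : set G, nbhs 1%g U & U `&` Gamma = [set 1%g]) /\
  compact [set: nilmanifold].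

Lemma nil_pull_subproof (f : smooth_fun nil_proj) :
  (f \o nil_proj : G -> R^o) \in smooth_pred (@id G).
Proof. exact/asboolP/(smooth_valE f). Qed.

Definition nil_pull (f : smooth_fun nil_proj) : smooth_fun (@id G) :=
  SmoothFun (nil_pull_subproof f).

End Nilmanifold.

Section Complexification.

(* V (x) C, the pair (x, y) standing for x + i y. *)
Record cplx (V : Type) := Cplx { cre : V ; cim : V }.

Definition cplx_pair V (z : cplx V) := (cre z, cim z).
Definition pair_cplx V (z : V * V) := Cplx z.1 z.2.
Lemma cplx_pairK V : cancel (@cplx_pair V) (@pair_cplx V).
Proof. by case. Qed.

HB.instance Definition _ (V : choiceType) :=
  Choice.copy (cplx V) (can_type (@cplx_pairK V)).

Section Zmodule.
Variable V : zmodType.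
Implicit Types x y z : cplx V.

Definition cplx_add x y := Cplx (cre x + cre y) (cim x + cim y).
Definition cplx_opp x := Cplx (- cre x) (- cim x).

Fact cplx_addA : associative cplx_add.
Proof. by move=> [a b] [c d] [e f]; rewrite /cplx_add /= !addrA. Qed.
Fact cplx_addC : commutative cplx_add.
Proof. by move=> [a b] [c d]; congr Cplx; rewrite addrC. Qed.
Fact cplx_add0 : left_id (Cplx 0 0) cplx_add.
Proof. by move=> [a b]; rewrite /cplx_add /= !add0r. Qed.
Fact cplx_addN : left_inverse (Cplx 0 0) cplx_opp cplx_add.
Proof. by move=> [a b]; rewrite /cplx_add /= !addNr. Qed.

HB.instance Definition _ :=
  GRing.isZmodule.Build (cplx V) cplx_addA cplx_addC cplx_add0 cplx_addN.

Definition cplx_conj x := Cplx (cre x) (- cim x).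
Definition cplx_muli x := Cplx (- cim x) (cre x).

End Zmodule.

Definition cplx_map V W (f : V -> W) (z : cplx V) := Cplx (f (cre z)) (f (cim z)).

Definition cplx_bilin V1 V2 (W : zmodType) (op : V1 -> V2 -> W)
    (x : cplx V1) (y : cplx V2) : cplx W :=
  Cplx (op (cre x) (cre y) - op (cim x) (cim y))
       (op (cre x) (cim y) + op (cim x) (cre y)).

End Complexification.

(* Complex-valued differential forms and their bigrading over a Lie algebra L of
   vector fields, given as an A-module with a bracket, an action by derivations
   of A (the anchor), and an endomorphism J. It is used twice:
   - A = C^oo(M), L = vector fields on M, anchor = the action of vector fields
     on functions: alternating_form is the space of smooth complex forms on M,
     dform the exterior derivative;
   - A = R, L = g, anchor = 0: alternating_form is the exterior algebra of the
     dual of g_C, dform the Chevalley-Eilenberg differential.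
   A form is evaluated on sequences of complexified fields of any length, hence
   is a family with one component in each degree. *)
Section Forms.
Context {K : fieldType} {A : comAlgType K} {L : lmodType A}.
Variables (anchor : L -> A -> A) (bracket : L -> L -> L) (J : L -> L).

Definition complex_structure : Prop :=
  [/\ forall (a : A) X Y, J (a *: X + Y) = a *: J X + J Y,
      forall X, J (J X) = - X &
      forall X Y, bracket (J X) (J Y) - J (bracket (J X) Y)
                  - J (bracket X (J Y)) - bracket X Y = 0].

Local Notation LC := (cplx L).
Local Notation AC := (cplx A).
Implicit Types (w : seq LC -> AC) (s : seq LC) (p q : int).

Definition alternating_form w : Prop :=
  (forall s1 s2 (a : AC) (X Y : LC),
     w (s1 ++ cplx_bilin *:%R a X + Y :: s2) =
     cplx_bilin *%R a (w (s1 ++ X :: s2)) + w (s1 ++ Y :: s2)) /\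
  (forall s1 s2 s3 (X : LC), w (s1 ++ X :: s2 ++ X :: s3) = 0).

Definition omit s i := take i s ++ drop i.+1 s.

(* Koszul formula:
   (d w)(X_0, ..., X_k) = \sum_i (-1)^i X_i (w(..^X_i..))
     + \sum_(i < j) (-1)^(i + j) w([X_i, X_j], ..^X_i..^X_j..) *)
Definition dform w : seq LC -> AC := fun s =>
  \sum_(i < size s) cplx_bilin anchor s`_i (w (omit s i)) *~ (-1) ^+ i
  + \sum_(j < size s) \sum_(i < j)
      w (cplx_bilin bracket s`_i s`_j :: omit (omit s j) i) *~ (-1) ^+ (i + j).

Definition type10 (Z : LC) : Prop := cplx_map J Z = cplx_muli Z.
Definition type01 (Z : LC) : Prop := cplx_map J Z = - cplx_muli Z.

(* p and q are integers, and there is no nonzero form of bidegree (p, q) when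
   one of them is negative; this covers (n - 2, _) for n < 2. The condition
   forces w to vanish in degrees other than p + q. *)
Definition pq_form p q w : Prop :=
  alternating_form w /\
  forall s1 s2, (forall Z, Z \in s1 -> type10 Z) ->
    (forall Z, Z \in s2 -> type01 Z) ->
    ((size s1)%:Z, (size s2)%:Z) <> (p, q) -> w (s1 ++ s2) = 0.

Definition real_form w : Prop :=
  forall s, w (map (@cplx_conj L) s) = cplx_conj (w s).

Definition proj10 (Z : LC) : LC :=
  cplx_map ( *:%R (2^-1 : K)%:A) (Z - cplx_muli (cplx_map J Z)).
Definition proj01 (Z : LC) : LC :=
  cplx_map ( *:%R (2^-1 : K)%:A) (Z + cplx_muli (cplx_map J Z)).

(* The (p, q)-component: expand each argument as proj10 Z + proj01 Z and keep
   the terms with p arguments of type (1,0) and q of type (0,1). *)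
Definition pq_part p q w : seq LC -> AC := fun s =>
  \sum_(b : (size s).-tuple bool |
      ((count id b)%:Z == p) && ((count negb b)%:Z == q))
    w [seq if c.1 then proj10 c.2 else proj01 c.2 | c <- zip b s].

(* The operators on forms of bidegree (p, q). *)
Definition del p q w := pq_part (p + 1) q (dform w).
Definition delbar p q w := pq_part p (q + 1) (dform w).

Definition weak_ddbar_lemma (n : nat) : Prop :=
  let N : int := n%:Z in
  forall phi, pq_form (N - 1) (N - 1) phi -> real_form phi ->
  (exists eta, pq_form (N - 2) N eta /\
     delbar (N - 1) (N - 1) phi =1 del (N - 2) N eta) ->
  exists psi, pq_form (N - 2) (N - 1) psi /\
    forall s, delbar (N - 1) (N - 1) phi s =
      cplx_muli (del (N - 2) N (delbar (N - 2) (N - 1) psi) s).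

End Forms.

Section Instances.
Context {R : realType} {m : nat} {G : lieGroupType R m}.

Definition lie_complex_structure (J : lie_algebra G -> lie_algebra G) : Prop :=
  @complex_structure R R^o (lie_algebra G) lie_bracket J.

Definition lie_weak_ddbar (J : lie_algebra G -> lie_algebra G) n : Prop :=
  @weak_ddbar_lemma R R^o (lie_algebra G) (fun _ _ => 0) lie_bracket J n.

Variable Gamma : subgroup G.
Local Notation vect := (derivation (smooth_fun (nil_proj Gamma))).

Definition nil_complex_structure (J : vect -> vect) : Prop :=
  complex_structure derivation_bracket J.

Definition nil_weak_ddbar (J : vect -> vect) n : Prop :=
  weak_ddbar_lemma (fun (X : vect) f => X f) derivation_bracket J n.

(* The left-invariant field X descends to the field Y on the quotient. *)
Definition proj_related (X : lie_algebra G) (Y : vect) : Prop :=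
  forall f, X (nil_pull f) = nil_pull (Y f).

(* J' is the structure on the quotient induced by J. *)
Definition induced_structure (J : lie_algebra G -> lie_algebra G)
    (J' : vect -> vect) : Prop :=
  forall X Y, proj_related X Y -> proj_related (J X) (J' Y).

End Instances.
Arguments simply_connected R T : clear implicits.

(* Main.v *)
Require Import Defs.
From HB Require Import structures.
From mathcomp Require Import all_boot all_order all_algebra.
From mathcomp Require Import all_classical all_reals all_analysis.
From mathcomp Require Import generic_quotient ring lra.

(** Suppose that M satisfies the weak lemma, and let phi and eta be invariant
    forms, that is, forms on the Lie algebra, with delbar phi = del eta. They
    extend to forms on M with the same property, so there is a form psi on M
    with delbar phi = i del delbar psi. Let av(psi)(X_1, .., X_k) be the mean
    over M of the function psi(X_1, .., X_k), for left-invariant X_j. A mean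
    that kills every derivative X f makes the terms X_i (psi(..)) of the Koszul
    formula disappear, so av commutes with d ([avg_dform]); it commutes with the
    projections to types because J is invariant ([avg_pq_part]). Hence av(psi)
    solves the equation on the Lie algebra ([nil_ddbar_descends]).

    The mean is only required to be a linear functional on smooth functions
    which is 1 on the constant 1 and 0 on every X f ([invariant_functional]).
    By linear algebra ([separating_functional]) it exists unless 1 is a sum of
    functions X_i f_i. As M is compact, X_i f_i is a uniform limit of difference
    quotients of f_i along a curve in G ([curve_diff_quotient]). So such a sum
    would provide finitely many bounded functions f_i on G, elements g_i and
    c > 0 with sum_i (f_i (x g_i) - f_i x) >= c for all x, against the
    amenability of the nilpotent group G ([nilpotent_no_gap]), which is proved
    by averaging over powers of elements along the upper central series.

    Forms on the Lie algebra extend to M because the left-invariant fields are a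
    basis of the module of derivations of smooth functions on M
    ([frame_decomp]). Indeed a derivation is determined at a point by its values
    on coordinates, by Hadamard's lemma ([hadamard0], [local_coords],
    [point_derivation_eq0]). The coordinates are multiplied by cutoff functions
    and made periodic under Gamma, which is discrete ([periodize]). Cramer's
    rule shows that the coefficients in the basis are smooth ([coef_smooth]).
    The equality delbar phi = del eta passes from the Lie algebra to all vector
    fields on M because the Koszul differential of a form is multilinear over
    the functions ([koszul_multilin]). *)

Set Implicit Arguments.
Unset Strict Implicit.
Unset Printing Implicit Defensive.

Import Order.TTheory GRing.Theory Num.Theory.
Import numFieldNormedType.Exports.

Local Open Scope classical_set_scope.
Local Open Scope ring_scope.

(** * Amenability of nilpotent groups *)

Section Amenability.
Context {R : realType} {G : groupType}.
Implicit Types (S T : set G) (f phi psi : G -> R).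

Definition bounded_fun f := exists B : R, forall x, `|f x| <= B.

(** The sums of n terms f (x h) - f x with h in S and f bounded. The number of
    terms is recorded for the induction in [no_gap_central], where averaging
    over the powers of an element of T must keep the number of terms from T. *)
Inductive coboundary S : nat -> (G -> R) -> Prop :=
| Coboundary0 : coboundary S 0 (fun=> 0)
| CoboundaryS n h f phi : S h -> bounded_fun f -> coboundary S n phi ->
    coboundary S n.+1 (fun x => f (x * h)%g - f x + phi x).

(** Equivalent, by separation, to the existence of a mean on the bounded
    functions that is invariant under S. *)
Definition no_gap S := forall n phi, coboundary S n phi ->
  forall c : R, 0 < c -> exists x, phi x < c.

Lemma coboundaryD S n phi m psi : coboundary S n phi -> coboundary S m psi ->
  exists k, coboundary S k (fun x => phi x + psi x).
Proof.
move=> + Hpsi; elim=> [|n' h f phi' Sh bf _ [k IH]].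
  by exists m; under eq_fun do rewrite add0r.
by exists k.+1; under eq_fun do rewrite -addrA; exact: CoboundaryS.
Qed.

Lemma coboundary_sum S (I : Type) (r : seq I) (F : I -> G -> R) :
  (forall i, exists n, coboundary S n (F i)) ->
  exists n, coboundary S n (fun x => \sum_(i <- r) F i x).
Proof.
move=> HF; elim: r => [|i r [n IH]].
  by exists 0; under eq_fun do rewrite big_nil; exact: Coboundary0.
have [m Hm] := HF i; have [k Hk] := coboundaryD Hm IH.
by exists k; under eq_fun do rewrite big_cons.
Qed.

Definition avg K (g : G) f : G -> R :=
  fun x => K%:R^-1 * \sum_(a < K) f (x * g ^+ a)%g.

Lemma bounded_fun_translate f (k : G) (c : R) :
  bounded_fun f -> bounded_fun (fun x => c * f (x * k)%g).
Proof.
by move=> [B HB]; exists (`|c| * B) => x; rewrite normrM ler_wpM2l.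
Qed.

Lemma bounded_fun_avg K g f : bounded_fun f -> bounded_fun (avg K g f).
Proof.
move=> [B HB]; exists (`|K%:R^-1| * (\sum_(a < K) B)) => x.
rewrite normrM ler_wpM2l//; apply: (le_trans (ler_norm_sum _ _ _)).
exact: ler_sum.
Qed.

(** An average of right translates by powers of g turns the term of h into terms
    of conjugates of h. *)
Lemma avg_conj S g n phi K : (forall h y, S h -> S (h ^ y)%g) ->
  coboundary S n phi -> exists m, coboundary S m (avg K g phi).
Proof.
move=> SJ; elim=> [|n' h f phi' Sh bf _ [m IH]].
  exists 0; rewrite /avg; under eq_fun do rewrite big1// mulr0.
  exact: Coboundary0.
pose F (a : 'I_K) x := K%:R^-1 * f (x * (h ^ (g ^- a)) * g ^+ a)%g
    - K%:R^-1 * f (x * g ^+ a)%g + 0.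
have [k Hk] : exists k, coboundary S k (fun x => \sum_(a < K) F a x).
  apply: coboundary_sum => a; exists 1; rewrite /F.
  apply: (CoboundaryS (f := fun x => K%:R^-1 * f (x * g ^+ a)%g)).
  - exact: SJ.
  - exact: bounded_fun_translate.
  - exact: Coboundary0.
have [j Hj] := coboundaryD Hk IH; exists j.
suff -> : avg K g (fun x => f (x * h)%g - f x + phi' x) =
  fun x => \sum_(a < K) F a x + avg K g phi' x by [].
apply/funext => x; rewrite /avg /F mulr_sumr [in RHS]mulr_sumr -big_split /=.
apply: eq_bigr => a _; rewrite addr0 mulrDr mulrBr; congr (_ * f _ - _ + _).
by rewrite conjgE invgK !mulgA mulgVK.
Qed.

(** Moving h across a power of g costs a commutator, which is in S. So the average
    of the term of h is the term of h for the averaged function, up to terms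
    from S. *)
Lemma avg_central S T g n phi K :
  (forall h y, S h -> S (h ^ y)%g) ->
  (forall h y, T h -> S [~ h, y]%g) ->
  coboundary T n phi ->
  exists phi' psi m, [/\ coboundary T n phi', coboundary S m psi &
    avg K g phi = fun x => phi' x + psi x].
Proof.
move=> SJ TS; elim=> [|n' h f phi' Th bf _ [phi1 [psi1 [m [H1 H2 H3]]]]].
  exists (fun=> 0), (fun=> 0), 0; split; [exact: Coboundary0|exact: Coboundary0|].
  by apply/funext => x; rewrite /avg big1// mulr0 addr0.
pose z a := ([~ h, g ^- a] ^ (h^-1))%g.
pose F (a : 'I_K) x := K%:R^-1 * f (x * z a * (h * g ^+ a))%g
    - K%:R^-1 * f (x * (h * g ^+ a))%g + 0.
have [k Hk] : exists k, coboundary S k (fun x => \sum_(a < K) F a x).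
  apply: coboundary_sum => a; exists 1; rewrite /F.
  apply: (CoboundaryS (f := fun x => K%:R^-1 * f (x * (h * g ^+ a))%g)).
  - by apply: SJ; exact: TS.
  - exact: bounded_fun_translate.
  - exact: Coboundary0.
have [j Hj] := coboundaryD Hk H2.
exists (fun x => avg K g f (x * h)%g - avg K g f x + phi1 x).
exists (fun x => \sum_(a < K) F a x + psi1 x), j; split => //.
  apply: CoboundaryS => //; exact: bounded_fun_avg.
apply/funext => x; have := congr1 (fun u => u x) H3; rewrite /avg /= => H3x.
rewrite addrACA -H3x /F !mulr_sumr -sumrB -2!big_split /=.
apply: eq_bigr => a _; rewrite addr0 mulrDr mulrBr; congr (_ + _).
have -> : (x * g ^+ a * h = x * z a * (h * g ^+ a))%g.
  by rewrite /z commgEl !conjgE !invgK !mulgA !(mulgVK, mulgK, mulgV, mulVg, mul1g).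
rewrite !mulgA; ring.
Qed.

(** The sum over the powers of g telescopes. *)
Lemma avg_coboundary (g : G) f (B : R) K x : (forall x, `|f x| <= B) ->
  avg K g (fun x => f (x * g)%g - f x) x <= K%:R^-1 * (B + B).
Proof.
move=> HB; rewrite /avg ler_wpM2l//.
have -> : \sum_(a < K) (f (x * g ^+ a * g)%g - f (x * g ^+ a)%g) =
    f (x * g ^+ K)%g - f x.
  elim: K => [|K IH]; first by rewrite big_ord0 expg0 mulg1 subrr.
  by rewrite big_ord_recr /= IH expgSr mulgA; ring.
by have := HB (x * g ^+ K)%g; have := HB x; rewrite !ler_norml; lra.
Qed.

(** Induction on the number of terms from T. Averaging over K powers of the element
    h of the first one makes this term smaller than any given constant and
    changes the others only by terms from S. *)
Lemma no_gap_central S T :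
  (forall h y, S h -> S (h ^ y)%g) ->
  (forall h y, T h -> S [~ h, y]%g) -> no_gap S -> no_gap T.
Proof.
move=> SJ TS gS.
suff H n phi m psi : coboundary T n phi -> coboundary S m psi ->
    forall c : R, 0 < c -> exists x, phi x + psi x < c.
  move=> n phi Hphi c c0.
  have [x Hx] := H _ _ _ _ Hphi (Coboundary0 S) c c0.
  by exists x; rewrite addr0 in Hx.
elim: n phi m psi => [|n IH] phi m psi Hphi Hpsi c c0.
  inversion Hphi; subst; have [x Hx] := gS _ _ Hpsi c c0.
  by exists x; rewrite add0r.
inversion Hphi as [|n' h f phi' Th [B HB] Hphi' en ephi]; subst.
(* So many powers that the average of the term of h is at most c / 2. *)
pose K := (Num.truncn ((B + B) * 2 / c)).+1.
have [phi1 [psi1 [k [H1 H2 H3]]]] := avg_central h K SJ TS Hphi'.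
have [k' H4] := avg_conj h K SJ Hpsi.
have [k'' H5] := coboundaryD H2 H4.
have [x Hx] := IH _ _ _ H1 H5 (c / 2) ltac:(by rewrite divr_gt0).
apply/not_existsP => Hc.
have : c <= avg K h (fun x => f (x * h)%g - f x + phi' x + psi x) x.
  rewrite /avg ler_pdivlMl ?ltr0Sn//.
  rewrite -[K in K%:R * c]card_ord mulr_natl -sumr_const.
  by apply: ler_sum => a _; rewrite leNgt; apply/negP => /Hc.
have -> : avg K h (fun x => f (x * h)%g - f x + phi' x + psi x) x =
  avg K h (fun x => f (x * h)%g - f x) x + (phi1 x + (psi1 x + avg K h psi x)).
  have H3x : phi1 x + psi1 x = avg K h phi' x by rewrite H3.
  rewrite [X in _ = _ + X]addrA H3x.
  rewrite /avg -!mulrDr -!big_split /=; congr (_ * _); apply: eq_bigr => a _; ring.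
have E := avg_coboundary h K x HB.
have : K%:R^-1 * (B + B) <= c / 2.
  have : (B + B) * 2 / c < K%:R by exact: truncnS_gt.
  rewrite ltr_pdivrMr// ler_pdivrMl ?ltr0Sn// mulrA ler_pdivlMr//.
  exact: ltW.
lra.
Qed.

Lemma upper_centerJ k (h y : G) :
  upper_center k h -> upper_center k (h ^ y)%g.
Proof.
elim: k h y => [|k IH] h y /=; first by move=> ->; rewrite conj1g.
move=> H z.
have -> : ([~ h ^ y, z] = [~ h, z ^ (y^-1)] ^ y)%g.
  by rewrite conjRg -conjgM mulVg conjg1.
exact/IH/H.
Qed.

(** Induction along the upper central series; the elements of each step commute
    with all others modulo the previous step. *)
Lemma nilpotent_no_gap : nilpotent_group G -> no_gap setT.
Proof.
case=> k <-; elim: k => [|k IH].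
  move=> n phi Hphi c c0; exists 1%g.
  suff -> : phi 1%g = 0 by [].
  elim: Hphi => //= n' h f phi' -> _ _ ->; by rewrite mulg1 subrr addr0.
apply: no_gap_central IH => [h y|h y Hh]; [exact: upper_centerJ|exact: Hh].
Qed.

End Amenability.

(** * Linear functionals with prescribed kernel *)

(** A subspace M containing S and maximal among those without e is a hyperplane
    with M + K e = V; the functional is the coordinate along e. *)
Lemma separating_functional (K : fieldType) (V : lmodType K) (S : set V) (e : V) :
  S 0 -> (forall a x y, S x -> S y -> S (a *: x + y)) -> ~ S e ->
  exists I : V -> K, [/\ forall a x y, I (a *: x + y) = a * I x + I y,
    forall x, S x -> I x = 0 & I e = 1].
Proof.
move=> S0 Slin Se.
pose sub (A : set V) := A 0 /\ forall a x y, A x -> A y -> A (a *: x + y).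
(* The empty set is included for the union of the empty chain. *)
pose P (A : set V) := A = set0 \/ [/\ S `<=` A, sub A & ~ A e].
have [M [PM maxM]] : exists A, P A /\ forall B, A `<` B -> ~ P B.
  apply: Zorn_bigcup => F FP Ftot.
  have [[A FA An0]|none] := pselect (exists2 A, F A & A <> set0); last first.
    left; apply/seteqP; split => // x [A FA Ax].
    by case: none; exists A => // A0; rewrite A0 in Ax.
  have H B : F B -> B <> set0 -> [/\ S `<=` B, sub B & ~ B e].
    by move=> /FP [].
  right; split.
  - move=> x Sx; exists A => //; have [SA _ _] := H _ FA An0; exact: SA.
  - split; first by exists A => //; have [_ [] ] := H _ FA An0.
    move=> a x y [B FB Bx] [C FC Cy].
    have [BC|CB] := Ftot _ _ FB FC.
      exists C => //; have [|_ [_ Hl] _] := H C FC; first by move=> C0; rewrite C0 in Cy.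
      by apply: Hl => //; exact: BC.
    exists B => //; have [|_ [_ Hl] _] := H B FB; first by move=> C0; rewrite C0 in Bx.
    by apply: Hl => //; exact: CB.
  - move=> [B FB Be]; have [|_ _] := H B FB; last exact.
    by move=> C0; rewrite C0 in Be.
case: PM => [M0|[SM [M0 Mlin] Me]].
  exfalso; apply: (maxM S); last by right; split => //; split.
  rewrite M0 properEneq; split; last exact: sub0set.
  by apply/eqP => S00; move: S0; rewrite -S00.
have dec x : exists r : K, M (x - r *: e).
  have [Mx|Mx] := pselect (M x); first by exists 0; rewrite scale0r subr0.
  pose B := [set z | exists r : K, M (z - r *: x)].
  have MB : M `<=` B by move=> z Mz; exists 0; rewrite scale0r subr0.
  have Be : B e.
    apply: contrapT => nBe; apply: (maxM B).
      rewrite properEneq; split => //; apply/eqP => E; apply: Mx; rewrite E.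
      by exists 1; rewrite scale1r subrr.
    right; split => //; first exact: subset_trans MB.
    split; first exact: MB.
    move=> a y z [r Hr] [s Hs]; exists (a * r + s).
    have := Mlin a _ _ Hr Hs; congr (M _).
    by rewrite scalerBr scalerDl scalerA opprD addrACA.
  have [r Hr] := Be; have r0 : r != 0.
    by apply/eqP => r0; rewrite r0 scale0r subr0 in Hr.
  exists r^-1; have := Mlin (- r^-1) _ _ Hr M0; congr (M _).
  by rewrite addr0 scalerBr scaleNr scaleNr opprK scalerA mulVf// scale1r addrC.
have [I HI] := choice dec.
have uniq x r s : M (x - r *: e) -> M (x - s *: e) -> r = s.
  move=> Hr Hs; apply: contrapT => /eqP rs.
  have := Mlin (-1) _ _ Hr Hs; rewrite scaleN1r opprB addrA subrK -scalerBl => H.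
  apply: Me; have := Mlin (r - s)^-1 _ _ H M0.
  by rewrite addr0 scalerA mulVf ?scale1r// subr_eq0.
exists I; split.
- move=> a x y; apply: (@uniq (a *: x + y)) => //.
  have := Mlin a _ _ (HI x) (HI y); congr (M _).
  by rewrite scalerBr scalerDl scalerA opprD addrACA.
- by move=> x Sx; apply: (@uniq x) => //; rewrite scale0r subr0; exact: SM.
- by apply: (@uniq e) => //; rewrite scale1r subrr.
Qed.

(** * Calculus of C^k maps *)

Section CkCalculus.
Context {R : realType}.
Implicit Types V W : normedModType R.

(** The conditions defining C^k bear on the points of U one at a time, so the sets
    U' can be arbitrary. *)
Lemma Ck_cover V W k (U : set V) (f : V -> W) :
  (forall x, U x -> exists2 U', U' x & Ck k U' f) -> Ck k U f.
Proof.
elim: k f => [|k IH] f H /=.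
  by move=> x Ux; have [U' U'x] := H x Ux; exact.
split=> [x Ux|v]; first by have [U' U'x [+ _]] := H x Ux; exact.
by apply: IH => x Ux; have [U' U'x [_ DU]] := H x Ux; exists U'; last exact: DU.
Qed.

Lemma Ck_sub V W k (U U' : set V) (f : V -> W) :
  U' `<=` U -> Ck k U f -> Ck k U' f.
Proof. by move=> U'U H; apply: Ck_cover => x /U'U Ux; exists U. Qed.

Lemma CkD V W k (U : set V) (f g : V -> W) : open U ->
  Ck k U f -> Ck k U g -> Ck k U (fun x => f x + g x).
Proof. by move=> oU Cf Cg; have := Ck_lin 1 oU Cf Cg; rewrite scale1r. Qed.

Lemma CkZ V W k (U : set V) (f : V -> W) (a : R) : open U ->
  Ck k U f -> Ck k U (fun x => a *: f x).
Proof.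
move=> oU Cf; have := Ck_lin a oU Cf (Ck_cst k U 0).
by apply: Ck_ext => // x _; rewrite [LHS]addr0.
Qed.

Lemma Ck_sum V W k (U : set V) (I : Type) (r : seq I) (f : I -> V -> W) :
  open U -> (forall i, Ck k U (f i)) -> Ck k U (fun x => \sum_(i <- r) f i x).
Proof.
move=> oU Cf; elim: r => [|i r IH].
  by apply: Ck_ext (Ck_cst k U 0) => // x _; rewrite big_nil.
by apply: Ck_ext (CkD oU (Cf i) IH) => // x _; rewrite big_cons.
Qed.

Lemma derive_affine V V' W (L : V -> V') (L0 : V -> V') (f : V' -> W) x v :
  (forall x t v, L (t *: v + x) = t *: L0 v + L x) ->
  'D_v (f \o L) x = 'D_(L0 v) f (L x).
Proof.
move=> HL; rewrite /derive; set u := (X in lim (X @ _)).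
set w := (X in _ = lim (X @ _)); suff -> : u = w by [].
by apply/funext => t; rewrite /u /w /= HL.
Qed.

(** L0 is the linear part of L. The derivatives of f \o L are derivatives of f
    composed with L, so that no chain rule between arbitrary spaces is
    involved. *)
Lemma Ck_affine V V' W (L : V -> V') (L0 : V -> V') k (U : set V) (U' : set V')
    (f : V' -> W) :
  (forall x t v, L (t *: v + x) = t *: L0 v + L x) ->
  (forall x, differentiable L x) ->
  U `<=` L @^-1` U' -> Ck k U' f -> Ck k U (f \o L).
Proof.
move=> HL dL UU'; elim: k f => [|k IH] f /=.
  move=> cf x Ux; apply: continuous_comp; last exact/cf/UU'.
  exact: differentiable_continuous.
move=> [df Df]; split=> [x Ux|v].
  by apply: differentiable_comp => //; exact/df/UU'.
have -> : (fun x => 'D_v (f \o L) x) = (fun x => 'D_(L0 v) f x) \o L.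
  by apply/funext => x; exact: derive_affine.
exact/IH/Df.
Qed.

Lemma Ck_coord V m k (U : set V) (h : V -> 'rV[R]_m) j : open U ->
  Ck k U h -> Ck k U (fun x => h x 0 j).
Proof.
move=> oU; elim: k h => [|k IH] h /=.
  move=> ch x Ux; apply: (@continuous_comp _ _ _ h (fun M : 'rV_m => M 0 j)).
    exact: ch.
  exact: coord_continuous.
move=> [dh Dh]; split=> [x Ux|v].
  apply: (@differentiable_comp _ _ _ _ h (fun M : 'rV_m => M 0 j)); first exact: dh.
  exact: differentiable_coord.
apply: Ck_ext (IH _ (Dh v)) => // x Ux.
have dhx : derivable h x v by exact/diff_derivable/dh.
by rewrite (derive_mx dhx) mxE.
Qed.

Lemma derive_rV m (g : 'rV[R]_m -> R) y (v : 'rV[R]_m) : differentiable g y ->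
  'D_v g y = \sum_j v 0 j * 'D_(delta_mx 0 j) g y.
Proof.
move=> dg; rewrite deriveE// {1}(row_sum_delta v) linear_sum.
by apply: eq_bigr => j _; rewrite linearZ /= deriveE.
Qed.

Lemma derive_comp V m (h : V -> 'rV[R]_m) (g : 'rV[R]_m -> R) x v :
  differentiable h x -> differentiable g (h x) ->
  'D_v (g \o h) x = \sum_j 'D_v h x 0 j * 'D_(delta_mx 0 j) g (h x).
Proof.
move=> dh dg; rewrite deriveE; last exact: differentiable_comp.
by rewrite diff_comp// /comp -deriveE// -deriveE// derive_rV.
Qed.

(** The intermediate space has coordinates, so the derivative of the composite is a
    sum of products to which the induction on k applies. *)
Lemma Ck_comp V m k (U : set V) (U' : set 'rV[R]_m) (h : V -> 'rV[R]_m)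
    (g : 'rV[R]_m -> R) : open U ->
  U `<=` h @^-1` U' -> Ck k U h -> Ck k U' g -> Ck k U (g \o h).
Proof.
move=> oU UU'; elim: k h g UU' => [|k IH] h g UU'.
  by move=> ch cg x Ux; apply: continuous_comp; [exact: ch|exact/cg/UU'].
move=> Ch Cg; have [[dh Dh] [dg Dg]] := (Ch, Cg); split=> [x Ux|v].
  by apply: differentiable_comp; [exact: dh|exact/dg/UU'].
pose F j x := 'D_v h x 0 j * 'D_(delta_mx 0 j) g (h x).
apply: (@Ck_ext _ _ _ _ _ (fun x => \sum_j F j x)) => // [x Ux|].
  by rewrite derive_comp//; [exact: dh|exact/dg/UU'].
apply: Ck_sum => // j.
apply: (@Ck_mul _ _ _ _ (fun x => 'D_v h x 0 j)) => //.
  exact/Ck_coord/Dh.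
by apply: (IH h _ UU') (Dg _); exact: Ck_prev.
Qed.

(** For a family of functions of one variable closed under derivation up to an
    operation D on the indices, the derivatives of F j \o f are products of
    F (D j) \o f with derivatives of f. *)
Lemma Ck_family V (T : Type) (F : T -> R -> R) (D : T -> T) (k : nat) (U : set V)
    (f : V -> R) (j : T) : open U ->
  (forall (i : T) (x : R), is_derive x 1 (F i) (F (D i) x)) ->
  Ck k U f -> Ck k U (F j \o f).
Proof.
move=> oU HF; have dF i x : differentiable (F i) x.
  by apply/derivable1_diffP; have [] := HF i x.
elim: k f j => [|k IH] f j.
  move=> cf x Ux; apply: continuous_comp; first exact: cf.
  exact: differentiable_continuous.
move=> Cf; have [df Df] := Cf; split=> [x Ux|v].
  by apply: differentiable_comp => //; exact: df.
have Cg := Ck_mul oU (Df v) (IH f (D j) (Ck_prev Cf)).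
apply: Ck_ext Cg => // x Ux.
rewrite deriveE; last by apply: differentiable_comp => //; exact: df.
rewrite diff_comp//; last exact: df.
rewrite /comp -(deriveE v); last exact: df.
rewrite /= -[X in _ = 'd _ _ X]mulr1 -[_ * 1]/(_ *: 1) linearZ /= -deriveE//.
by have [_ ->] := HF j (f x).
Qed.

Lemma CkV V k (U : set V) (f : V -> R) : open U -> (forall x, U x -> f x != 0) ->
  Ck k U f -> Ck k U (fun x => (f x)^-1).
Proof.
move=> oU f0; elim: k => [|k IH].
  by move=> cf x Ux; apply: (@cvgV _ _ _ _ f); [exact: f0|exact: cf].
move=> Cf; have [df Df] := Cf; split=> [x Ux|v].
  by apply: (@differentiableV _ _ f); [exact: df|exact: f0].
have CI := IH (Ck_prev Cf).
have := CkZ (-1) oU (Ck_mul oU (Ck_mul oU CI CI) (Df v)).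
apply: Ck_ext => // x Ux.
have dfx : derivable f x v by exact/diff_derivable/df.
rewrite (@deriveV _ _ f)//; last exact: f0.
by rewrite scaleN1r scaleNr /= -exprVn expr2.
Qed.

End CkCalculus.

(** * Cutoff functions *)

Section Bump.
Context {R : realType}.
Implicit Types (P Q : {poly R}) (x y : R).

(** The functions P(1/x) exp(-1/x), extended by 0 to x <= 0. Closed under
    derivation, they are the standard example of smooth functions that vanish on
    a half-line. *)
Definition flat P x : R := if 0 < x then P.[x^-1] * expR (- x^-1) else 0.

(** exp y = exp(y/i)^i >= (y/i)^i for every i > 0, which bounds the monomials. *)
Lemma exp_dominates Q : exists C : R, forall y, 0 < y -> `|Q.[y]| <= C * expR y.
Proof.
exists (\sum_(i < size Q) `|Q`_i| * i%:R ^+ i) => y y0.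
rewrite horner_coef; apply: le_trans (ler_norm_sum _ _ _) _.
rewrite mulr_suml; apply: ler_sum => i _.
rewrite normrM -mulrA ler_wpM2l// ger0_norm ?exprn_ge0 ?(ltW y0)//.
case: (nat_of_ord i) => [|n]; first by rewrite !expr0 mul1r; apply: ltW; rewrite expR_gt1.
have {1 2}-> : y = n.+1%:R * (y / n.+1%:R) by rewrite mulrC divfK.
rewrite exprMn ler_wpM2l ?exprn_ge0//.
rewrite expRM_natl lerXn2r ?nnegrE ?expR_ge0 ?divr_ge0 ?(ltW y0)//.
by apply: le_trans (expR_ge1Dx _); rewrite lerDr.
Qed.

(** At 0, the bound on X^2 P by a multiple of exp gives |flat P x| <= C x^2, hence
    derivative 0. *)
Lemma is_derive_flat P x : is_derive x 1 (flat P) (flat ('X^2 * (P - P^`())) x).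
Proof.
have [x0|x0|->] := ltgtP x 0.
- have -> : flat ('X^2 * (P - P^`())) x = 0 by rewrite /flat ltNge ltW.
  apply: (@near_eq_is_derive _ _ _ (cst 0)).
  near=> z; rewrite /flat ltNge ltW//.
  by near: z; exact: lt_nbhsl.
- rewrite [flat (_ * _) x]/flat x0.
  pose f := fun z : R => P.[z^-1] * expR (- z^-1).
  apply: (@near_eq_is_derive _ _ _ f).
    near=> z; rewrite /flat /f ifT//.
    by near: z; exact: lt_nbhsr.
  have dV : is_derive x 1 (fun z : R => z^-1) (- x^-2).
    split; first by apply: derivableV => //; exact: lt0r_neq0.
    rewrite deriveV ?lt0r_neq0// derive_id scaleNr.
    by rewrite [X in - X]mulr1.
  have d1 : is_derive x 1 (horner P \o (fun z : R => z^-1)) (P^`().[x^-1] * - x^-2).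
    exact: is_derive1_comp.
  have d2 : is_derive x 1 (expR \o (fun z : R => - z^-1)) (expR (- x^-1) * x^-2).
    have dN : is_derive x 1 (fun z : R => - z^-1) (x^-2).
      by rewrite -[x^-2]opprK; exact: is_deriveN.
    exact: is_derive1_comp.
  have d3 := is_deriveM d1 d2.
  apply: (is_derive_eq (f := f) d3).
  rewrite /= !hornerE -[_ *: _]/(_ * _) -[X in _ + X]/(_ * _) /=.
  rewrite -!exprVn.
  ring.
- rewrite [flat (_ * _) 0]/flat ltxx.
  have [C HC] := exp_dominates ('X^2 * P).
  have flatC z : `|flat P z| <= `|C| * z ^+ 2.
    rewrite /flat; case: ifPn => [z0|_]; last by rewrite normr0 mulr_ge0 ?sqr_ge0.
    have := HC z^-1; rewrite invr_gt0 => /(_ z0); rewrite !hornerE normrM.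
    rewrite exprVn normfV (ger0_norm (sqr_ge0 z)) => H.
    rewrite normrM [`|expR _|]ger0_norm ?expR_ge0// expRN.
    rewrite ler_pdivrMr ?expR_gt0//.
    rewrite mulrC ler_pdivrMr ?exprn_gt0// in H.
    apply: le_trans H _; rewrite [leRHS](_ : _ = `|C| * expR z^-1 * z ^+ 2).
      by rewrite ler_wpM2r ?sqr_ge0// ler_wpM2r ?expR_ge0// ler_norm.
    rewrite [RHS]mulrAC; congr (_ * _); exact/esym/mulrA.
  have H : (fun h : R => h^-1 *: ((flat P \o shift 0) (h *: 1) - flat P 0)) @ 0^' --> (0 : R).
    apply/cvgr0Pnorm_lt => e e0.
    have C1 : 0 < `|C| + 1 by rewrite ltr_pwDr.
    near=> h.
    have h0 : h != 0 by near: h; exact: nbhs_dnbhs_neq.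
    rewrite /= addr0 [flat P 0]/flat ltxx subr0 -[h *: 1]/(h * 1) mulr1.
    rewrite -[_ *: _]/(_ * _) normrM normfV.
    rewrite mulrC ltr_pdivrMr ?normr_gt0//.
    apply: le_lt_trans (flatC h) _.
    rewrite -real_normK ?num_real// expr2 mulrA ltr_pM2r ?normr_gt0//.
    apply: (@le_lt_trans _ _ ((`|C| + 1) * `|h|)).
      by rewrite ler_wpM2r// lerDl.
    rewrite mulrC -ltr_pdivlMr//.
    by near: h; apply: dnbhs0_lt; exact: divr_gt0.
  split; first by apply/cvg_ex; exists 0.
  exact/cvg_lim.
Unshelve. all: by end_near.
Qed.

Lemma Ck_flat (V : normedModType R) k (U : set V) (f : V -> R) P : open U ->
  Ck k U f -> Ck k U (flat P \o f).
Proof.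
by move=> oU; apply: (Ck_family (D := fun P => 'X^2 * (P - P^`()))) => // Q x; exact: is_derive_flat.
Qed.

(** Supported in the ball of the Euclidean norm, so in the ball of radius r of the
    norm of row vectors, which is the supremum of the coordinates. *)
Definition cutoff m (u0 : 'rV[R]_m) (r : R) (u : 'rV[R]_m) : R :=
  flat 1 (1 - \sum_j ((u - u0) 0 j / r) ^+ 2) / flat 1 1.

Lemma flat1_gt0 : 0 < flat 1 1.
Proof. by rewrite /flat ltr01 !hornerE expR_gt0. Qed.

Lemma cutoff_center m (u0 : 'rV[R]_m) r : cutoff u0 r u0 = 1.
Proof.
rewrite /cutoff subrr big1 ?subr0 ?divff ?lt0r_neq0 ?flat1_gt0// => j _.
by rewrite mxE mul0r expr0n.
Qed.

Lemma cutoff_supp m (u0 : 'rV[R]_m) r u : 0 < r -> cutoff u0 r u != 0 -> `|u - u0| < r.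
Proof.
move=> r0; apply: contraNT; rewrite -leNgt => H.
suff : ~~ (0 < 1 - \sum_j ((u - u0) 0 j / r) ^+ 2).
  by rewrite /cutoff /flat => /negPf ->; rewrite mul0r.
rewrite -leNgt subr_le0.
have n0 : `|u - u0| != 0 by rewrite gt_eqF// (lt_le_trans r0).
have [[i j] E] := mx_norm_neq0 n0.
rewrite (bigD1 j)//= ler_wpDr ?sumr_ge0// => [k _|]; first exact: sqr_ge0.
move: H; rewrite -[`|_|]/(mx_norm _) E /= (ord1 i) => H.
rewrite -real_normK ?num_real// normrM normfV (gtr0_norm r0).
by rewrite exprn_ege1// ler_pdivlMr// mul1r.
Qed.

Lemma Ck_coordB m k (u0 : 'rV[R]_m) j : Ck k setT (fun u : 'rV[R]_m => (u - u0) 0 j).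
Proof.
apply: Ck_coord; first exact: openT.
have dB (x : 'rV[R]_m) : differentiable (fun u : 'rV[R]_m => u - u0) x.
  by apply: (@differentiableB _ _ _ id (cst u0)); [exact: ex_diff|exact: differentiable_cst].
case: k => [|k]; first by move=> x _; exact: differentiable_continuous.
split=> [x _|v]; first exact: dB.
apply: Ck_ext (Ck_cst k setT v); first exact: openT.
move=> x _; rewrite (@deriveB _ _ _ id (cst u0)) ?derive_id ?derive_cst ?subr0//.
Qed.

Lemma Ck_cutoff m k (u0 : 'rV[R]_m) r : Ck k setT (cutoff u0 r).
Proof.
have oT := @openT 'rV[R]_m.
pose q u := 1 - \sum_j ((u - u0) 0 j / r) ^+ 2.
have Cq : Ck k setT q.
  have Cs : Ck k setT (fun u => \sum_j ((u - u0) 0 j / r) ^+ 2).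
    apply: (@Ck_sum _ _ _ _ _ _ _ (fun j (u : 'rV[R]_m) => ((u - u0) 0 j / r) ^+ 2)) => // j.
    have Cj : Ck k setT (fun u : 'rV[R]_m => (u - u0) 0 j / r).
      apply: Ck_ext (CkZ r^-1 oT (Ck_coordB k u0 j)) => // x _.
      exact: mulrC.
    by apply: Ck_ext (Ck_mul oT Cj Cj) => // x _; rewrite expr2.
  have := CkD oT (Ck_cst k setT (1 : R)) (CkZ (-1) oT Cs).
  by apply: Ck_ext => // x _; rewrite scaleN1r.
have := CkZ (flat 1 1)^-1 oT (Ck_flat 1 oT Cq); apply: Ck_ext => // x _.
exact: mulrC.
Qed.

End Bump.

(** * Hadamard's lemma *)

(** A form of the definition of differentiability with a prescribed candidate for
    the differential, in terms of inequalities. *)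
Lemma linear_approx_differentiable (R : realType) (V : normedModType R)
    (f : V -> R) (x : V) (L : {linear V -> R}) : continuous L ->
  (forall e : R, 0 < e -> \forall h \near (0 : V), `|f (h + x) - f x - L h| <= e * `|h|) ->
  differentiable f x /\ forall v, 'D_v f x = L v.
Proof.
move=> cL HL.
have dh : f \o shift x = cst (f x) + L +o_ 0 id.
  apply/eqaddoP => e e0; apply: filterS (HL e e0) => h /= Hh.
  by rewrite [X in `|X|](_ : _ = f (h + x) - f x - L h)//= -addrA -opprD.
have E := diff_unique cL dh.
have df : differentiable f x by apply/diff_locallyP; rewrite E.
by split=> // v; rewrite deriveE// E.
Qed.

Section Integral01.
Context {R : realType}.
Implicit Types (f g F : R -> R).
Local Notation mu := (@lebesgue_measure R).

Definition int01 g : R := Rintegral mu `[0, 1] g.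

Let mI : measurable (`[0, 1] : set R). Proof. exact: measurable_itv. Qed.

Lemma int01_integrable g : continuous g -> mu.-integrable `[0, 1] (EFin \o g).
Proof.
move=> cg; apply: continuous_compact_integrable; first exact: segment_compact.
exact: continuous_subspaceT.
Qed.

Lemma int01_lin a f g : continuous f -> continuous g ->
  int01 (fun t => a * f t + g t) = a * int01 f + int01 g.
Proof.
move=> cf cg; rewrite /int01 RintegralD ?RintegralZl//; try exact: int01_integrable.
by apply: int01_integrable => x; apply: cvgM; [exact: cvg_cst|exact: cf].
Qed.

Lemma int01_bound g (c : R) : continuous g ->
  (forall t, 0 <= t <= 1 -> `|g t| <= c) -> `|int01 g| <= c.
Proof.
move=> cg Hg; rewrite /int01.
apply: (le_trans (le_normr_Rintegral _ (int01_integrable cg))) => //.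
have cN : continuous (fun t => `|g t|).
  by move=> x; apply: (@cvg_norm _ _ _ _ _ g); exact: cg.
have H : Rintegral mu `[0, 1] (fun t => `|g t|) <= Rintegral mu `[0, 1] (cst c).
  apply: le_Rintegral => //.
  - exact: (int01_integrable cN).
  - by apply: int01_integrable => x; exact: cvg_cst.
apply: (le_trans H); rewrite (Rintegral_cst mu mI).
have := @lebesgue_measure_itv R `[0, 1]; rewrite /= lte_fin ltr01 => ->.
by rewrite -EFinB subr0 mulr1.
Qed.

Lemma int01_FTC F f : continuous f -> (forall t : R, is_derive t 1 F (f t)) ->
  int01 f = F 1 - F 0.
Proof.
move=> cf dF.
have cF : continuous F.
  move=> t; apply: differentiable_continuous; apply/derivable1_diffP.
  by have [] := dF t.
rewrite /int01 /Rintegral (@continuous_FTC2 _ f F 0 1)//.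
- exact: continuous_subspaceT.
- split; first by move=> t _; have [] := dF t.
    by apply: cvg_at_right_filter; exact: cF.
  by apply: cvg_at_left_filter; exact: cF.
- by move=> t _; rewrite derive1E; have [_ ->] := dF t.
Qed.

Lemma int01B f g : continuous f -> continuous g ->
  int01 (fun t => f t - g t) = int01 f - int01 g.
Proof.
move=> cf cg; have := int01_lin (-1) cg cf; rewrite mulN1r addrC => <-.
by congr int01; apply/funext => t; rewrite mulN1r addrC.
Qed.

Lemma int01_sum (I : Type) (r : seq I) (a : I -> R) (F : I -> R -> R) :
  (forall i, continuous (F i)) ->
  continuous (fun t => \sum_(i <- r) a i * F i t) /\
  int01 (fun t => \sum_(i <- r) a i * F i t) = \sum_(i <- r) a i * int01 (F i).
Proof.
move=> cF; elim: r => [|i r [IHc IH]].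
  have -> : (fun t => \sum_(i <- [::]) a i * F i t) = fun=> 0.
    by apply/funext => t; rewrite big_nil.
  have c0 : continuous (fun _ : R => 0 : R) by move=> x; exact: cvg_cst.
  split => //; rewrite big_nil.
  by have := int01B c0 c0; rewrite !subrr.
have -> : (fun t => \sum_(k <- i :: r) a k * F k t) =
    fun t => a i * F i t + \sum_(k <- r) a k * F k t.
  by apply/funext => t; rewrite big_cons.
rewrite int01_lin// IH big_cons; split => // t.
apply: cvgD; last exact: IHc.
by apply: cvgM; [exact: cvg_cst|exact: cF].
Qed.

End Integral01.

Section Hadamard.
Context {R : realType} {m : nat}.
Implicit Types (f : 'rV[R]_m -> R) (u v h : 'rV[R]_m).
Local Notation V := 'rV[R]_m.

(** The family over w is closed under derivation: the derivative along v for the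
    weight w is the integral of the derivative of f for the weight w + 1. *)
Definition ray_int (w : nat) f u : R := int01 (fun t => t ^+ w * f (t *: u)).

Lemma ray_cont w f u : continuous f -> continuous (fun t : R => t ^+ w * f (t *: u)).
Proof.
move=> cf t; apply: cvgM; first exact: exprn_continuous.
apply: (@continuous_comp _ _ _ (fun t : R => t *: u) f); last exact: cf.
exact: scalel_continuous.
Qed.

(** The segment from 0 to u is compact. *)
Lemma uniform_on_ray f u (e : R) : continuous f -> 0 < e ->
  \forall k \near (0 : V), forall t : R, 0 <= t <= 1 ->
    `|f (t *: u + k) - f (t *: u)| < e.
Proof.
move=> cf e0.
have cpt := @segment_compact R 0 1.
have /compact_near_coveringP := cpt.
move=> /(_ V (nbhs (0 : V)) (fun k t => `|f (t *: u + k) - f (t *: u)| < e) _) H.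
have := H _; move=> /(_ _)/wrap[].
  move=> t _.
  pose q (z : R * V) := f (z.1 *: u + z.2) - f (z.1 *: u).
  have cq : {for (t, 0 : V), continuous q}.
    have c1 : {for (t, 0 : V), continuous (fun z : R * V => z.1 *: u)}.
      by apply: cvgZl; exact: cvg_fst.
    apply: cvgB.
      apply: (@continuous_comp _ _ _ (fun z : R * V => z.1 *: u + z.2) f); last exact: cf.
      by apply: cvgD; [exact: c1|exact: cvg_snd].
    by apply: (@continuous_comp _ _ _ (fun z : R * V => z.1 *: u) f); [exact: c1|exact: cf].
  have : q z @[z --> (t, 0 : V)] --> (0 : R).
    by have := cq; rewrite /prop_for /continuous_at {2}/q /= addr0 subrr.
  move=> /cvgr0Pnorm_lt /(_ e e0); exact.
by apply: filterS => k Hk t t01; apply: Hk; rewrite /= in_itv.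
Qed.

Lemma ray_MVT f u k : (forall x, differentiable f x) ->
  exists2 s : R, 0 <= s <= 1 & f (u + k) - f u = 'D_k f (u + s *: k).
Proof.
move=> df.
pose F (s : R) := f (u + s *: k).
have dF (s : R) : is_derive s 1 F ('D_k f (u + s *: k)).
  have dfs : derivable f (u + s *: k) k by exact/diff_derivable/df.
  have E : (fun h : R => h^-1 *: ((F \o shift s) (h *: 1) - F s)) =
      (fun h : R => h^-1 *: ((f \o shift (u + s *: k)) (h *: k) - f (u + s *: k))).
    apply/funext => h; rewrite /F /=; congr (_ *: (f _ - _)).
    by rewrite [h *: 1]mulr1 scalerDl addrCA.
  by split; rewrite /derivable /derive E.
have [|s Hs E] := @MVT R F (fun s => 'D_k f (u + s *: k)) 0 1 ltr01.
  apply: continuous_subspaceT => s; apply: differentiable_continuous.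
  by apply/derivable1_diffP; have [] := dF s.
exists s; first by move: Hs; rewrite in_itv /= => /andP[/ltW-> /ltW->].
by move: E; rewrite /F scale1r scale0r addr0 subr0 mulr1.
Qed.

Definition coef_form (c : 'I_m -> R) (v : V) : R := \sum_j v 0 j * c j.

Fact coef_form_linear c : linear (coef_form c).
Proof.
move=> a u v; rewrite /coef_form -[a *: (\sum_j _)]/(a * _) mulr_sumr -big_split /=.
by apply: eq_bigr => j _; rewrite !mxE mulrDl mulrA.
Qed.

HB.instance Definition _ c :=
  GRing.isLinear.Build R V R *:%R (coef_form c) (coef_form_linear c).

Lemma coef_form_continuous c : continuous (coef_form c).
Proof.
have : Ck 0 setT (coef_form c).
  have oT := @openT V.
  apply: (@Ck_sum _ _ _ _ _ _ _ (fun j (v : V) => v 0 j * c j)) => // j.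
  have C0 : Ck 0 setT (fun v : V => v 0 j).
    by move=> v _; exact: coord_continuous.
  by have := CkZ (c j) oT C0; apply: Ck_ext => // v _; rewrite -[LHS]/(_ * _) mulrC.
by move=> H v; exact: H.
Qed.

Lemma ray_int_derive w f v u : (forall x, differentiable f x) ->
  (forall v, continuous (fun x => 'D_v f x)) ->
  ray_int w (fun x => 'D_v f x) u =
  coef_form (fun j => ray_int w (fun x => 'D_(delta_mx 0 j) f x) u) v.
Proof.
move=> df cD; rewrite /ray_int.
have -> : (fun t : R => t ^+ w * 'D_v f (t *: u)) =
    fun t => \sum_j v 0 j * (t ^+ w * 'D_(delta_mx 0 j) f (t *: u)).
  apply/funext => t; rewrite derive_rV// mulr_sumr.
  by apply: eq_bigr => j _; rewrite mulrCA.
have cF j : continuous (fun t : R => t ^+ w * 'D_(delta_mx 0 j) f (t *: u)).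
  exact: (ray_cont (w := w) (u := u) (cD (delta_mx 0 j))).
by have [_ ->] := int01_sum (index_enum 'I_m) (v 0) cF.
Qed.

(** The mean value theorem bounds the error of the linear approximation under the
    integral by the variation of the partial derivatives near the segment from 0
    to u, which is uniformly small. *)
Lemma ray_int_diff w f u : (forall x, differentiable f x) ->
  (forall v, continuous (fun x => 'D_v f x)) ->
  differentiable (ray_int w f) u /\
  forall v, 'D_v (ray_int w f) u = ray_int w.+1 (fun x => 'D_v f x) u.
Proof.
move=> df cD; have cf : continuous f.
  by move=> x; apply: differentiable_continuous; exact: df.
pose c j := ray_int w.+1 (fun x => 'D_(delta_mx 0 j) f x) u.
suff [H1 H2] : differentiable (ray_int w f) u /\
    forall v, 'D_v (ray_int w f) u = coef_form c v.
  by split => // v; rewrite H2 ray_int_derive.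
apply: linear_approx_differentiable; first exact: coef_form_continuous.
move=> e e0; pose e' := e / m.+1%:R.
have e'0 : 0 < e' by rewrite divr_gt0.
have /nbhs_normP [d /= d0 Hd] : \forall k \near (0 : V), forall j (t : R), 0 <= t <= 1 ->
    `|'D_(delta_mx 0 j) f (t *: u + k) - 'D_(delta_mx 0 j) f (t *: u)| < e'.
  apply: (@filter_forall V 'I_m (fun j (k : V) => forall t : R, 0 <= t <= 1 ->
    `|'D_(delta_mx 0 j) f (t *: u + k) - 'D_(delta_mx 0 j) f (t *: u)| < e') (nbhs (0 : V)) _) => j.
  have := uniform_on_ray u (cD (delta_mx 0 j)) e'0.
  by apply: filterS => k; apply.
apply/nbhs_normP; exists d => // h /=; rewrite sub0r normrN => hd.
have Hh j (s t : R) : 0 <= s <= 1 -> 0 <= t <= 1 ->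
    `|'D_(delta_mx 0 j) f (t *: u + s *: (t *: h)) - 'D_(delta_mx 0 j) f (t *: u)| < e'.
  move=> /andP[s0 s1] t01; apply: Hd => //=; have /andP[t0 t1] := t01.
  rewrite sub0r normrN scalerA normrZ ger0_norm ?mulr_ge0//.
  apply: le_lt_trans hd; rewrite -[leRHS]mul1r ler_wpM2r//.
  by rewrite -[leRHS]mul1r ler_pM.
rewrite /coef_form /c /ray_int.
have [cs <-] := int01_sum (index_enum 'I_m) (h 0)
  (F := fun j (t : R) => t ^+ w.+1 * 'D_(delta_mx 0 j) f (t *: u))
  (fun j => ray_cont (w := w.+1) (u := u) (cD (delta_mx 0 j))).
have c1 := ray_cont (w := w) (u := h + u) cf.
have c2 := ray_cont (w := w) (u := u) cf.
rewrite -int01B// -int01B//; last by move=> t; apply: cvgB; [exact: c1|exact: c2].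
apply: int01_bound.
  by move=> t; apply: cvgB; [apply: cvgB; [exact: c1|exact: c2]|exact: cs].
move=> t t01; rewrite -mulrBr scalerDr addrC.
have [s s01 E] := ray_MVT (t *: u) (t *: h) df.
rewrite [t *: h + _]addrC E derive_rV//.
have -> : - (\sum_j h 0 j * (t ^+ w.+1 * 'D_(delta_mx 0 j) f (t *: u))) +
    t ^+ w * (\sum_j (t *: h) 0 j * 'D_(delta_mx 0 j) f (t *: u + s *: (t *: h))) =
  \sum_j t ^+ w.+1 * h 0 j * ('D_(delta_mx 0 j) f (t *: u + s *: (t *: h))
      - 'D_(delta_mx 0 j) f (t *: u)).
  rewrite mulr_sumr -sumrN -big_split /=; apply: eq_bigr => j _.
  by rewrite !mxE exprS; ring.
apply: le_trans (ler_norm_sum _ _ _) _.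
apply: (@le_trans _ _ (\sum_(j < m) `|h| * e')).
  apply: ler_sum => j _; rewrite !normrM; apply: ler_pM => //.
  - rewrite -[leRHS]mul1r; apply: ler_pM => //.
      have /andP[t0 t1] := t01; rewrite ger0_norm ?exprn_ge0//.
      exact: exprn_ile1.
    have := @mx_normrE R 1 m h; rewrite -[mx_norm h]/(`|h|) => ->.
    by apply/bigmax_geP; right; exists (0, j).
  - by apply: ltW; exact: Hh.
rewrite sumr_const card_ord /e' -[_ *+ m]mulr_natr.
have -> : `|h| * (e / m.+1%:R) * m%:R = e * `|h| * (m%:R / m.+1%:R).
  by rewrite mulrCA -!mulrA; congr (_ * (_ * _)); rewrite mulrC.
apply: ler_piMr; first by rewrite mulr_ge0 ?(ltW e0).
by rewrite ler_pdivrMr ?ltr0Sn// mul1r ler_nat.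
Qed.

Lemma Ck_ray_int k w f : (forall j, Ck j setT f) -> Ck k setT (ray_int w f).
Proof.
elim: k w f => [|k IH] w f Cf; have [df Df] := Cf 1%N.
  by move=> x _; apply: differentiable_continuous; apply: (ray_int_diff _ _ _ _).1 => [y|v y];
    [exact: df|exact: Df].
have H u := ray_int_diff w u (fun y => df y I) (fun v y => Df v y I).
split=> [x _|v]; first exact: (H x).1.
have -> : (fun x => 'D_v (ray_int w f) x) = ray_int w.+1 (fun x => 'D_v f x).
  by apply/funext => x; exact: (H x).2.
by apply: IH => j; have [_ +] := Cf j.+1; exact.
Qed.

(** Fundamental theorem of calculus along the segment from 0 to u, the derivative
    along u being expanded in partial derivatives. The cofactors of the
    coordinates are smooth by [Ck_ray_int]. *)
Lemma hadamard0 f u : (forall j, Ck j setT f) ->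
  f u - f 0 = \sum_j u 0 j * ray_int 0 (fun x => 'D_(delta_mx 0 j) f x) u.
Proof.
move=> Cf; have [df Df] := Cf 1%N.
have df' y : differentiable f y by exact: df.
have cD v : continuous (fun x => 'D_v f x) by move=> y; exact: Df.
rewrite -[RHS]/(coef_form _ _) -ray_int_derive// /ray_int.
have dF (t : R) : is_derive t 1 (fun t : R => f (t *: u)) ('D_u f (t *: u)).
  have dfs : derivable f (t *: u) u by exact/diff_derivable.
  have E : (fun h : R => h^-1 *: (((fun t : R => f (t *: u)) \o shift t) (h *: 1) - f (t *: u))) =
      (fun h : R => h^-1 *: ((f \o shift (t *: u)) (h *: u) - f (t *: u))).
    apply/funext => h /=; congr (_ *: (f _ - _)).
    by rewrite [h *: 1]mulr1 scalerDl.
  by split; rewrite /derivable /derive E.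
have dF' (t : R) : is_derive t 1 (fun t : R => f (t *: u)) (t ^+ 0 * 'D_u f (t *: u)).
  by rewrite expr0 mul1r.
have c0 := ray_cont (w := 0) (u := u) (cD u).
by rewrite (int01_FTC c0 dF') scale1r scale0r.
Qed.

End Hadamard.

(** * Smooth functions on a Lie group *)

Lemma open_setI_preimage (T T' : topologicalType) (U : set T) (f : T -> T')
    (W : set T') : open U -> (forall x, U x -> {for x, continuous f}) ->
  open W -> open (U `&` f @^-1` W).
Proof.
move=> oU cf oW; rewrite openE => x [Ux Wx]; rewrite /interior.
apply: filterI; first exact: open_nbhs_nbhs.
by apply: cf => //; exact: open_nbhs_nbhs.
Qed.

Lemma open_setX (T T' : topologicalType) (A : set T) (B : set T') :
  open A -> open B -> open (A `*` B).
Proof.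
move=> oA oB; rewrite openE => -[x y] [/= Ax By].
by exists (A, B) => //; split; exact: open_nbhs_nbhs.
Qed.

Section LieSmooth.
Context {R : realType} {m : nat} {G : lieGroupType R m}.
Implicit Types (f g : G -> R) (x y a : G) (c d : chart R m G).
Local Notation V := 'rV[R]_m.

Lemma chart_inv_dom c u : chart_img c u -> chart_dom c (chart_inv c u).
Proof. by move=> [x cx <-]; rewrite chart_mapK// inE. Qed.

Lemma chart_invK c u : chart_img c u -> chart_map c (chart_inv c u) = u.
Proof. by move=> [x cx <-]; rewrite chart_mapK// inE. Qed.

Lemma chart_map_img c x : chart_dom c x -> chart_img c (chart_map c x).
Proof. by move=> cx; exists x. Qed.

Lemma chart_mapE c x : chart_dom c x -> chart_inv c (chart_map c x) = x.
Proof. by move=> cx; rewrite chart_mapK// inE. Qed.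

Lemma chart_inv_open c (W : set G) : open W ->
  open (chart_img c `&` chart_inv c @^-1` W).
Proof.
move=> oW; apply: open_setI_preimage => //; first exact: chart_img_open.
by move=> u; exact: chart_inv_cont.
Qed.

Lemma chart_at x : exists2 c, lie_atlas G c & chart_dom c x.
Proof. exact: (lie_atlasP (s := G)).1. Qed.

Lemma lie_smooth_continuous f : lie_smooth f -> continuous f.
Proof.
move=> sf x; have [c cA cx] := chart_at x.
have cf := sf c cA 0%N _ (chart_map_img cx).
have H : {for x, continuous (f \o chart_inv c \o chart_map c)}.
  by apply: continuous_comp; [exact: chart_map_cont|exact: cf].
move: H; rewrite /prop_for /continuous_at /= chart_mapE//.
apply: cvg_trans; apply: near_eq_cvg.
have : nbhs x (chart_dom c) by apply: open_nbhs_nbhs; split=> //; exact: chart_open.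
by apply: filterS => y cy /=; rewrite chart_mapE.
Qed.

Lemma lie_smooth_local f :
  (forall x, exists W g, [/\ open W, W x, lie_smooth g & forall y, W y -> f y = g y]) ->
  lie_smooth f.
Proof.
move=> H c cA k; apply: Ck_cover => u cu.
have [W [g [oW Wx sg fg]]] := H (chart_inv c u).
exists (chart_img c `&` chart_inv c @^-1` W); first by split.
apply: (@Ck_ext _ _ _ _ _ (g \o chart_inv c)).
- exact: chart_inv_open.
- by move=> v [_ Wv] /=; rewrite fg.
- by apply: Ck_sub (sg c cA k) => v [].
Qed.

Lemma lie_mul_continuous : continuous (fun z : G * G => (z.1 * z.2)%g).
Proof. exact: (lie_mul_smooth (s := G)).1. Qed.

Lemma lie_inv_continuous : continuous (fun x : G => x^-1%g).
Proof. exact: (lie_inv_smooth (s := G)).1. Qed.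

Lemma lie_mulr_continuous a : continuous (fun x : G => (a * x)%g).
Proof.
move=> x; apply: (@continuous_comp _ _ _ (fun x : G => (a, x)) (fun z : G * G => (z.1 * z.2)%g)).
  by apply: cvg_pair; [exact: cvg_cst|exact: cvg_id].
exact: lie_mul_continuous.
Qed.

(** All smoothness statements about the group reduce to this one: translation and
    left-invariant fields are obtained from the product by fixing a variable or
    differentiating in it. *)
Lemma smooth_mul_charts f c1 c2 k : lie_smooth f -> lie_atlas G c1 -> lie_atlas G c2 ->
  Ck k (chart_img c1 `*` chart_img c2)
    (fun z : V * V => f (chart_inv c1 z.1 * chart_inv c2 z.2)%g).
Proof.
move=> sf c1A c2A; pose h (z : V * V) := (chart_inv c1 z.1 * chart_inv c2 z.2)%g.
apply: Ck_cover => z [z1 z2].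
have [d dA dz] := chart_at (h z).
pose S := chart_img c1 `*` chart_img c2 `&` h @^-1` chart_dom d.
have oS : open S.
  apply: open_setI_preimage; last exact: chart_open.
    by apply: open_setX; exact: chart_img_open.
  move=> y [y1 y2].
  apply: (@continuous_comp _ _ _ (fun y : V * V => (chart_inv c1 y.1, chart_inv c2 y.2))
    (fun z : G * G => (z.1 * z.2)%g)); last exact: lie_mul_continuous.
  apply: cvg_pair.
    apply: (@continuous_comp _ _ _ fst (chart_inv c1)); first exact: cvg_fst.
    exact: chart_inv_cont.
  apply: (@continuous_comp _ _ _ snd (chart_inv c2)); first exact: cvg_snd.
  exact: chart_inv_cont.
exists S; first by split.
have Ch : Ck k S (chart_map d \o h) by exact: (lie_mul_smooth (s := G)).2.
apply: (@Ck_ext _ _ _ _ _ ((f \o chart_inv d) \o (chart_map d \o h))) => //.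
  by move=> y [_ dy] /=; rewrite chart_mapE.
apply: Ck_comp Ch (sf d dA k) => //.
by move=> y [_ dy] /=; exact: chart_map_img.
Qed.

Lemma lie_smooth_translate f a : lie_smooth f -> lie_smooth (fun x => f (a * x)%g).
Proof.
move=> sf c cA k; have [d dA da] := chart_at a.
have H := smooth_mul_charts k sf dA cA.
pose L (u : V) : V * V := (chart_map d a, u).
apply: (@Ck_ext _ _ _ _ _ ((fun z : V * V => f (chart_inv d z.1 * chart_inv c z.2)%g) \o L)).
- exact: chart_img_open.
- by move=> u _ /=; rewrite chart_mapE.
apply: (@Ck_affine _ _ _ _ L (fun v => (0, v))) H.
- by move=> u t v; rewrite /L; congr pair; rewrite /= ?scaler0 ?add0r.
- by move=> u; apply: differentiable_pair; [exact: differentiable_cst|exact: ex_diff].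
- by move=> u cu; split => //=; exact: chart_map_img.
Qed.

End LieSmooth.

(** * Pointwise evaluation in the function algebras *)

Section Evaluation.
Context {R : realType} {m : nat} {G : lieGroupType R m} {T : Type}.
Variable p : G -> T.
Local Notation C := (smooth_fun p).
Implicit Types (f g : C) (x : T).

Lemma smooth_fun_ext f g : f =1 g -> f = g.
Proof. by move=> fg; apply/val_inj/funext. Qed.

Lemma evalD f g x : (f + g) x = f x + g x. Proof. by []. Qed.
Lemma evalN f x : (- f) x = - f x. Proof. by []. Qed.
Lemma eval0 x : (0 : C) x = 0. Proof. by []. Qed.
Lemma eval1 x : (1 : C) x = 1. Proof. by []. Qed.
Lemma evalM f g x : (f * g) x = f x * g x. Proof. by []. Qed.
Lemma evalZ (a : R) f x : (a *: f) x = a * f x. Proof. by []. Qed.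
Lemma eval_sum (I : Type) (r : seq I) (P : pred I) (F : I -> C) x :
  (\sum_(i <- r | P i) F i) x = \sum_(i <- r | P i) F i x.
Proof. by apply: (big_morph (fun f : C => f x)) => [f g|]; [exact: evalD|exact: eval0]. Qed.
Lemma eval_nat n x : (n%:R : C) x = n%:R.
Proof. by elim: n => [|n IH]; rewrite ?mulr0n ?eval0// !mulrS evalD IH eval1. Qed.

Lemma derevalD (Y Z : derivation C) f : (Y + Z) f = Y f + Z f. Proof. by []. Qed.
Lemma dereval0 f : (0 : derivation C) f = 0. Proof. by []. Qed.
Lemma derevalZ (a : C) (Y : derivation C) f : (a *: Y) f = a * Y f. Proof. by []. Qed.
Lemma dereval_sum (I : Type) (r : seq I) (P : pred I) (F : I -> derivation C) f :
  (\sum_(i <- r | P i) F i) f = \sum_(i <- r | P i) F i f.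
Proof.
by apply: (big_morph (fun Y : derivation C => Y f)) => [Y Z|]; [exact: derevalD|exact: dereval0].
Qed.
Lemma derivation_ext (Y Z : derivation C) : (forall f, Y f = Z f) -> Y = Z.
Proof. by move=> YZ; apply/val_inj/funext. Qed.

Lemma der_lin (Y : derivation C) (a : R) f g x :
  Y (a *: f + g) x = a * Y f x + Y g x.
Proof. by have [lY _] := derivationP Y; rewrite lY. Qed.

Lemma der_mul (Y : derivation C) f g x :
  Y (f * g) x = Y f x * g x + f x * Y g x.
Proof. by have [_ mY] := derivationP Y; rewrite mY. Qed.
End Evaluation.

Section LieEvaluation.
Context {R : realType} {m : nat} {G : lieGroupType R m}.
Local Notation CG := (smooth_fun (@id G)).
Implicit Types (X Y : lie_algebra G) (f g : CG).
Lemma lieevalD X Y f : (X + Y) f = X f + Y f. Proof. by []. Qed.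
Lemma lieeval0 f : (0 : lie_algebra G) f = 0. Proof. by []. Qed.
Lemma lieevalZ (a : R) X f : (a *: X) f = a *: X f. Proof. by []. Qed.
Lemma lieeval_sum (I : Type) (r : seq I) (P : pred I) (F : I -> lie_algebra G) f :
  (\sum_(i <- r | P i) F i) f = \sum_(i <- r | P i) F i f.
Proof.
by apply: (big_morph (fun X : lie_algebra G => X f)) => [X Y|]; [exact: lieevalD|exact: lieeval0].
Qed.
Lemma lie_algebra_ext X Y : (forall f, X f = Y f) -> X = Y.
Proof. by move=> XY; apply/val_inj/funext. Qed.
Lemma lie_lin X (a : R) f g x :
  X (a *: f + g) x = a * X f x + X g x.
Proof. by have [[lD _] _] := lie_algebraP X; rewrite lD. Qed.

Lemma lie_mul X f g x :
  X (f * g) x = X f x * g x + f x * X g x.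
Proof. by have [[_ mD] _] := lie_algebraP X; rewrite mD. Qed.
End LieEvaluation.

(** * Left-invariant fields and coordinates at the identity *)

Section LocalCoordinates.
Context {R : realType} {m : nat} {G : lieGroupType R m}.
Local Notation V := 'rV[R]_m.
Implicit Types (f g : G -> R) (x y a : G) (u v : V).

Definition chart1 : chart R m G := s2val (cid2 (chart_at (1%g : G))).
Definition coord1 : V := chart_map chart1 (1%g : G).

Lemma chart1_atlas : lie_atlas G chart1.
Proof. exact: (s2valP (cid2 (chart_at (1%g : G)))). Qed.

Lemma chart1_dom : chart_dom chart1 (1%g : G).
Proof. exact: (s2valP' (cid2 (chart_at (1%g : G)))). Qed.

Lemma coord1_img : chart_img chart1 coord1.
Proof. exact/chart_map_img/chart1_dom. Qed.

Lemma coord1K : chart_inv chart1 coord1 = 1%g.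
Proof. exact/chart_mapE/chart1_dom. Qed.

(** The left-invariant field with value v at 1, in the coordinates at 1: the
    derivative of f along the left translate by x of a curve through 1. *)
Definition field_of v f x : R := 'D_v (fun u => f (x * chart_inv chart1 u)%g) coord1.

Lemma field_of_chart (c : chart R m G) v f (y : V) : lie_atlas G c ->
  field_of v f (chart_inv c y) = 'D_((0, v) : V * V)
    (fun z : V * V => f (chart_inv c z.1 * chart_inv chart1 z.2)%g) (y, coord1).
Proof.
move=> cA; rewrite /field_of.
apply: (@derive_affine _ _ _ _ (fun u => (y, u)) (fun v => (0, v))
  (fun z : V * V => f (chart_inv c z.1 * chart_inv chart1 z.2)%g)).
by move=> u t w; congr pair; rewrite /= ?scaler0 ?add0r.
Qed.

(** In charts, the field is a partial derivative of the smooth function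
    f (y z) of two variables, at z = 1. *)
Lemma field_of_smooth v f : lie_smooth f -> lie_smooth (field_of v f).
Proof.
move=> sf c cA k.
have [_ H] := smooth_mul_charts k.+1 sf cA chart1_atlas.
apply: (@Ck_ext _ _ _ _ _ ((fun z : V * V => 'D_((0, v) : V * V)
    (fun z : V * V => f (chart_inv c z.1 * chart_inv chart1 z.2)%g) z) \o
    (fun y : V => (y, coord1)))).
- exact: chart_img_open.
- by move=> y _ /=; rewrite field_of_chart.
apply: (@Ck_affine _ _ _ _ (fun y : V => (y, coord1)) (fun w => (w, 0))) (H (0, v)).
- by move=> u t w; congr pair; rewrite /= ?scaler0 ?add0r.
- by move=> u; apply: differentiable_pair; [exact: ex_diff|exact: differentiable_cst].
- by move=> y cy; split => //=; exact: coord1_img.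
Qed.

Lemma slice_differentiable f x : lie_smooth f ->
  differentiable (fun u => f (x * chart_inv chart1 u)%g) coord1.
Proof.
move=> sf; have sfx := lie_smooth_translate x sf.
by have [H _] := sfx _ chart1_atlas 1%N; exact/H/coord1_img.
Qed.

Lemma field_of_lin v (a : R) f g : lie_smooth f -> lie_smooth g ->
  field_of v (fun x => a * f x + g x) = fun x => a * field_of v f x + field_of v g x.
Proof.
move=> sf sg; apply/funext => x; rewrite /field_of.
have df := diff_derivable (v := v) (slice_differentiable x sf).
have dg := diff_derivable (v := v) (slice_differentiable x sg).
have := deriveD (derivableZ (k := a) df) dg; rewrite (deriveZ a df); exact.
Qed.

Lemma field_of_mul v f g : lie_smooth f -> lie_smooth g ->
  field_of v (fun x => f x * g x) = fun x => field_of v f x * g x + f x * field_of v g x.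
Proof.
move=> sf sg; apply/funext => x; rewrite /field_of.
have df := diff_derivable (v := v) (slice_differentiable x sf).
have dg := diff_derivable (v := v) (slice_differentiable x sg).
have := deriveM df dg; rewrite coord1K mulg1 => H.
by rewrite -[LHS]/('D_v _ _) H addrC [X in X + _]mulrC.
Qed.

Lemma field_of_translate v f a x :
  field_of v (fun x => f (a * x)%g) x = field_of v f (a * x)%g.
Proof. by rewrite /field_of; under eq_fun do rewrite mulgA. Qed.

Lemma field_of_near v f g x : (\forall y \near x, f y = g y) ->
  field_of v f x = field_of v g x.
Proof.
move=> fg; rewrite /field_of; apply: near_eq_derive.
have H : (fun u => (x * chart_inv chart1 u)%g) @ coord1 --> (x : G).
  have -> : nbhs x = nbhs (x * chart_inv chart1 coord1)%g by rewrite coord1K mulg1.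
  apply: (@continuous_comp _ _ _ (chart_inv chart1) (fun y => x * y)%g).
    by apply: chart_inv_cont; exact: coord1_img.
  exact: lie_mulr_continuous.
exact: H fg.
Qed.

Local Notation CG := (smooth_fun (@id G)).

Fact inv_op_subproof v (f : CG) : (field_of v f : G -> R^o) \in smooth_pred (@id G).
Proof. by apply/asboolP; apply: field_of_smooth; exact: (smooth_valE f). Qed.

Definition inv_op v (f : CG) : CG := SmoothFun (inv_op_subproof v f).

Fact inv_field_subproof v : inv_op v \in @lie_algebra_pred R m G.
Proof.
apply/asboolP; split.
  split=> [a f g|f g]; apply/val_inj.
    exact: (field_of_lin v a (smooth_valE f) (smooth_valE g)).
  exact: (field_of_mul v (smooth_valE f) (smooth_valE g)).
move=> a f h hf x; rewrite -[LHS]/(field_of v h x) -[RHS]/(field_of v f _).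
rewrite -field_of_translate; congr (field_of v _ x); exact/funext.
Qed.

Definition inv_field v : lie_algebra G := LieAlgebra (inv_field_subproof v).

Definition chart_ext (F : V -> R) x : R :=
  if pselect (chart_dom chart1 x) then F (chart_map chart1 x) else 0.

Lemma chart_extE F x : chart_dom chart1 x -> chart_ext F x = F (chart_map chart1 x).
Proof. by rewrite /chart_ext; case: pselect. Qed.

Lemma chart_ext_out F x : ~ chart_dom chart1 x -> chart_ext F x = 0.
Proof. by rewrite /chart_ext; case: pselect. Qed.

Lemma chart_ext_coord F u : chart_img chart1 u -> chart_ext F (chart_inv chart1 u) = F u.
Proof. by move=> cu; rewrite chart_extE ?chart_invK//; exact: chart_inv_dom. Qed.

Section Cube.
Variables (r : R) (N : set G).
Hypotheses (r0 : 0 < r)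
  (rimg : forall u, `|u - coord1| <= r -> chart_img chart1 u /\ N (chart_inv chart1 u)).

Let cube : set V := [set u | `|u - coord1| <= r].

Lemma cube_closed : closed cube.
Proof.
have -> : cube = closed_ball coord1 r.
  by rewrite closed_ballE//; apply/seteqP; split => u; rewrite /cube /closed_ball_ /= distrC.
exact: closed_ball_closed.
Qed.

Lemma cube_compact : compact cube.
Proof.
apply: bounded_closed_compact; last exact: cube_closed.
exists (r + `|coord1|); split; first exact: num_real.
move=> M rM u /= ur; apply: le_trans (ltW rM).
by rewrite -[u](subrK coord1); apply: le_trans (ler_normD _ _) _; rewrite lerD2r.
Qed.

(** The image of the closed cube is compact, hence closed because G is Hausdorff:
    the extension vanishes near every point outside the chart. *)
Lemma chart_ext_smooth F : (forall k, Ck k setT F) ->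
  (forall u, F u != 0 -> `|u - coord1| < r) -> lie_smooth (chart_ext F).
Proof.
move=> CF F0 c cA k; apply: Ck_cover => u cu.
have [dx|dx] := pselect (chart_dom chart1 (chart_inv c u)).
  exists (chart_img c `&` chart_inv c @^-1` chart_dom chart1); first by split.
  have oS := chart_inv_open (c := c) (chart_open chart1).
  apply: (@Ck_ext _ _ _ _ _ (F \o (chart_map chart1 \o chart_inv c))) => //.
    by move=> w [_ dw] /=; rewrite chart_extE.
  apply: (@Ck_comp _ _ _ _ _ setT) => //.
  exact: (lie_atlasP (s := G)).2 cA chart1_atlas k.
pose K := chart_inv chart1 @` cube.
have clK : closed K.
  apply: compact_closed; first exact: (lie_hausdorff (s := G)).
  apply: continuous_compact; last exact: cube_compact.
  apply: continuous_in_subspaceT => w; rewrite inE => /rimg [cw _].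
  exact: chart_inv_cont.
exists (chart_img c `&` chart_inv c @^-1` (~` K)).
  split=> // -[w /rimg[cw _] E]; apply: dx; rewrite -E; exact: chart_inv_dom.
apply: (@Ck_ext _ _ _ _ _ (cst 0)).
- apply: chart_inv_open; exact: closed_openC.
- move=> w [cw Kw] /=; rewrite /chart_ext; case: pselect => // dw.
  apply/esym/eqP; apply: contrapT => /negP /F0 /ltW H; apply: Kw.
  by exists (chart_map chart1 (chart_inv c w)) => //; rewrite chart_mapE.
- exact: Ck_cst.
Qed.

Lemma chart_ext_supp F : (forall u, F u != 0 -> `|u - coord1| < r) ->
  forall x, chart_ext F x != 0 -> N x.
Proof.
move=> F0 x; have [dx|dx] := pselect (chart_dom chart1 x); last first.
  by rewrite chart_ext_out// eqxx.
by rewrite chart_extE// => /F0 /ltW /rimg [_]; rewrite chart_mapE.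
Qed.

(** The cutoff makes f a smooth function on the whole space of row vectors, to
    which Hadamard's lemma applies after moving the origin to the coordinates of
    1. *)
Lemma cutoff_hadamard f : lie_smooth f -> exists g : 'I_m -> V -> R,
  (forall j k, Ck k setT (g j)) /\
  forall u, chart_img chart1 u ->
   cutoff coord1 r u * f (chart_inv chart1 u) - f 1%g = \sum_j (u - coord1) 0 j * g j u.
Proof.
move=> sf; have oT := @openT V.
pose F u := if pselect (chart_img chart1 u) then
  cutoff coord1 r u * f (chart_inv chart1 u) else 0.
have FE u : chart_img chart1 u -> F u = cutoff coord1 r u * f (chart_inv chart1 u).
  by rewrite /F; case: pselect.
have CF k : Ck k setT F.
  apply: Ck_cover => u _; have [cu|cu] := pselect (chart_img chart1 u).
    exists (chart_img chart1) => //.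
    have Cb : Ck k (chart_img chart1) (cutoff coord1 r).
      by apply: Ck_sub (Ck_cutoff k coord1 r).
    have := Ck_mul (chart_img_open chart1) Cb (sf _ chart1_atlas k).
    by apply: Ck_ext; [exact: chart_img_open|move=> w cw; rewrite FE].
  exists (~` cube); first by move=> /rimg [].
  apply: (@Ck_ext _ _ _ _ _ (cst 0)); last exact: Ck_cst.
    exact/closed_openC/cube_closed.
  move=> w Kw; rewrite /F; case: pselect => // cw; apply/esym.
  have [->|/(cutoff_supp r0)/ltW //] := eqVneq (cutoff coord1 r w) 0.
  by rewrite mul0r.
have sh (x : V) (t : R) (v : V) : (t *: v + x) + coord1 = t *: v + (x + coord1) by rewrite addrA.
have dsh (w x : V) : differentiable (fun u : V => u + w) x.
  by apply: (@differentiableD _ _ _ id (cst w)); [exact: ex_diff|exact: differentiable_cst].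
pose F2 u := F (u + coord1).
have CF2 k : Ck k setT F2.
  by apply: (@Ck_affine _ _ _ _ (fun u : V => u + coord1) id _ _ setT) (CF k).
pose g j u := ray_int 0 (fun w : V => 'D_(delta_mx 0 j) F2 w) (u - coord1).
exists g; split.
  move=> j k; apply: (@Ck_affine _ _ _ _ (fun u : V => u - coord1) id _ _ setT
     (ray_int 0 (fun w : V => 'D_(delta_mx 0 j) F2 w))) => //.
    by move=> x t v; rewrite addrA.
  by apply: Ck_ray_int => i; have [_ +] := CF2 i.+1; exact.
move=> u cu; have := hadamard0 (u - coord1) CF2.
rewrite /F2 subrK add0r FE// FE; last exact: coord1_img.
by rewrite cutoff_center mul1r coord1K.
Qed.

End Cube.

(** Hadamard's lemma for the coordinates at 1, with every function multiplied by
    the cutoff chi to be global and supported in N: one factor chi for f, one for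
    the coordinates kappa and one for the cofactors g. *)
Lemma local_coords (N : set G) : nbhs (1%g : G) N ->
  exists (chi : G -> R) (kappa : 'I_m -> G -> R),
  [/\ lie_smooth chi /\ (forall j, lie_smooth (kappa j)),
      chi 1%g = 1 /\ (forall j, kappa j 1%g = 0),
      forall i j, field_of (delta_mx 0 i) (kappa j) 1%g = (i == j)%:R,
      (forall x, chi x != 0 -> N x) /\ (forall j x, kappa j x != 0 -> N x) &
      forall f, lie_smooth f -> exists g : 'I_m -> G -> R,
        [/\ forall j, lie_smooth (g j), forall j x, g j x != 0 -> N x &
          forall x, chi x * chi x * (chi x * f x - f 1%g) = \sum_j kappa j x * g j x]].
Proof.
move=> N1; have oT := @openT V.
have : nbhs coord1 (chart_img chart1 `&` chart_inv chart1 @^-1` N).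
  apply: filterI.
    by apply: open_nbhs_nbhs; split; [exact: chart_img_open|exact: coord1_img].
  by apply: (chart_inv_cont coord1_img); rewrite coord1K.
move=> /nbhs_normP [e /= e0 He].
pose r := e / 2; have r0 : 0 < r by rewrite divr_gt0.
have rimg u : `|u - coord1| <= r -> chart_img chart1 u /\ N (chart_inv chart1 u).
  move=> ur; apply: He; rewrite /= distrC; apply: le_lt_trans ur _.
  by rewrite ltr_pdivrMr// ltr_pMr// ltr1n.
pose b := cutoff coord1 r.
pose bc j u := b u * (u - coord1) 0 j.
have supp_mul (h : V -> R) u : b u * h u != 0 -> `|u - coord1| < r.
  by rewrite mulf_eq0 negb_or => /andP[/(cutoff_supp r0)].
have supp_b u : b u != 0 -> `|u - coord1| < r by exact: cutoff_supp.
have Cb k : Ck k setT b by exact: Ck_cutoff.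
have Cbc j k : Ck k setT (bc j) by apply: Ck_mul (Cb k) (Ck_coordB k coord1 j).
exists (chart_ext b), (fun j => chart_ext (bc j)); split.
- split=> [|j]; first exact: (chart_ext_smooth r0 rimg).
  by apply: (chart_ext_smooth r0 rimg) => // u; exact: (supp_mul (fun u => (u - coord1) 0 j)).
- split=> [|j]; rewrite chart_extE; try exact: chart1_dom.
    exact: cutoff_center.
  by rewrite -/coord1 /bc subrr mxE mulr0.
- move=> i j; rewrite /field_of.
  have -> : 'D_(delta_mx 0 i) (fun u => chart_ext (bc j) (1 * chart_inv chart1 u)%g) coord1
     = 'D_(delta_mx 0 i) (bc j) coord1.
    apply: near_eq_derive.
    have : nbhs coord1 (chart_img chart1).
      by apply: open_nbhs_nbhs; split; [exact: chart_img_open|exact: coord1_img].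
    by apply: filterS => u cu; rewrite mul1g chart_ext_coord.
  have [db _] := Cb 1%N; have [dc _] := Ck_coordB 1%N coord1 j.
  have := @deriveM _ _ b (fun u : V => (u - coord1) 0 j) coord1 (delta_mx 0 i).
  move=> /(_ (diff_derivable (db _ I)) (diff_derivable (dc _ I))).
  rewrite -[X in 'D__ X _]/(bc j) => ->.
  rewrite subrr mxE scale0r addr0 /b cutoff_center scale1r.
  have -> : 'D_(delta_mx 0 i) (fun u : V => (u - coord1) 0 j) coord1 =
      'D_(delta_mx 0 i) (fun u : V => u 0 j) 0.
    have := @derive_affine _ _ _ _ (fun u : V => u - coord1) id (fun u : V => u 0 j)
      coord1 (delta_mx 0 i).
    rewrite subrr; apply; by move=> x t v; rewrite addrA.
  have := derive_mx (@derivable_id _ V 0 (delta_mx 0 i)).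
  rewrite derive_id => /(congr1 (fun M : V => M 0 j)); rewrite !mxE eqxx /= => <-.
  by rewrite eq_sym.
- split=> [x|j x]; first exact: (chart_ext_supp rimg).
  by apply: (chart_ext_supp rimg) => u; exact: (supp_mul (fun u => (u - coord1) 0 j)).
move=> f sf; have [g [Cg gE]] := cutoff_hadamard r0 rimg sf.
exists (fun j => chart_ext (fun u => b u * g j u)); split.
- move=> j; apply: (chart_ext_smooth r0 rimg); last by move=> u; exact: (supp_mul (g j)).
  by move=> k; exact: Ck_mul.
- by move=> j x; apply: (chart_ext_supp rimg) => u; exact: (supp_mul (g j)).
move=> x; have [dx|dx] := pselect (chart_dom chart1 x); last first.
  rewrite (chart_ext_out _ dx) !mul0r big1// => j _.
  by rewrite (chart_ext_out _ dx) mul0r.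
rewrite chart_extE//; set u := chart_map chart1 x.
have -> : f x = f (chart_inv chart1 u) by rewrite chart_mapE.
rewrite gE; last exact: chart_map_img.
rewrite mulr_sumr; apply: eq_bigr => j _; rewrite !chart_extE// -/u /bc; ring.
Qed.

End LocalCoordinates.

(** By Leibniz, delta kills the products kappa j * g j, as both delta and ev kill
    kappa j. Applied to the left-hand sides this gives
    delta f + ev f * delta chi = 0; the case f = 1 shows delta chi = 0. *)
Lemma point_derivation_eq0 (R : realType) (A : comAlgType R) (I : finType)
    (ev delta : A -> R) (chi : A) (kappa : I -> A) :
  (forall a f g, ev (a *: f + g) = a * ev f + ev g) ->
  (forall f g, ev (f * g) = ev f * ev g) -> ev 1 = 1 ->
  (forall a f g, delta (a *: f + g) = a * delta f + delta g) ->
  (forall f g, delta (f * g) = delta f * ev g + ev f * delta g) ->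
  ev chi = 1 -> (forall j, ev (kappa j) = 0) -> (forall j, delta (kappa j) = 0) ->
  (forall f, exists g : I -> A,
     chi * chi * (chi * f - ev f *: 1) = \sum_j kappa j * g j) ->
  forall f, delta f = 0.
Proof.
move=> evl evM ev1 dl dM ech ek dk had.
have d1 : delta 1 = 0.
  have := dM 1 1; rewrite mulr1 ev1 mulr1 mul1r => /eqP.
  by rewrite -subr_eq0 opprD addNKr oppr_eq0 => /eqP.
have d0 : delta 0 = 0 by have := dl (-1) 1 1; rewrite scaleN1r addNr mulN1r addNr.
have ev0 : ev 0 = 0 by have := evl (-1) 1 1; rewrite scaleN1r addNr mulN1r addNr.
have key f : delta f + ev f * delta chi = 0.
  have [g Hg] := had f.
  have : delta (chi * chi * (chi * f - ev f *: 1)) = 0.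
    rewrite Hg; elim/big_rec: _ => // j y _ Hy.
    by rewrite -[_ * _]scale1r dl dM dk ek !mul0r addr0 mulr0 add0r.
  rewrite dM !evM !ech !mul1r.
  have -> : chi * f - ev f *: 1 = (- ev f) *: 1 + chi * f by rewrite scaleNr addrC.
  rewrite evl dl d1 evM ech mul1r ev1 mulr1 addNr !mulr0 !add0r dM ech mul1r.
  by rewrite addrC mulrC.
move=> f; have := key 1; rewrite d1 ev1 mul1r add0r => dch.
by have := key f; rewrite dch mulr0 addr0.
Qed.

(** * Descent to the quotient by a discrete subgroup *)

Section InvariantFrame.
Context {R : realType} {m : nat} {G : lieGroupType R m}.
Local Notation CG := (smooth_fun (@id G)).
Local Notation X_ i := (inv_field (G := G) (delta_mx 0 i)).

Definition mkCG (f : G -> R) (sf : lie_smooth f) : CG :=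
  @SmoothFun _ _ _ _ (@id G) f (introT (asboolP _) sf).

(** At 1, the derivation f |-> D f - sum_j (D kappa_j) X_j f kills the coordinates
    kappa_j, so it is zero; left invariance carries this to the other points. *)
Lemma inv_field_span (D : lie_algebra G) :
  exists c : 'I_m -> R, D = \sum_j c j *: X_ j.
Proof.
have [chi [kap [[sc sk] [c1 k1] Xk _ had]]] := @local_coords R m G setT filterT.
pose K j := mkCG (sk j).
pose c j := D (K j) 1%g.
have [_ iD] := lie_algebraP D.
have XE j (f : CG) : X_ j f 1%g = field_of (delta_mx 0 j) f 1%g by [].
pose delta (f : CG) : R := D f 1%g - \sum_j c j * X_ j f 1%g.
have delta0 f : delta f = 0.
  apply: (@point_derivation_eq0 R CG 'I_m (fun f : CG => f 1%g) delta (mkCG sc) K) => //.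
  - move=> a f0 g; rewrite /delta. have E := lie_lin D a f0 g 1%g.
    rewrite [D _ _]E.
    rewrite mulrBr mulr_sumr addrACA -opprD -big_split /=.
    congr (_ - _); apply: eq_bigr => j _.
    have := lie_lin (X_ j) a f0 g 1%g; rewrite !XE => ->; ring.
  - move=> f0 g; rewrite /delta lie_mul mulrBl mulrBr mulr_sumr mulr_suml addrACA.
    rewrite -opprD -big_split /=.
    congr (_ - _); apply: eq_bigr => j _.
    have := lie_mul (X_ j) f0 g 1%g; rewrite !XE => ->; ring.
  - move=> j; rewrite /delta (bigD1 j)//= ?XE Xk eqxx mulr1 /c big1 ?addr0 ?subrr//.
    by move=> i ij; rewrite ?XE Xk (negPf ij) mulr0.
  - move=> f0; have [g [sg _ Hg]] := had _ (smooth_valE f0).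
    exists (fun j => mkCG (sg j)); apply: smooth_fun_ext => x.
    rewrite eval_sum !(evalM, evalD, evalN, evalZ, eval1) mulr1.
    by under eq_bigr do rewrite evalM; rewrite -Hg.
exists c; apply: lie_algebra_ext => f; apply: smooth_fun_ext => x.
have sh := lie_smooth_translate x (smooth_valE f).
have hf y : mkCG sh y = f (x * y)%g by [].
rewrite lieeval_sum eval_sum -[in LHS](mulg1 x) -(iD _ _ _ hf).
have := delta0 (mkCG sh); rewrite /delta => /eqP; rewrite subr_eq0 => /eqP ->.
apply: eq_bigr => j _; have [_ iX] := lie_algebraP (X_ j).
by rewrite (iX _ _ _ hf) mulg1 lieevalZ evalZ.
Qed.

(** Locally, a is the quotient e / d. *)
Lemma lie_smooth_div_local (a : G -> R) :
  (forall y, exists d e, [/\ lie_smooth d, lie_smooth e, d y != 0 &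
     forall x, d x * a x = e x]) -> lie_smooth a.
Proof.
move=> H c cA k; apply: Ck_cover => u cu.
have [d [e [sd se dy da]]] := H (chart_inv c u).
pose W : set G := d @^-1` [set z | z != 0].
have oW : open W.
  apply: open_comp; last exact: open_neq.
  by move=> x _; exact: lie_smooth_continuous.
exists (chart_img c `&` chart_inv c @^-1` W); first by split.
have oS := chart_inv_open (c := c) oW.
have Cd : Ck k (chart_img c `&` chart_inv c @^-1` W) (d \o chart_inv c).
  by apply: Ck_sub (sd c cA k) => v [].
have Ce : Ck k (chart_img c `&` chart_inv c @^-1` W) (e \o chart_inv c).
  by apply: Ck_sub (se c cA k) => v [].
have CV := CkV oS (fun v Sv => Sv.2) Cd.
have := Ck_mul oS CV Ce; apply: Ck_ext => // v [_ Wv].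
by rewrite -[LHS]/((d (chart_inv c v))^-1 * e (chart_inv c v)) -da mulKf.
Qed.

End InvariantFrame.

Section Quotient.
Context {R : realType} {m : nat} {G : lieGroupType R m}.
Variable Gamma : subgroup G.
Local Notation CG := (smooth_fun (@id G)).
Local Notation Gam := (subgroup_set Gamma).
Local Notation pi := (nil_proj Gamma).
Local Notation CM := (smooth_fun pi).
Local Notation X_ i := (inv_field (G := G) (delta_mx 0 i)).

Lemma nil_projP x y : pi x = pi y <-> Gam (y * x^-1)%g.
Proof.
split; first by move/(@eqmodP G (rcoset_equiv Gamma)) => /asboolP.
by move=> H; apply/(@eqmodP G (rcoset_equiv Gamma)); apply/asboolP.
Qed.

Lemma nil_projM (c x : G) : Gam c -> pi (c * x)%g = pi x.
Proof. by move=> Gc; apply/esym/nil_projP; rewrite mulgK. Qed.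

Lemma nil_proj_surj p : exists x, pi x = p.
Proof. by exists (repr (p : left_quotient Gamma)); exact: reprK. Qed.

Lemma smooth_nil_ext (f g : CM) : (forall x, f (pi x) = g (pi x)) -> f = g.
Proof. by move=> fg; apply: smooth_fun_ext => p; have [x <-] := nil_proj_surj p. Qed.

Definition invariant_fun (F : G -> R) := forall c x, Gam c -> F (c * x)%g = F x.

Lemma descend (F : G -> R) : lie_smooth F -> invariant_fun F ->
  {f : CM | forall x, f (pi x) = F x}.
Proof.
move=> sF iF; pose f (p : nilmanifold Gamma) : R^o := F (repr (p : left_quotient Gamma)).
have fE x : f (pi x) = F x.
  rewrite /f; set y := repr _.
  have /esym/nil_projP Gy : pi y = pi x by exact: reprK.
  by rewrite -(iF _ x Gy) mulgVK.
have sf : f \in smooth_pred pi.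
  by apply/asboolP; have -> : f \o pi = F by exact/funext.
by exists (SmoothFun sf).
Qed.

Lemma nil_pull_inv (f : CM) : invariant_fun (nil_pull f).
Proof. by move=> c x Gc; rewrite -[LHS]/(f (pi _)) nil_projM. Qed.

(** A left-invariant derivation commutes with the translations by Gamma, so it
    preserves the invariant functions. *)
Lemma desc_op_subproof (X : lie_algebra G) (f : CM) : invariant_fun (X (nil_pull f)).
Proof.
move=> c x Gc; have [_ iX] := lie_algebraP X.
by rewrite -(iX c (nil_pull f) (nil_pull f))// => y; rewrite nil_pull_inv.
Qed.

Definition desc_op (X : lie_algebra G) (f : CM) : CM :=
  sval (descend (smooth_valE (X (nil_pull f))) (desc_op_subproof X f)).

Lemma desc_opE (X : lie_algebra G) f x : desc_op X f (pi x) = X (nil_pull f) x.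
Proof. by rewrite /desc_op; case: descend => g /= ->. Qed.

Fact desc_subproof (X : lie_algebra G) : desc_op X \in @derivation_pred R CM.
Proof.
apply/asboolP; split=> [a f g|f g]; apply: smooth_nil_ext => x.
  rewrite evalD evalZ !desc_opE.
  have -> : nil_pull (a *: f + g) = a *: nil_pull f + nil_pull g.
    by apply: smooth_fun_ext => y; rewrite evalD evalZ.
  exact: lie_lin.
rewrite evalD !evalM !desc_opE.
have -> : nil_pull (f * g) = nil_pull f * nil_pull g.
  by apply: smooth_fun_ext => y; rewrite evalM.
by rewrite lie_mul.
Qed.

Definition desc (X : lie_algebra G) : derivation CM := Derivation (desc_subproof X).

Lemma descE (X : lie_algebra G) f x : desc X f (pi x) = X (nil_pull f) x.
Proof. exact: desc_opE. Qed.

Lemma desc_related (X : lie_algebra G) : proj_related X (desc X).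
Proof. by move=> f; apply: smooth_fun_ext => x; rewrite -descE. Qed.

Lemma related_desc (X : lie_algebra G) Y : proj_related X Y -> Y = desc X.
Proof.
move=> H; apply: derivation_ext => f; apply: smooth_nil_ext => x.
by rewrite descE H.
Qed.

Lemma descD (a : R) (X Y : lie_algebra G) : desc (a *: X + Y) = a%:A *: desc X + desc Y.
Proof.
apply: derivation_ext => f; apply: smooth_nil_ext => x; rewrite descE.
rewrite lieevalD lieevalZ derevalD derevalZ !evalD evalM !evalZ eval1 mulr1.
by rewrite !descE.
Qed.

Lemma desc_bracket (X Y : lie_algebra G) :
  desc (lie_bracket X Y) = derivation_bracket (desc X) (desc Y).
Proof.
apply/esym/related_desc => f.
have -> : lie_bracket X Y (nil_pull f) = X (Y (nil_pull f)) - Y (X (nil_pull f)) by [].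
rewrite !desc_related; apply: smooth_fun_ext => x.
have -> : derivation_bracket (desc X) (desc Y) f =
  desc X (desc Y f) - desc Y (desc X f) by [].
by rewrite evalD evalN.
Qed.

(** Gamma acts properly discontinuously. For e = 1 the conclusion says that the
    translates of y N under Gamma are disjoint; a neighbourhood E of 1 in place
    of 1 makes the family of the translates locally finite. *)
Lemma discrete_nbhs (U : set G) y : nbhs (1%g : G) U -> U `&` Gam = [set 1%g] ->
  exists N E : set G, [/\ nbhs (1%g : G) N, nbhs (1%g : G) E &
   forall c n n' e, Gam c -> N n -> N n' -> E e ->
     c = (y * n' * e * n^-1 * y^-1)%g -> c = 1%g].
Proof.
move=> U1 UG.
pose q (z : G * G * G) := (y * (z.1.1 * z.1.2 * z.2^-1) * y^-1)%g.
have M (T : topologicalType) (f g : T -> G) t : {for t, continuous f} -> {for t, continuous g} ->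
    {for t, continuous (fun t => (f t * g t)%g)}.
  move=> cf cg; apply: (@continuous_comp _ _ _ (fun t => (f t, g t)) (fun z : G * G => (z.1 * z.2)%g)).
    exact: cvg_pair.
  exact: lie_mul_continuous.
have cq : {for ((1%g, 1%g), 1%g) : G * G * G, continuous q}.
  apply: (M _ (fun z : G * G * G => y * (z.1.1 * z.1.2 * z.2^-1))%g); last exact: cvg_cst.
  apply: (M _ (fun=> y)); first exact: cvg_cst.
  apply: (M _ (fun z : G * G * G => z.1.1 * z.1.2)%g).
    apply: (M _ (fun z : G * G * G => z.1.1)).
      by apply: (@continuous_comp _ _ _ fst fst); exact: cvg_fst.
    by apply: (@continuous_comp _ _ _ fst snd); [exact: cvg_fst|exact: cvg_snd].
  apply: (@continuous_comp _ _ _ snd (fun x : G => x^-1%g)); first exact: cvg_snd.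
  exact: lie_inv_continuous.
have : nbhs (((1%g, 1%g), 1%g) : G * G * G) (q @^-1` U).
  by apply: cq; rewrite /q /= invg1 !mulg1 mulgV.
move=> [[/= AB C] [[[A B] [/= A1 B1] ABs] C1] H].
exists (A `&` C), B; split => //; first exact: filterI.
move=> c n n' e Gc [_ Cn] [An' _] Be E.
have : (U `&` Gam) c.
  split => //; have := H ((n', e), n); rewrite /q /= !mulgA -E; apply.
  by split => //; apply: ABs.
by rewrite UG.
Qed.

(** f is the sum of the translates of b by Gamma, at most one of which is nonzero
    at a given point. Near each point at most one translate of the support is
    met, so that the sum is locally a translate of b or zero. *)
Lemma periodize (U : set G) y : nbhs (1%g : G) U -> U `&` Gam = [set 1%g] ->
  exists2 N : set G, nbhs (1%g : G) N &
  forall b : G -> R, lie_smooth b -> (forall x, b x != 0 -> N (y^-1 * x)%g) ->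
  exists f : CM, [/\ forall x, N (y^-1 * x)%g -> f (pi x) = b x &
    forall x, (forall c, Gam c -> ~ N (y^-1 * (c * x))%g) -> f (pi x) = 0].
Proof.
move=> U1 UG; have [N [E [N1 E1 NE]]] := discrete_nbhs y U1 UG.
exists N => // b sb bN.
pose meets x c := Gam c /\ N (y^-1 * (c * x))%g.
pose F x := if pselect (exists c, meets x c) is left H then b (sval (cid H) * x)%g else 0.
have uniq x x' c c' : E (x'^-1 * x)%g -> meets x c -> meets x' c' -> c = c'.
  move=> Ex [Gc Nc] [Gc' Nc'].
  have : (c' * c^-1 = 1)%g.
    apply: (NE _ _ _ _ _ Nc Nc' Ex).
      by apply: subgroupM => //; exact: subgroupV.
    by rewrite !invgM !invgK !mulgA !(mulgK, mulgVK, mulgV, mul1g).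
  by move=> /(congr1 (fun z => z * c)%g); rewrite mulgVK mul1g.
have E11 : E 1%g by exact: nbhs_singleton.
have F1 x c : meets x c -> F x = b (c * x)%g.
  rewrite /F; case: pselect => [H|H] Hc; last by case: H; exists c.
  case: cid => c' /= Hc'; congr (b (_ * _)%g).
  by apply: (uniq x x) => //; rewrite mulVg.
have F0 x : ~ (exists c, meets x c) -> F x = 0 by rewrite /F; case: pselect.
have sF : lie_smooth F.
  apply: lie_smooth_local => x.
  have : nbhs x [set z | E (x^-1 * z)%g /\ E (z^-1 * x)%g].
    have c1 := @lie_mulr_continuous R m G x^-1%g x.
    have c2 : {for x, continuous (fun z : G => (z^-1 * x)%g)}.
      apply: (@continuous_comp _ _ _ (fun z : G => (z^-1, x)%g) (fun z : G * G => (z.1 * z.2)%g)).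
        by apply: cvg_pair; [exact: lie_inv_continuous|exact: cvg_cst].
      exact: lie_mul_continuous.
    by apply: filterI; [apply: c1|apply: c2]; rewrite /= mulVg.
  have cEE : nbhs (x^-1 * x)%g E by rewrite mulVg.
  pose q (z : G * G) := (z.1^-1 * z.2)%g.
  have cq : {for (x, x), continuous q}.
    apply: (@continuous_comp _ _ _ (fun z : G * G => (z.1^-1, z.2)%g) (fun z : G * G => (z.1 * z.2)%g)).
      apply: cvg_pair; last exact: cvg_snd.
      apply: (@continuous_comp _ _ _ fst (fun x : G => x^-1%g)); first exact: cvg_fst.
      exact: lie_inv_continuous.
    exact: lie_mul_continuous.
  move=> _; have [[A B] [/= Ax Bx] AB] := cq _ cEE.
  pose W := (A `&` B)^°.
  have oW : open W by exact: open_interior.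
  have Wx : W x by rewrite /W /interior; exact: filterI.
  have WE z z' : W z -> W z' -> E (z'^-1 * z)%g.
    by move=> /interior_subset [_ Bz] /interior_subset [Az' _]; exact: (AB (z', z)).
  have [[c [z [Wz Hz]]]|none] := pselect (exists c z, W z /\ meets z c).
    exists W, (fun z => b (c * z)%g); split => //; first exact: lie_smooth_translate.
    move=> w Ww; have [H|H] := pselect (exists c', meets w c').
      have [c' Hc'] := H; rewrite (F1 _ _ Hc').
      by rewrite (uniq _ _ _ _ (WE _ _ Ww Wz) Hc' Hz).
    rewrite F0//; apply/esym/eqP; apply: contrapT => /negP /bN Nc.
    by apply: H; exists c; split => //; have [] := Hz.
  exists W, (fun=> 0); split => //; first exact: lie_smooth_cst.
  by move=> w Ww; rewrite F0// => -[c Hc]; apply: none; exists c, w.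
have iF : invariant_fun F.
  move=> c x Gc; have [[c' [Gc' Nc']]|H] := pselect (exists c', meets x c').
    rewrite (F1 x c')// (F1 _ (c' * c^-1)%g) ?mulgA ?mulgVK//.
    by split; [apply: subgroupM => //; exact: subgroupV|rewrite !mulgA mulgVK -mulgA].
  rewrite !F0// => -[c' [Gc' Nc']]; apply: H; exists (c' * c)%g.
  by split; [exact: subgroupM|rewrite -mulgA].
have [f fE] := descend sF iF; exists f; split=> x Hx; rewrite fE.
  by rewrite (F1 x 1%g) ?mul1g//; split; [exact: subgroup1|rewrite mul1g].
by rewrite F0// => -[c [Gc Nc]]; exact: (Hx c).
Qed.

End Quotient.

(** * The frame of left-invariant fields on the quotient *)

Section Frame.
Context {R : realType} {m : nat} {G : lieGroupType R m}.
Variable Gamma : subgroup G.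
Local Notation Gam := (subgroup_set Gamma).
Local Notation pi := (nil_proj Gamma).
Local Notation CM := (smooth_fun pi).
Local Notation X_ i := (inv_field (G := G) (delta_mx 0 i)).
Hypothesis discrete : exists2 U : set G, nbhs 1%g U & U `&` Gam = [set 1%g].

(** The functions of [local_coords], translated to y and made periodic. *)
Lemma nil_coords y : exists (chi : CM) (kappa : 'I_m -> CM),
  [/\ chi (pi y) = 1, forall j, kappa j (pi y) = 0,
    forall i j, desc Gamma (X_ i) (kappa j) (pi y) = (i == j)%:R &
    forall f : CM, exists g : 'I_m -> CM,
      chi * chi * (chi * f - f (pi y) *: 1) = \sum_j kappa j * g j].
Proof.
have [U U1 UG] := discrete.
have [N N1 per] := periodize y U1 UG.
have [chi [kap [[sc sk] [c1 k1] Xk [suc suk] had]]] := local_coords N1.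
have [Chi [Chi1 Chi0]] := per _ (lie_smooth_translate y^-1%g sc) (fun x => suc _).
have /choice[K HK] j : exists f : CM,
    (forall x, N (y^-1 * x)%g -> f (pi x) = kap j (y^-1 * x)%g) /\
    (forall x, (forall c, Gam c -> ~ N (y^-1 * (c * x))%g) -> f (pi x) = 0).
  by have [f [H1 H2]] := per _ (lie_smooth_translate y^-1%g (sk j)) (fun x => suk j _); exists f.
have Ny : N (y^-1 * y)%g by rewrite mulVg; exact: nbhs_singleton.
exists Chi, K; split.
- by rewrite Chi1// mulVg.
- by move=> j; rewrite (HK j).1// mulVg.
- move=> i j; rewrite descE -[LHS]/(field_of (delta_mx 0 i) (nil_pull (K j)) y).
  rewrite (field_of_near _ (g := fun x => kap j (y^-1 * x)%g)).
    by rewrite field_of_translate mulVg Xk.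
  have cN : nbhs (y^-1 * y)%g N by rewrite mulVg.
  have : nbhs y [set x | N (y^-1 * x)%g].
    exact: (@lie_mulr_continuous R m G y^-1%g y N cN).
  by apply: filterS => x Nx; rewrite -(HK j).1.
move=> f; have [g [sg sug Hg]] := had _ (lie_smooth_translate y (smooth_valE (nil_pull f))).
have /choice[g' Hg'] j : exists f : CM,
    (forall x, N (y^-1 * x)%g -> f (pi x) = g j (y^-1 * x)%g) /\
    (forall x, (forall c, Gam c -> ~ N (y^-1 * (c * x))%g) -> f (pi x) = 0).
  by have [h [H1 H2]] := per _ (lie_smooth_translate y^-1%g (sg j)) (fun x => sug j _); exists h.
exists g'; apply: smooth_nil_ext => x.
rewrite eval_sum; under eq_bigr do rewrite evalM.
rewrite !(evalM, evalD, evalN, evalZ, eval1) mulr1.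
have [[c [Gc Nc]]|H] := pselect (exists c, Gam c /\ N (y^-1 * (c * x))%g).
  rewrite -(nil_projM x Gc) Chi1//.
  transitivity (\sum_j kap j (y^-1 * (c * x))%g * g j (y^-1 * (c * x))%g).
    rewrite -Hg; congr (_ * (_ * _ - _)).
      by rewrite mulVKg.
    by rewrite mulg1.
  by apply: eq_bigr => j _; rewrite (HK j).1// (Hg' j).1.
have H' c : Gam c -> ~ N (y^-1 * (c * x))%g by move=> Gc Nc; apply: H; exists c.
rewrite Chi0// !mul0r big1// => j _.
by rewrite (HK j).2// mul0r.
Qed.

(** The difference of the two sides is a derivation at p that kills the
    coordinates. *)
Lemma nil_frame_at p : exists kappa : 'I_m -> CM,
  (forall i j, desc Gamma (X_ i) (kappa j) p = (i == j)%:R) /\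
  forall (Y : derivation CM) f, Y f p = \sum_j Y (kappa j) p * desc Gamma (X_ j) f p.
Proof.
have [y <-] := nil_proj_surj p.
have [chi [K [c1 k1 Xk had]]] := nil_coords y.
exists K; split=> // Y f; apply/eqP; rewrite -subr_eq0; apply/eqP.
pose delta (f : CM) : R := Y f (pi y) - \sum_j Y (K j) (pi y) * desc Gamma (X_ j) f (pi y).
apply: (@point_derivation_eq0 R CM 'I_m (fun f : CM => f (pi y)) delta chi K) => //.
- move=> a f0 g; rewrite /delta der_lin mulrBr mulr_sumr addrACA -opprD -big_split /=.
  congr (_ - _); apply: eq_bigr => j _.
  by have /= -> := der_lin (desc Gamma (X_ j)) a f0 g (pi y); ring.
- move=> f0 g; rewrite /delta der_mul mulrBl mulrBr mulr_sumr mulr_suml addrACA.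
  rewrite -opprD -big_split /=.
  congr (_ - _); apply: eq_bigr => j _.
  by have /= -> := der_mul (desc Gamma (X_ j)) f0 g (pi y); ring.
- move=> j; rewrite /delta; under eq_bigr do rewrite Xk.
  rewrite (bigD1 j)//= eqxx mulr1 big1 ?addr0 ?subrr// => i ij.
  by rewrite (negPf ij) mulr0.
Qed.

(** Coordinate functions at p, chosen at each point p independently of each
    other. *)
Definition frame_coord (p : nilmanifold Gamma) : 'I_m -> CM := sval (cid (nil_frame_at p)).

Lemma frame_coordE p i j : desc Gamma (X_ i) (frame_coord p j) p = (i == j)%:R.
Proof. by rewrite /frame_coord; case: cid => k [] /=. Qed.

Lemma frame_expand p (Y : derivation CM) f :
  Y f p = \sum_j Y (frame_coord p j) p * desc Gamma (X_ j) f p.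
Proof. by rewrite {1}/frame_coord; case: cid => k [] /=. Qed.

(** Named so as to be a ring morphism that commutes with determinants. *)
Definition eval_at (p : nilmanifold Gamma) (f : CM) : R := f p.

Fact eval_at_zmod p : zmod_morphism (eval_at p).
Proof. by move=> f g; rewrite /eval_at evalD evalN. Qed.
Fact eval_at_monoid p : monoid_morphism (eval_at p).
Proof. by split=> [|f g]; [exact: eval1|exact: evalM]. Qed.
HB.instance Definition _ p := GRing.isZmodMorphism.Build CM R (eval_at p) (eval_at_zmod p).
HB.instance Definition _ p := GRing.isMonoidMorphism.Build CM R (eval_at p) (eval_at_monoid p).

(** With the coordinates K at a fixed point, the coefficients a of Y in the frame
    satisfy a B = Y K for the matrix B of the X_i K_j. By Cramer's rule (det B) a
    is smooth, and B is the identity at the fixed point. *)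
Lemma coef_smooth (Y : derivation CM) i :
  lie_smooth (fun x => Y (frame_coord (pi x) i) (pi x)).
Proof.
apply: lie_smooth_div_local => y.
pose K := frame_coord (pi y).
pose B : 'M[CM]_m := \matrix_(i, j) desc Gamma (X_ i) (K j).
pose e : CM := \sum_j Y (K j) * (\adj B) j i.
exists (nil_pull (\det B)), (nil_pull e); split; try exact: smooth_valE.
  rewrite -[nil_pull _ _]/(eval_at (pi y) (\det B)) -det_map_mx.
  suff -> : map_mx (eval_at (pi y)) B = 1%:M by rewrite det1 oner_neq0.
  by apply/matrixP => a b; rewrite !mxE; exact: frame_coordE.
move=> x; set p := pi x.
rewrite -[nil_pull _ x]/(eval_at p (\det B)) -[nil_pull e x]/(eval_at p e).
pose a : 'rV[R]_m := \row_j Y (frame_coord p j) p.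
have H : a *m map_mx (eval_at p) B = \row_j Y (K j) p.
  apply/rowP => j; rewrite !mxE (frame_expand p Y (K j)).
  by apply: eq_bigr => k _; rewrite !mxE.
have := congr1 (fun v => (v *m \adj (map_mx (eval_at p) B)) 0 i) H.
rewrite -mulmxA mul_mx_adj mul_mx_scalar [LHS]mxE [a 0 i]mxE det_map_mx => ->.
rewrite [LHS]mxE /e rmorph_sum; apply: eq_bigr => j _.
by rewrite [(\row_j _) 0 j]mxE rmorphM -map_mx_adj [map_mx _ _ _ _]mxE.
Qed.

Lemma coef_inv (Y : derivation CM) i :
  invariant_fun Gamma (fun x => Y (frame_coord (pi x) i) (pi x)).
Proof. by move=> c x Gc; rewrite nil_projM. Qed.

Definition coef i (Y : derivation CM) : CM := sval (descend (coef_smooth Y i) (coef_inv Y i)).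

Lemma coefE i Y p : coef i Y p = Y (frame_coord p i) p.
Proof.
have [x <-] := nil_proj_surj p.
by rewrite /coef; case: descend => f /= ->.
Qed.

Lemma coef_lin i (a : CM) (Y Z : derivation CM) : coef i (a *: Y + Z) = a * coef i Y + coef i Z.
Proof.
apply: smooth_fun_ext => p; rewrite coefE.
by rewrite derevalD derevalZ !(evalD, evalM) !coefE.
Qed.

Lemma coef_desc i j : coef i (desc Gamma (X_ j)) = (j == i)%:R.
Proof.
apply: smooth_fun_ext => p; rewrite coefE frame_coordE.
by rewrite eval_nat.
Qed.

Lemma frame_decomp (Y : derivation CM) : Y = \sum_j coef j Y *: desc Gamma (X_ j).
Proof.
apply: derivation_ext => f; apply: smooth_fun_ext => p.
rewrite dereval_sum eval_sum frame_expand; apply: eq_bigr => j _.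
by rewrite derevalZ evalM coefE.
Qed.

End Frame.

(** * An invariant mean on the compact quotient *)

Section InvariantMean.
Context {R : realType} {m : nat} {G : lieGroupType R m}.
Variable Gamma : subgroup G.
Local Notation Gam := (subgroup_set Gamma).
Local Notation pi := (nil_proj Gamma).
Local Notation CM := (smooth_fun pi).
Local Notation V := 'rV[R]_m.
Local Notation X_ i := (inv_field (G := G) (delta_mx 0 i)).
Local Notation chart1 := (@chart1 R m G).
Local Notation coord1 := (@coord1 R m G).
Hypothesis cpt : compact [set: nilmanifold Gamma].

(** The projection is open: the saturation of an open set is the union of its
    translates under Gamma. *)
Lemma nil_proj_nbhs x (A : set G) : nbhs x A -> nbhs (pi x) (pi @` A).
Proof.
move=> Ax; pose W := A^°.
have Wx : nbhs (pi x) (pi @` W).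
  apply: open_nbhs_nbhs; split; last by exists x.
  rewrite /open /= /quotient_open.
  have -> : (\pi_(left_quotient Gamma)%qT @^-1` (pi @` W)) =
      \bigcup_(c in Gam) ((fun y : G => (c * y)%g) @^-1` W).
    apply/seteqP; split => [y [z Wz /nil_projP Gc]|y [c Gc Wc]].
      exists (z * y^-1)%g; last by rewrite /= mulgVK.
      by have := subgroupV Gc; rewrite invgM invgK.
    by exists (c * y)%g => //; exact: nil_projM.
  apply: bigcup_open => c _; apply: open_comp; last exact: open_interior.
  by move=> y _; exact: lie_mulr_continuous.
apply: filterS Wx => p [z Wz <-]; exists z => //; exact: interior_subset.
Qed.

(** A property invariant under Gamma is one of points of the quotient, where
    compactness makes local conditions uniform. *)
Lemma near_uniform (I : Type) (F : set_system I) (P : I -> G -> Prop) : Filter F ->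
  (forall c i (x : G), Gam c -> P i x -> P i (c * x)%g) ->
  (forall x : G, \forall x' \near x & i \near F, P i x') ->
  \forall i \near F, forall x : G, P i x.
Proof.
move=> FF Pinv loc.
have /compact_near_coveringP := cpt.
move=> /(_ I F (fun i p => forall x, pi x = p -> P i x) FF) H.
have Q : \near F, [set: nilmanifold Gamma] `<=` (fun p => forall x, pi x = p -> P F x).
  apply: H => p _; have [y <-] := nil_proj_surj p.
  have [[A B] [/= Ay FB] AB] := loc y.
  exists (pi @` A, B); first by split => //; exact: nil_proj_nbhs.
  move=> [q i] /= [[z Az <-] Bi] x /nil_projP Gc.
  have := Pinv _ _ _ (subgroupV Gc) (AB (z, i) (conj Az Bi)).
  by rewrite invgM invgK mulgVK.
by apply: filterS Q => i Hi x; exact: (Hi (pi x)).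
Qed.

Lemma nil_bounded (f : CM) : exists B : R, forall x, `|nil_pull f x| <= B.
Proof.
have H : \forall B \near +oo, forall x : G, `|nil_pull f x| <= (B : R).
  apply: (near_uniform (P := fun B (x : G) => `|nil_pull f x| <= B)) => [c i x Gc|x]; first by rewrite nil_pull_inv.
  exists ([set y | `|nil_pull f y - nil_pull f x| < 1], [set B : R | `|nil_pull f x| + 1 <= B]).
    split => /=.
      have cf : continuous (nil_pull f : G -> R).
        exact: (lie_smooth_continuous (smooth_valE (nil_pull f))).
      have := cf x; move=> /cvgrPdist_lt /(_ 1 ltr01).
      by apply: filterS => y; rewrite distrC.
    by exists (`|nil_pull f x| + 1); split; [exact: num_real|move=> B /ltW].
  move=> [y B] /= [Hy HB]; apply: le_trans HB.
  by have := lerB_dist (nil_pull f y) (nil_pull f x); move: Hy; lra.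
have [B HB] := filter_ex H; by exists B.
Qed.

(** A straight line in the chart, with the velocity of X_i at t = 0. *)
Definition curve i (t : R) : G := chart_inv chart1 (t *: delta_mx 0 i + coord1).

(** Locally in x, the mean value theorem in t compares the difference quotient with
    a value of the continuous partial derivative of f (y z) near z = 1; uniformity
    comes from [near_uniform]. *)
Lemma curve_diff_quotient (f : CM) i (e : R) : 0 < e ->
  \forall t \near (0 : R), forall x : G, 0 < t ->
    `|nil_pull f (x * curve i t)%g - nil_pull f x - t * X_ i (nil_pull f) x| <= e * t.
Proof.
move=> e0; set F := nil_pull f; have sF : lie_smooth F by exact: smooth_valE.
have XE x : X_ i F x = field_of (delta_mx 0 i) F x by [].
have FI c x : Gam c -> F (c * x)%g = F x by exact: nil_pull_inv.
have XI c x : Gam c -> X_ i F (c * x)%g = X_ i F x by exact: desc_op_subproof.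
pose P (t : R) (x : G) := 0 < t ->
    `|F (x * curve i t)%g - F x - t * X_ i F x| <= e * t.
apply: (@near_uniform R (nbhs (0 : R)) P _) => [c t x Gc|x]; rewrite /P.
  by rewrite -(mulgA c x) !(FI c _ Gc) (XI c x Gc).
move=> {P}; have [c cA cx] := chart_at x; set y := chart_map c x.
pose H (z : V * V) := F (chart_inv c z.1 * chart_inv chart1 z.2)%g.
pose S := chart_img c `*` chart_img chart1.
have [dH DH] := smooth_mul_charts 1 sF cA chart1_atlas.
pose D (z : V * V) := 'D_((0, delta_mx 0 i) : V * V) H z.
have yS : S (y, coord1) by split; [exact: chart_map_img|exact: coord1_img].
have oS : open S by apply: open_setX; exact: chart_img_open.
have cD : {for (y, coord1), continuous D} by exact: (DH (0, delta_mx 0 i)).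
have e2 : 0 < e / 2 by rewrite divr_gt0.
have near1 : \forall z \near (y, coord1), S z /\ `|D (y, coord1) - D z| < e / 2.
  apply: filterI; first exact: open_nbhs_nbhs.
  by move/cvgrPdist_lt : cD; apply.
have [[A B] [/= Ay Bu] AB] := near1.
have cl : {for 0, continuous (fun t : R => t *: (delta_mx 0 i : V) + coord1)}.
  by move=> /=; apply: cvgD; [exact: scalel_continuous|exact: cvg_cst].
have /nbhs_normP [d /= d0 Hd] : \forall t \near (0 : R), B (t *: delta_mx 0 i + coord1).
  by apply: cl; rewrite scale0r add0r.
have Hd' t : 0 <= t -> t < d -> B (t *: delta_mx 0 i + coord1).
  by move=> t0 td; apply: Hd; rewrite /= sub0r normrN ger0_norm.
exists ([set x' | chart_dom c x' /\ A (chart_map c x')], [set t | `|t| < d]).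
  split => /=; last by apply/nbhs_normP; exists d => // t /=; rewrite sub0r normrN.
  apply: filterI; last exact: chart_map_cont.
  by apply: open_nbhs_nbhs; split => //; exact: chart_open.
move=> [x' t] /= [[dx' Ax'] td] t0; rewrite gtr0_norm// in td.
set y' := chart_map c x'.
have x'E : x' = chart_inv c y' by rewrite /y' chart_mapE.
pose L (s : R) : V * V := (y', s *: delta_mx 0 i + coord1).
have SL s : 0 <= s -> s <= t -> S (L s) /\ `|D (y, coord1) - D (L s)| < e / 2.
  by move=> s0 st; apply: AB; split => //=; apply: Hd' => //; exact: le_lt_trans td.
have dk s : 0 <= s -> s <= t -> is_derive s 1 (H \o L) (D (L s)).
  move=> s0 st; have [Ss _] := SL s s0 st.
  have dfs : derivable H (L s) ((0, delta_mx 0 i) : V * V) by exact/diff_derivable/dH.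
  have E : (fun h : R => h^-1 *: ((H \o L \o shift s) (h *: 1) - (H \o L) s)) =
      (fun h : R => h^-1 *: ((H \o shift (L s)) (h *: ((0, delta_mx 0 i) : V * V)) - H (L s))).
    apply/funext => h /=; congr (_ *: (H _ - _)); rewrite /L [h *: 1]mulr1.
    by congr pair; rewrite /= ?scaler0 ?add0r// scalerDl addrA.
  by split; rewrite /derivable /D /derive E.
have [||s] := @MVT R (H \o L) (D \o L) 0 t t0.
- by move=> s; rewrite in_itv /= => /andP[s0 st]; apply: dk; exact: ltW.
- apply: continuous_in_subspaceT => s; rewrite inE /= in_itv /= => /andP[s0 st].
  apply: differentiable_continuous; apply/derivable1_diffP.
  by have [] := dk s s0 st.
rewrite in_itv /= => /andP[/ltW s0 /ltW st]; rewrite subr0 => E.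
rewrite -[leLHS]/(`|F (x' * curve i t)%g - F x' - t * X_ i F x'|).
have -> : F (x' * curve i t)%g = (H \o L) t by rewrite /H /L /= -x'E.
have -> : F x' = (H \o L) 0 by rewrite /H /L /= scale0r add0r coord1K mulg1 -x'E.
have -> : X_ i F x' = D (L 0).
  by rewrite XE x'E (field_of_chart _ _ _ cA) /L scale0r add0r.
rewrite E /= mulrC -mulrBr normrM gtr0_norm// mulrC ler_wpM2r// ?(ltW t0)//.
have [_ H1] := SL s s0 st; have [_ H2] := SL 0 (lexx _) (ltW t0).
move: H1 H2; rewrite /=; move: (D (y, coord1)) (D (L s)) (D (L 0)) => a b c'.
by rewrite !ltr_norml ler_norml; lra.
Qed.

Hypothesis nilp : nilpotent_group G.

(** Otherwise the sum over i of f_i (x g_i) - f_i x, with g_i on the curve of X_i at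
    a small time t, would be at least t / 2 everywhere on G. *)
Lemma one_not_divergence (f : 'I_m -> CM) : \sum_i desc Gamma (X_ i) (f i) <> 1.
Proof.
move=> E.
(* So small that m errors of size e * t add up to at most t / 2. *)
pose e : R := (2 * m.+1%:R)^-1.
have e0 : 0 < e by rewrite invr_gt0 mulr_gt0.
have H : \forall t \near (0 : R), forall i (x : G), 0 < t ->
    `|nil_pull (f i) (x * curve i t)%g - nil_pull (f i) x - t * X_ i (nil_pull (f i)) x| <= e * t.
  apply: (@filter_forall R 'I_m (fun i (t : R) => forall x : G, 0 < t ->
    `|nil_pull (f i) (x * curve i t)%g - nil_pull (f i) x - t * X_ i (nil_pull (f i)) x| <= e * t) (nbhs (0 : R)) _) => i.
  exact: curve_diff_quotient.
move: H => /nbhs_normP [d /= d0 Hd].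
pose t := d / 2; have t0 : 0 < t by rewrite divr_gt0.
have td : `|t| < d by rewrite gtr0_norm// ltr_pdivrMr// ltr_pMr// ltr1n.
have {}Hd i x : - (e * t) <= nil_pull (f i) (x * curve i t)%g - nil_pull (f i) x
    - t * X_ i (nil_pull (f i)) x.
  have := Hd t; rewrite /= sub0r normrN => /(_ td i x t0).
  by rewrite ler_norml => /andP[].
have [n cob] : exists n, coboundary setT n (fun x : G =>
    \sum_i (nil_pull (f i) (x * curve i t)%g - nil_pull (f i) x)).
  apply: (@coboundary_sum R G setT 'I_m (index_enum 'I_m) (fun i (x : G) =>
    nil_pull (f i) (x * curve i t)%g - nil_pull (f i) x)) => i.
  exists 1; have := CoboundaryS (S := setT) (h := curve i t) (f := nil_pull (f i)) I
    (nil_bounded (f i)) (Coboundary0 setT).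
  by under [X in coboundary _ _ X -> _]eq_fun do rewrite addr0.
have [x] := nilpotent_no_gap nilp cob (c := t / 2) (divr_gt0 t0 (ltr0Sn _ _)).
apply/negP; rewrite -leNgt.
have Ex : \sum_i X_ i (nil_pull (f i)) x = 1.
  have := congr1 (fun h : CM => h (pi x)) E; rewrite eval1 eval_sum => <-.
  by apply: eq_bigr => i _; rewrite descE.
have S : \sum_(i < m) (- (e * t) + t * X_ i (nil_pull (f i)) x) <=
    \sum_i (nil_pull (f i) (x * curve i t)%g - nil_pull (f i) x).
  by apply: ler_sum => i _; rewrite -lerBrDr.
apply: le_trans S; rewrite big_split /= -mulr_sumr Ex mulr1 sumr_const card_ord.
suff : (e * t) *+ m <= t / 2 by rewrite mulNrn; lra.
rewrite -[_ *+ m]mulr_natr mulrAC mulrC ler_wpM2l ?(ltW t0)//.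
rewrite /e invfM -mulrA ler_piMr// ler_pdivrMl ?ltr0Sn// mulr1 ler_nat.
exact: leqnSn.
Qed.

(** Plays the role of integration against the invariant volume of total mass 1. *)
Lemma invariant_functional : exists I : CM -> R,
  [/\ forall a f g, I (a *: f + g) = a * I f + I g,
      forall (X : lie_algebra G) f, I (desc Gamma X f) = 0 & I 1 = 1].
Proof.
pose S := [set h : CM | exists f : 'I_m -> CM, h = \sum_i desc Gamma (X_ i) (f i)].
have der0 (Y : derivation CM) : Y 0 = 0.
  by have [lY _] := derivationP Y; have := lY (-1) 1 1; rewrite !scaleN1r !addNr.
have S0 : S 0 by exists (fun=> 0); rewrite big1// => i _; exact: der0.
have Sl (a : R) x y : S x -> S y -> S (a *: x + y).
  move=> [f ->] [g ->]; exists (fun i => a *: f i + g i).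
  rewrite scaler_sumr -big_split; apply: eq_bigr => i _.
  by have [lY _] := derivationP (desc Gamma (X_ i)); exact/esym/lY.
have S1 : ~ S 1 by move=> [f /esym]; exact: one_not_divergence.
have [I [Il I0 I1]] := separating_functional S0 Sl S1.
exists I; split => // X f; apply: I0.
have [c ->] := inv_field_span X; exists (fun i => c i *: f).
apply: smooth_nil_ext => x; rewrite descE lieeval_sum !eval_sum.
apply: eq_bigr => i _; rewrite lieevalZ evalZ descE.
have -> : nil_pull (c i *: f) = c i *: nil_pull f + 0.
  by apply: smooth_fun_ext => z; rewrite addr0.
have [[lX _] _] := lie_algebraP (X_ i).
have lX0 : X_ i 0 = 0 by have := lX (-1) 1 1; rewrite !scaleN1r !addNr.
by rewrite lie_lin lX0 eval0 addr0.
Qed.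

End InvariantMean.

(** * Tensoriality of the Koszul differential *)

Section Koszul.
Variables (B E : zmodType) (mul : B -> B -> B) (sc : B -> E -> E)
  (rho : E -> B -> B) (br : E -> E -> E).
Implicit Types (w : seq E -> B) (s : seq E) (a b : B) (X Y Z : E).

Definition delete s i := take i s ++ drop i.+1 s.

(** The differential of forms for an abstract action rho by derivations and
    bracket br. Complexified fields and functions are an instance with the
    complexified operations. *)
Definition koszul w s : B :=
  \sum_(i < size s) rho s`_i (w (delete s i)) *~ (-1) ^+ i
  + \sum_(j < size s) \sum_(i < j)
      w (br s`_i s`_j :: delete (delete s j) i) *~ (-1) ^+ (i + j).

Definition multilin w := forall s1 s2 a X Y,
  w (s1 ++ sc a X + Y :: s2) = mul a (w (s1 ++ X :: s2)) + w (s1 ++ Y :: s2).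

Definition alternating w := forall s1 s2 s3 X, w (s1 ++ X :: s2 ++ X :: s3) = 0.

Hypothesis mulDr : forall a b c, mul a (b + c) = mul a b + mul a c.
Variable e : B.
Hypothesis mul1 : forall b, mul e b = b.
Hypothesis sc1 : forall X, sc e X = X.
Hypothesis rhoD : forall X b c, rho X (b + c) = rho X b + rho X c.
Hypothesis rhoM : forall X a b, rho X (mul a b) = mul (rho X a) b + mul a (rho X b).
Hypothesis rho_lin : forall a X Y b, rho (sc a X + Y) b = mul a (rho X b) + rho Y b.
Hypothesis br_lin : forall X a Y Z, br X (sc a Y + Z) = sc (rho X a) Y + (sc a (br X Y) + br X Z).
Hypothesis br_anti : forall X Y, br X Y = - br Y X.

Lemma mulBr a b c : mul a (b - c) = mul a b - mul a c.
Proof. by apply/(addIr (mul a c)); rewrite -mulDr !subrK. Qed.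

Lemma rhoN X b : rho X (- b) = - rho X b.
Proof.
have r0 : rho X 0 = 0 by apply/(addrI (rho X 0)); rewrite -rhoD !addr0.
by apply/(addrI (rho X b)); rewrite -rhoD !subrr.
Qed.

Lemma signS (b : B) n : b *~ (-1) ^+ n.+1 = - (b *~ (-1) ^+ n).
Proof. by rewrite exprS mulN1r mulrNz. Qed.

Section Form.
Variable w : seq E -> B.
Hypotheses (wl : multilin w) (wa : alternating w).

Lemma formD s1 s2 X Y : w (s1 ++ X + Y :: s2) = w (s1 ++ X :: s2) + w (s1 ++ Y :: s2).
Proof. by have := wl s1 s2 e X Y; rewrite sc1 mul1. Qed.

Lemma form_sum (I : Type) (r : seq I) (c : I -> B) (F : I -> E) s1 s2 :
  w (s1 ++ \sum_(i <- r) sc (c i) (F i) :: s2) =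
  \sum_(i <- r) mul (c i) (w (s1 ++ F i :: s2)).
Proof.
elim: r => [|i r IH]; last by rewrite !big_cons wl IH.
by rewrite !big_nil; apply/(addrI (w (s1 ++ 0 :: s2))); rewrite -formD !addr0.
Qed.

Lemma formN s1 s2 X : w (s1 ++ - X :: s2) = - w (s1 ++ X :: s2).
Proof.
have f0 : w (s1 ++ 0 :: s2) = 0.
  by apply/(addrI (w (s1 ++ 0 :: s2))); rewrite -formD !addr0.
by apply/(addrI (w (s1 ++ X :: s2))); rewrite -formD !subrr.
Qed.

Lemma form_swap s1 s2 X Y : w (s1 ++ X :: Y :: s2) = - w (s1 ++ Y :: X :: s2).
Proof.
have := wa s1 [::] s2 (X + Y); rewrite /= formD.
have H Z : w (s1 ++ Z :: X + Y :: s2) = w (s1 ++ Z :: X :: s2) + w (s1 ++ Z :: Y :: s2).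
  by rewrite -!(cat_rcons Z) formD.
rewrite !H (wa s1 [::] s2 X) (wa s1 [::] s2 Y) add0r addr0 => /eqP.
by rewrite addr_eq0 => /eqP.
Qed.

Lemma form_move s1 s2 X : w (s1 ++ X :: s2) = w (X :: s1 ++ s2) *~ (-1) ^+ size s1.
Proof.
elim/last_ind: s1 s2 => [|s1 Y IH] s2; first by rewrite expr0.
by rewrite cat_rcons form_swap IH size_rcons signS cat_rcons.
Qed.

Lemma contract_multilin X : multilin (fun s => w (X :: s)).
Proof. by move=> s1 s2 a Y Z; rewrite -!cat_cons wl. Qed.

Lemma contract_alternating X : alternating (fun s => w (X :: s)).
Proof. by move=> s1 s2 s3 Y; rewrite -!cat_cons wa. Qed.

(** Minus the part of the Lie derivative along X that acts on the arguments. The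
    prefix p allows induction on s. *)
Definition lie_sum w0 p X s : B :=
  \sum_(j < size s) w0 (p ++ take j s ++ br X s`_j :: drop j.+1 s).

Lemma lie_sum_cons w0 p X Y s :
  lie_sum w0 p X (Y :: s) = w0 (p ++ br X Y :: s) + lie_sum w0 (rcons p Y) X s.
Proof.
rewrite /lie_sum /= big_ord_recl /= drop0; congr (_ + _).
by apply: eq_bigr => j _; rewrite cat_rcons.
Qed.

(** Cartan's formula: the contraction of d w with X is the Lie derivative of w
    along X minus d of the contraction of w with X. It reduces the properties of
    d to induction on the number of arguments. *)
Lemma koszul_cons X s :
  koszul w (X :: s) = rho X (w s) - lie_sum w [::] X s - koszul (fun s => w (X :: s)) s.
Proof.
rewrite /koszul /= big_ord_recl /= {1}/delete take0 /= drop0 expr0.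
rewrite [X in _ + _ + X]big_ord_recl big_ord0 add0r /=.
rewrite -!addrA; congr (_ + _).
have -> : \sum_(i < size s) rho s`_i (w (delete (X :: s) (bump 0 i))) *~ (-1) ^+ bump 0 i =
    - \sum_(i < size s) rho s`_i (w (X :: delete s i)) *~ (-1) ^+ i.
  by rewrite -sumrN; apply: eq_bigr => i _; rewrite /bump /= add1n signS.
rewrite opprD addrCA; congr (_ + _).
rewrite /lie_sum -!sumrN -big_split /=; apply: eq_bigr => j _.
rewrite /bump /= add1n big_ord_recl /= add0n.
rewrite {1}/delete take0 /= drop0 signS; congr (_ + _).
  by rewrite form_move size_takel ?(ltnW (ltn_ord j)).
rewrite -sumrN; apply: eq_bigr => i _; rewrite /bump /= add1n addSn addnS !signS opprK.
by rewrite (form_swap [::]) /= mulNrz.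
Qed.

End Form.

Lemma lie_sum_prefix w X p1 p2 a Y Z s : multilin w ->
  lie_sum w (p1 ++ sc a Y + Z :: p2) X s =
  mul a (lie_sum w (p1 ++ Y :: p2) X s) + lie_sum w (p1 ++ Z :: p2) X s.
Proof.
move=> wl; elim: s p2 => [|V s IH] p2.
  by rewrite /lie_sum !big_ord0 addr0; apply/esym/(addrI (mul a 0)); rewrite -mulDr !addr0.
rewrite !lie_sum_cons !rcons_cat !rcons_cons IH -!catA !cat_cons wl mulDr.
by rewrite addrACA.
Qed.

(** The bracket [X, a Y] produces the extra term (X a) Y. *)
Lemma lie_sum_multilin w X s1 s2 p a Y Z : multilin w ->
  lie_sum w p X (s1 ++ sc a Y + Z :: s2) =
  mul (rho X a) (w (p ++ s1 ++ Y :: s2)) +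
  (mul a (lie_sum w p X (s1 ++ Y :: s2)) + lie_sum w p X (s1 ++ Z :: s2)).
Proof.
move=> wl; elim: s1 p => [|V s1 IH] p /=; rewrite !lie_sum_cons mulDr.
  have := @lie_sum_prefix w X p [::] a Y Z s2 wl; rewrite -!cats1 => ->.
  by rewrite br_lin !wl -!addrA; congr (_ + (_ + _)); rewrite addrCA.
rewrite IH cat_rcons -!cat_cons !catA wl addrCA; congr (_ + _).
by rewrite addrACA.
Qed.

Lemma subr_common (V : zmodType) (u x y : V) : (u + x) - (u + y) = x - y.
Proof. by rewrite opprD addrACA subrr add0r. Qed.

Lemma subr_pair (V : zmodType) (x y p q : V) : (x + y) - (p + q) = (x - p) + (y - q).
Proof. by rewrite opprD addrACA. Qed.

(** In Cartan's formula the extra terms with X a, one from X (a w(.., Y, ..)) and one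
    from [X, a Y], cancel. *)
Lemma koszul_slot X w s1 s2 a Y Z : multilin w -> alternating w ->
  koszul (fun s => w (X :: s)) (s1 ++ sc a Y + Z :: s2) =
    mul a (koszul (fun s => w (X :: s)) (s1 ++ Y :: s2)) +
    koszul (fun s => w (X :: s)) (s1 ++ Z :: s2) ->
  koszul w (X :: s1 ++ sc a Y + Z :: s2) =
    mul a (koszul w (X :: s1 ++ Y :: s2)) + koszul w (X :: s1 ++ Z :: s2).
Proof.
move=> wl wa IH; rewrite !koszul_cons// IH lie_sum_multilin// wl rhoD rhoM !mulBr.
rewrite cat0s -(addrA (mul (rho X a) _)) subr_common.
by rewrite (subr_pair (mul a (rho X _))) (subr_pair (mul a _ - _)).
Qed.

Lemma koszulN w s : koszul (fun s => - w s) s = - koszul w s.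
Proof.
rewrite /koszul opprD -!sumrN; congr (_ + _); apply: eq_bigr => i _.
  by rewrite rhoN mulNrz.
by rewrite -sumrN; apply: eq_bigr => j _; rewrite mulNrz.
Qed.

Lemma swap_cancel (V : zmodType) (a b c l1 l2 k : V) :
  a - (c + l1) - (b - l2 - k) + (b - (- c + l2) - (a - l1 - - k)) = 0.
Proof.
apply/eqP; rewrite addrC addr_eq0 !opprD !opprK !addrA; apply/eqP.
by rewrite (ACl (4*2*5*1*3*6)).
Qed.

(** Two applications of Cartan's formula give an expression that is antisymmetric
    term by term. *)
Lemma koszul_swap w X Z s : multilin w -> alternating w ->
  koszul w (X :: Z :: s) = - koszul w (Z :: X :: s).
Proof.
move=> wl wa; apply/eqP; rewrite -addr_eq0; apply/eqP.
have cl U := contract_multilin wl U; have ca U := contract_alternating wa U.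
rewrite (koszul_cons wl wa X) (koszul_cons (cl X) (ca X)).
rewrite (koszul_cons wl wa Z) (koszul_cons (cl Z) (ca Z)) !lie_sum_cons /=.
have -> : koszul (fun s => w (Z :: X :: s)) s = - koszul (fun s => w (X :: Z :: s)) s.
  rewrite -koszulN; congr (koszul _ s); apply/funext => t.
  exact: (form_swap wl wa [::]).
have -> : w (br Z X :: s) = - w (br X Z :: s).
  by rewrite br_anti (formN wl [::]).
have pc U V : lie_sum (fun s => w (U :: s)) [::] V s = lie_sum w [:: U] V s by [].
rewrite !pc.
exact: swap_cancel.
Qed.

(** Cartan's formula gives linearity in every argument but the first, by induction on
    the number of arguments; antisymmetry carries it to the first one. *)
Lemma koszul_multilin w : multilin w -> alternating w -> multilin (koszul w).
Proof.
move=> + + s1 s2; have [n] := ubnP (size s1 + size s2); elim: n w s1 s2 => // n IH w.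
have step X s1 s2 a Y Z : (size s1 + size s2 < n)%N -> multilin w -> alternating w ->
  koszul w (X :: s1 ++ sc a Y + Z :: s2) =
    mul a (koszul w (X :: s1 ++ Y :: s2)) + koszul w (X :: s1 ++ Z :: s2).
  move=> sz wl wa; apply: koszul_slot => //; apply: IH => //.
    exact: contract_multilin.
  exact: contract_alternating.
case=> [|X s1] s2 /=; rewrite ?addSn ltnS => sz wl wa a Y Z; last first.
  exact: step.
case: s2 sz => [|X s2] sz.
  rewrite !(koszul_cons wl wa) /lie_sum /koszul /= !big_ord0 !addr0 !subr0.
  exact: rho_lin.
have mulN b : mul a (- b) = - mul a b.
  have m0 : mul a 0 = 0 by apply/(addrI (mul a 0)); rewrite -mulDr !addr0.
  by rewrite -sub0r mulBr m0 sub0r.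
rewrite /= (koszul_swap (sc a Y + Z) X _ wl wa) (koszul_swap Y X _ wl wa).
by rewrite (koszul_swap Z X _ wl wa) (step X [::])// mulN opprD.
Qed.

End Koszul.

(** * Forms over a Lie-Rinehart pair *)

Lemma cplx_eq (V : Type) (x y : cplx V) : cre x = cre y -> cim x = cim y -> x = y.
Proof. by case: x y => [a b] [c d] /= -> ->. Qed.

Section CplxComponents.
Variable V : zmodType.
Implicit Types x y : cplx V.
Lemma creD x y : cre (x + y) = cre x + cre y. Proof. by []. Qed.
Lemma cimD x y : cim (x + y) = cim x + cim y. Proof. by []. Qed.
Lemma creN x : cre (- x) = - cre x. Proof. by []. Qed.
Lemma cimN x : cim (- x) = - cim x. Proof. by []. Qed.
Lemma cre0 : cre (0 : cplx V) = 0. Proof. by []. Qed.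
Lemma cim0 : cim (0 : cplx V) = 0. Proof. by []. Qed.
Lemma cre_sum (I : Type) (r : seq I) (P : pred I) (F : I -> cplx V) :
  cre (\sum_(i <- r | P i) F i) = \sum_(i <- r | P i) cre (F i).
Proof. by apply: (big_morph (@cre V)) => [x y|]; [exact: creD|exact: cre0]. Qed.
Lemma cim_sum (I : Type) (r : seq I) (P : pred I) (F : I -> cplx V) :
  cim (\sum_(i <- r | P i) F i) = \sum_(i <- r | P i) cim (F i).
Proof. by apply: (big_morph (@cim V)) => [x y|]; [exact: cimD|exact: cim0]. Qed.
End CplxComponents.
Definition cplxE := (creD, cimD, creN, cimN).

Section LieRinehart.
Context {K : fieldType} {A : comAlgType K} {L : lmodType A}.
Variables (anchor : L -> A -> A) (bracket : L -> L -> L) (J : L -> L).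
Local Notation LC := (cplx L).
Local Notation AC := (cplx A).
Local Notation mulC := (cplx_bilin ( *%R : A -> A -> A)).
Local Notation scC := (cplx_bilin ( *:%R : A -> L -> L)).
Hypothesis anchorD : forall X a b, anchor X (a + b) = anchor X a + anchor X b.
Hypothesis anchorM : forall X a b, anchor X (a * b) = anchor X a * b + a * anchor X b.
Hypothesis anchor_lin : forall a X Y b, anchor (a *: X + Y) b = a * anchor X b + anchor Y b.
Hypothesis bracket_lin : forall X a Y Z,
  bracket X (a *: Y + Z) = anchor X a *: Y + (a *: bracket X Y + bracket X Z).
Hypothesis bracket_anti : forall X Y, bracket X Y = - bracket Y X.
Hypothesis J_lin : forall a X Y, J (a *: X + Y) = a *: J X + J Y.

Let anchorDl X Y b : anchor (X + Y) b = anchor X b + anchor Y b.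
Proof. by have := anchor_lin 1 X Y b; rewrite scale1r mul1r. Qed.
Let anchorN X b : anchor X (- b) = - anchor X b.
Proof.
have r0 : anchor X 0 = 0 by apply/(addrI (anchor X 0)); rewrite -anchorD !addr0.
by apply/(addrI (anchor X b)); rewrite -anchorD !subrr.
Qed.
Let anchor0l b : anchor 0 b = 0.
Proof. by apply/(addrI (anchor 0 b)); rewrite -anchorDl !addr0. Qed.
Let anchorNl X b : anchor (- X) b = - anchor X b.
Proof. by apply/(addrI (anchor X b)); rewrite -anchorDl !subrr anchor0l. Qed.
Let anchorZl a X b : anchor (a *: X) b = a * anchor X b.
Proof. by have := anchor_lin a X 0 b; rewrite addr0 anchor0l addr0. Qed.
Let anchor1 X : anchor X 1 = 0.
Proof. by have := anchorM X 1 1; rewrite !mulr1 mul1r => /eqP; rewrite -subr_eq0 opprD addNKr oppr_eq0 => /eqP. Qed.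
Let bracketD X Y Z : bracket X (Y + Z) = bracket X Y + bracket X Z.
Proof. by have := bracket_lin X 1 Y Z; rewrite !scale1r anchor1 scale0r add0r. Qed.
Let bracket0 X : bracket X 0 = 0.
Proof. by apply/(addrI (bracket X 0)); rewrite -bracketD !addr0. Qed.
Let bracketN X Y : bracket X (- Y) = - bracket X Y.
Proof. by apply/(addrI (bracket X Y)); rewrite -bracketD !subrr bracket0. Qed.
Let bracketZ X a Y : bracket X (a *: Y) = anchor X a *: Y + a *: bracket X Y.
Proof. by have := bracket_lin X a Y 0; rewrite addr0 bracket0 addr0. Qed.

Lemma dform_multilin (w : seq LC -> AC) : alternating_form w ->
  multilin mulC scC (dform anchor bracket w).
Proof.
move=> [wl wa].
have := @koszul_multilin AC LC mulC scC (cplx_bilin anchor) (cplx_bilin bracket).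
move=> /(_ _ (Cplx 1 0)); apply => //.
- by move=> a b c; apply: cplx_eq; rewrite /= ?cplxE; ring.
- by move=> b; apply: cplx_eq; rewrite /=; ring.
- by move=> X; apply: cplx_eq; rewrite /= ?scale1r ?scale0r ?subr0 ?addr0.
- by move=> X b c; apply: cplx_eq; rewrite /= ?cplxE !anchorD; ring.
- by move=> X a b; apply: cplx_eq; rewrite /= ?(anchorD, anchorN, anchorM); ring.
- by move=> a X Y b; apply: cplx_eq; rewrite /= ?(anchorDl, anchorNl, anchorZl); ring.
- move=> X a Y Z; apply: cplx_eq; rewrite /= ?cplxE /=.
    rewrite !(bracketD, bracketN, bracketZ) !(scalerBl, scalerDl, scalerBr, scalerDr).
    rewrite !(opprD, opprK) !addrA.
    by rewrite [LHS](ACl (1*8*3*6*2*7*4*9*5*10)).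
  rewrite !(bracketD, bracketN, bracketZ) !(scalerBl, scalerDl, scalerBr, scalerDr).
  rewrite !(opprD, opprK) !addrA.
  by rewrite [LHS](ACl (1*8*3*6*2*7*4*9*5*10)).
- move=> X Y; apply: cplx_eq; rewrite /= ?cplxE.
    by rewrite (bracket_anti (cre X)) (bracket_anti (cim X)) opprD opprK.
  by rewrite (bracket_anti (cre X)) (bracket_anti (cim X)) opprD addrC.
Qed.

Let JD X Y : J (X + Y) = J X + J Y.
Proof. by have := J_lin 1 X Y; rewrite !scale1r. Qed.
Let J0 : J 0 = 0. Proof. by apply/(addrI (J 0)); rewrite -JD !addr0. Qed.
Let JN X : J (- X) = - J X. Proof. by apply/(addrI (J X)); rewrite -JD !subrr J0. Qed.
Let JZ a X : J (a *: X) = a *: J X. Proof. by have := J_lin a X 0; rewrite !addr0 J0 addr0. Qed.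

Let scaleCA (a b : A) (X : L) : a *: (b *: X) = b *: (a *: X).
Proof. by rewrite !scalerA mulrC. Qed.

Lemma proj10_lin a X Y : proj10 J (scC a X + Y) = scC a (proj10 J X) + proj10 J Y.
Proof.
apply: cplx_eq; rewrite /= ?cplxE /= !(scaleCA _ (2^-1%:A)) -!(scalerBr, scalerDr).
  congr (_ *: _); rewrite !(JD, JN, JZ) ?(scalerBr, scalerDr, scalerN) ?(opprD, opprK) ?addrA.
  by rewrite [LHS](ACl (1*4*2*5*3*6)).
congr (_ *: _); rewrite !(JD, JN, JZ) ?(scalerBr, scalerDr, scalerN) ?(opprD, opprK) ?addrA.
by rewrite [LHS](ACl (1*4*2*5*3*6)).
Qed.

Lemma proj01_lin a X Y : proj01 J (scC a X + Y) = scC a (proj01 J X) + proj01 J Y.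
Proof.
apply: cplx_eq; rewrite /= ?cplxE /= !(scaleCA _ (2^-1%:A)) -!(scalerBr, scalerDr).
  congr (_ *: _); rewrite !(JD, JN, JZ) ?(scalerBr, scalerDr, scalerN) ?(opprD, opprK) ?addrA.
  by rewrite [LHS](ACl (1*4*2*5*3*6)).
congr (_ *: _); rewrite !(JD, JN, JZ) ?(scalerBr, scalerDr, scalerN) ?(opprD, opprK) ?addrA.
by rewrite [LHS](ACl (1*4*2*5*3*6)).
Qed.

Lemma pq_part_multilin p q (w : seq LC -> AC) :
  multilin mulC scC w -> multilin mulC scC (pq_part J p q w).
Proof.
move=> wl s1 s2 a X Y.
pose P n s := \sum_(b : n.-tuple bool | ((count id b)%:Z == p) && ((count negb b)%:Z == q))
    w [seq if c.1 then proj10 J c.2 else proj01 J c.2 | c <- zip b s].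
have PE s : pq_part J p q w s = P (size s) s by [].
rewrite !PE !size_cat /= /P.
set f := (fun c : bool * LC => if c.1 then proj10 J c.2 else proj01 J c.2).
have mulDr (x y z : AC) : mulC x (y + z) = mulC x y + mulC x z.
  by apply: cplx_eq; rewrite /= ?cplxE; ring.
have mulr0 (x : AC) : mulC x 0 = 0.
  by apply/(addrI (mulC x 0)); rewrite -mulDr !addr0.
have -> : forall n (Q : pred (n.-tuple bool)) (F : n.-tuple bool -> AC),
    mulC a (\sum_(b | Q b) F b) = \sum_(b | Q b) mulC a (F b).
  by move=> n Q F; apply: (big_morph (mulC a)) => [x y|]; [exact: mulDr|exact: mulr0].
rewrite -big_split /=; apply: eq_bigr => b _.
have Eb : val b = take (size s1) b ++ nth false b (size s1) :: drop (size s1).+1 b.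
  by rewrite -drop_nth ?cat_take_drop// size_tuple -addSnnS ltn_addr.
have st : size (take (size s1) b) = size s1.
  by rewrite size_takel// size_tuple leq_addr.
have Z V : [seq f c | c <- zip b (s1 ++ V :: s2)] =
    [seq f c | c <- zip (take (size s1) b) s1] ++ f (nth false b (size s1), V) ::
    [seq f c | c <- zip (drop (size s1).+1 b) s2].
  by rewrite {1}Eb zip_cat// map_cat.
rewrite !Z -wl; congr (w (_ ++ _ :: _)).
by rewrite /f /=; case: nth; [exact: proj10_lin|exact: proj01_lin].
Qed.

End LieRinehart.

Section ZmodMorphism.
Variables (U V : zmodType) (f : U -> V).
Hypothesis fB : zmod_morphism f.
Lemma zmod_morphism0 : f 0 = 0. Proof. by have := fB 0 0; rewrite !subrr. Qed.
Lemma zmod_morphismN x : f (- x) = - f x.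
Proof. by have := fB 0 x; rewrite zmod_morphism0 !sub0r. Qed.
Lemma zmod_morphismD x y : f (x + y) = f x + f y.
Proof. by have := fB x (- y); rewrite opprK zmod_morphismN opprK. Qed.
Lemma zmod_morphism_sum (I : Type) (r : seq I) (P : pred I) F :
  f (\sum_(i <- r | P i) F i) = \sum_(i <- r | P i) f (F i).
Proof. by apply: (big_morph f) => [x y|]; [exact: zmod_morphismD|exact: zmod_morphism0]. Qed.
Lemma zmod_morphismMz x n : f (x *~ n) = f x *~ n.
Proof.
have fn k : f (x *+ k) = f x *+ k.
  by elim: k => [|k IH]; rewrite ?mulr0n ?zmod_morphism0// !mulrS zmod_morphismD IH.
by case: n => k; rewrite ?NegzE ?mulrNz ?zmod_morphismN -!pmulrn fn.
Qed.
End ZmodMorphism.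

(** The relation T (w (d s)) = T' (w' s) between a form w on L and a form w' on L'
    is preserved by the differential and by the components. It serves twice: for
    the extension of an invariant form, with T the identity and T' the inclusion
    of the constants, and for the symmetrization, with T the mean and T' the
    identity. *)
Section Transport.
Context {K : fieldType} {A A' : comAlgType K} {L : lmodType A} {L' : lmodType A'}.
Variables (anchor : L -> A -> A) (bracket : L -> L -> L) (J : L -> L).
Variables (bracket' : L' -> L' -> L') (J' : L' -> L').
Variable d : L' -> L.
Hypothesis dB : zmod_morphism d.
Hypothesis dZ : forall (k : K) X, d (k%:A *: X) = k%:A *: d X.
Hypothesis dbr : forall X Y, d (bracket' X Y) = bracket (d X) (d Y).
Hypothesis dJ : forall X, d (J' X) = J (d X).
Local Notation dC := (cplx_map d).
Variables (Z : zmodType) (T : cplx A -> Z) (T' : cplx A' -> Z).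
Hypotheses (TB : zmod_morphism T) (T'B : zmod_morphism T').

Let dN X : d (- X) = - d X. Proof. exact: zmod_morphismN. Qed.
Let dD X Y : d (X + Y) = d X + d Y. Proof. exact: zmod_morphismD. Qed.

Variables (w : seq (cplx L) -> cplx A) (w' : seq (cplx L') -> cplx A').
Hypothesis ww' : forall s, T (w (map dC s)) = T' (w' s).

(** The anchor terms on L are killed by T, as they are zero on L'. *)
Lemma transport_dform :
  (forall X s, T (cplx_bilin anchor (dC X) (w (map dC s))) = 0) ->
  forall s, T (dform anchor bracket w (map dC s)) =
            T' (dform (fun _ _ => 0) bracket' w' s).
Proof.
move=> Tanchor s; rewrite /dform (zmod_morphismD TB) (zmod_morphismD T'B) !(zmod_morphism_sum TB) !(zmod_morphism_sum T'B); congr (_ + _).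
  rewrite !big1 ?size_map// => i _; rewrite ?(zmod_morphismMz TB) ?(zmod_morphismMz T'B).
    have -> : cplx_bilin (fun=> fun=> 0) s`_i (w' (omit (A := A') s i)) = 0 :> cplx A'.
      by apply: cplx_eq; rewrite /= ?subrr ?addr0.
    by rewrite (zmod_morphism0 T'B) mul0rz.
  rewrite (nth_map 0)//.
  have -> : omit (map dC s) i = map dC (omit (A := A') s i).
    by rewrite /omit -map_take -map_drop -map_cat.
  by rewrite Tanchor mul0rz.
rewrite size_map; apply: eq_bigr => j _; rewrite (zmod_morphism_sum TB) (zmod_morphism_sum T'B); apply: eq_bigr => i _.
rewrite (zmod_morphismMz TB) (zmod_morphismMz T'B) -ww'; congr (T (w _) *~ _).
have ij : (i < size s)%N by exact: ltn_trans (ltn_ord j).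
have E t k : omit (map dC t) k = map dC (omit (A := A') t k).
  by rewrite /omit -map_take -map_drop -map_cat.
rewrite !E /= !(nth_map 0)//; congr (_ :: _).
by apply: cplx_eq; rewrite /= ?(dD, dN) !dbr.
Qed.

Lemma transport_pq_part p q s :
  T (pq_part J p q w (map dC s)) = T' (pq_part J' p q w' s).
Proof.
rewrite /pq_part size_map (zmod_morphism_sum TB) (zmod_morphism_sum T'B); apply: eq_bigr => b _; rewrite -ww'.
congr (T (w _)); rewrite -map_comp.
have p10 X : proj10 J (dC X) = dC (proj10 J' X).
  by apply: cplx_eq; rewrite /= ?cplxE /= dZ ?(dD, dN) ?dJ.
have p01 X : proj01 J (dC X) = dC (proj01 J' X).
  by apply: cplx_eq; rewrite /= ?cplxE /= dZ ?(dD, dN) ?dJ.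
move: (tval b) => t {b}; elim: t s => [|c b' IH] [|X s] //=; rewrite IH; congr (_ :: _).
by case: c => /=.
Qed.

End Transport.

(** * Extension and symmetrization of forms *)

Section Symmetrization.
Context {R : realType} {m : nat} {G : lieGroupType R m}.
Variable Gamma : subgroup G.
Variables (J : lie_algebra G -> lie_algebra G)
  (JM : derivation (smooth_fun (nil_proj Gamma)) -> derivation (smooth_fun (nil_proj Gamma))).
Local Notation Gam := (subgroup_set Gamma).
Local Notation pi := (nil_proj Gamma).
Local Notation CM := (smooth_fun pi).
Local Notation g := (lie_algebra G).
Local Notation vect := (derivation CM).
Local Notation dsc := (desc Gamma).
Local Notation X_ i := (inv_field (G := G) (delta_mx 0 i)).
Hypothesis discrete : exists2 U : set G, nbhs 1%g U & U `&` Gam = [set 1%g].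
Hypothesis cpt : compact [set: nilmanifold Gamma].
Hypothesis nilp : nilpotent_group G.
Hypothesis Jc : lie_complex_structure J.
Hypothesis JMc : nil_complex_structure JM.
Hypothesis JJM : induced_structure J JM.
Local Notation coef := (coef discrete).

Lemma bracketE (X Y : vect) f : derivation_bracket X Y f = X (Y f) - Y (X f).
Proof. by []. Qed.

Lemma derD (Y : vect) a b : Y (a + b) = Y a + Y b.
Proof. by have [lY _] := derivationP Y; have := lY 1 a b; rewrite !scale1r. Qed.

Lemma derM (Y : vect) a b : Y (a * b) = Y a * b + a * Y b.
Proof. by have [_ mY] := derivationP Y; exact: mY. Qed.

Lemma vect_bracket_lin (X : vect) (a : CM) (Y Z : vect) :
  derivation_bracket X (a *: Y + Z) =
  (X a : CM) *: Y + (a *: derivation_bracket X Y + derivation_bracket X Z).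
Proof.
apply: derivation_ext => f; rewrite !(bracketE, derevalD, derevalZ) derD derM.
move: (X (Y f)) (X (Z f)) (Y (X f)) (Z (X f)) (X a) (Y f) => u v w z b c.
by ring.
Qed.

Lemma vect_bracket_anti (X Y : vect) : derivation_bracket X Y = - derivation_bracket Y X.
Proof.
have N (Z : vect) f : (- Z) f = - Z f by [].
by apply: derivation_ext => f; rewrite N !bracketE opprB.
Qed.

Lemma desc_zmod : zmod_morphism dsc.
Proof.
move=> X Y; have := descD Gamma (-1) Y X.
by rewrite scaleN1r addrC => ->; rewrite scaleN1r scaleN1r addrC.
Qed.

Lemma descZ (k : R) X : dsc (k *: X) = k%:A *: dsc X.
Proof.
have d0 : dsc 0 = 0 by have := desc_zmod 0 0; rewrite !subrr.
by have := descD Gamma k X 0; rewrite d0 !addr0.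
Qed.

Lemma desc_J X : dsc (J X) = JM (dsc X).
Proof. by apply/esym/related_desc/JJM/desc_related. Qed.

(** The value of Y at p, read in the Lie algebra by means of the frame. *)
Definition theta (p : nilmanifold Gamma) (Y : vect) : g := \sum_i coef i Y p *: X_ i.

Lemma theta_lin p (a : CM) Y Z : theta p (a *: Y + Z) = a p *: theta p Y + theta p Z.
Proof.
rewrite /theta scaler_sumr -big_split; apply: eq_bigr => i _.
by rewrite coef_lin evalD evalM scalerDl scalerA.
Qed.

Lemma theta_zmod p : zmod_morphism (theta p).
Proof.
move=> Y Z; have := theta_lin p (-1) Z Y.
by rewrite scaleN1r addrC => ->; rewrite evalN eval1 scaleN1r addrC.
Qed.

Lemma theta0 p : theta p 0 = 0.
Proof. by have := theta_zmod p 0 0; rewrite !subrr. Qed.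

Lemma thetaN p Y : theta p (- Y) = - theta p Y.
Proof. by have := theta_zmod p 0 Y; rewrite theta0 !sub0r. Qed.

Lemma thetaD p Y Z : theta p (Y + Z) = theta p Y + theta p Z.
Proof. by have := theta_zmod p Y (- Z); rewrite opprK thetaN opprK. Qed.

Lemma thetaZ p (a : CM) Y : theta p (a *: Y) = a p *: theta p Y.
Proof. by have := theta_lin p a Y 0; rewrite theta0 !addr0. Qed.

Lemma theta_sum p (I : Type) (r : seq I) (F : I -> vect) :
  theta p (\sum_(i <- r) F i) = \sum_(i <- r) theta p (F i).
Proof. by apply: (big_morph (theta p)) => [X Y|]; [exact: thetaD|exact: theta0]. Qed.

Lemma theta_desc p X : theta p (dsc X) = X.
Proof.
have [c ->] := inv_field_span X.
have -> : dsc (\sum_j c j *: X_ j) = \sum_j (c j)%:A *: dsc (X_ j).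
  apply: (big_rec2 (fun u v => dsc u = v)) => [|j u v _ <-]; last exact: descD.
  by have := desc_zmod 0 0; rewrite !subrr.
rewrite theta_sum; apply: eq_bigr => j _.
rewrite thetaZ evalZ eval1 mulr1; congr (_ *: _).
rewrite /theta (bigD1 j)//= coef_desc eqxx eval1 scale1r big1 ?addr0// => i ij.
by rewrite coef_desc eq_sym (negPf ij) eval0 scale0r.
Qed.

Lemma JM_sum (I : Type) (r : seq I) (a : I -> CM) (F : I -> vect) :
  JM (\sum_(i <- r) a i *: F i) = \sum_(i <- r) a i *: JM (F i).
Proof.
have [lJ _ _] := JMc; have J0 : JM 0 = 0.
  by have := lJ (-1) 0 0; rewrite scaler0 addr0 scaleN1r addNr.
by apply: (big_rec2 (fun u v => JM u = v)) => [//|i u v _ <-]; exact: lJ.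
Qed.

Lemma J_sum (I : Type) (r : seq I) (a : I -> R) (F : I -> g) :
  J (\sum_(i <- r) a i *: F i) = \sum_(i <- r) a i *: J (F i).
Proof.
have [lJ _ _] := Jc; have J0 : J 0 = 0.
  by have := lJ (-1) 0 0; rewrite scaler0 addr0 scaleN1r addNr.
by apply: (big_rec2 (fun u v => J u = v)) => [//|i u v _ <-]; exact: lJ.
Qed.

Lemma theta_J p Y : theta p (JM Y) = J (theta p Y).
Proof.
rewrite {1}(frame_decomp discrete Y) JM_sum theta_sum [in RHS]/theta J_sum.
by apply: eq_bigr => i _; rewrite thetaZ -desc_J theta_desc.
Qed.

Local Notation thetaC p := (cplx_map (theta p)).
Local Notation dscC := (cplx_map dsc).
Local Notation mulM := (cplx_bilin ( *%R : CM -> CM -> CM)).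
Local Notation scM := (cplx_bilin ( *:%R : CM -> vect -> vect)).
Local Notation mulR := (cplx_bilin ( *%R : R^o -> R^o -> R^o)).
Local Notation scR := (cplx_bilin ( *:%R : R^o -> g -> g)).

Definition evC (p : nilmanifold Gamma) (z : cplx CM) : cplx R^o :=
  Cplx (cre z p : R^o) (cim z p : R^o).

Lemma evC_ext z z' : (forall p, evC p z = evC p z') -> z = z'.
Proof.
move=> H; apply: cplx_eq; apply: smooth_fun_ext => p.
  exact: (congr1 (@cre R^o) (H p)).
exact: (congr1 (@cim R^o) (H p)).
Qed.

Lemma evCD p z z' : evC p (z + z') = evC p z + evC p z'.
Proof. by apply: cplx_eq. Qed.

Lemma evCM p z z' : evC p (mulM z z') = mulR (evC p z) (evC p z').
Proof. by apply: cplx_eq. Qed.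

Lemma evC0 p : evC p 0 = 0. Proof. by apply: cplx_eq. Qed.

Lemma evC_sum p (I : Type) (r : seq I) (F : I -> cplx CM) :
  evC p (\sum_(i <- r) F i) = \sum_(i <- r) evC p (F i).
Proof. by apply: (big_morph (evC p)) => [x y|]; [exact: evCD|exact: evC0]. Qed.

Lemma thetaC_lin p a Y Z : thetaC p (scM a Y + Z) = scR (evC p a) (thetaC p Y) + thetaC p Z.
Proof.
by apply: cplx_eq; rewrite /= ?cplxE /= !(thetaD, thetaN, thetaZ).
Qed.

Lemma thetaC_desc p X : thetaC p (dscC X) = X.
Proof. by apply: cplx_eq; rewrite /= theta_desc. Qed.

Definition coefC i (Z : cplx vect) : cplx CM := Cplx (coef i (cre Z)) (coef i (cim Z)).

Lemma frame_decompC (Z : cplx vect) : Z = \sum_i scM (coefC i Z) (dscC (Cplx (X_ i) 0)).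
Proof.
have d0 : dsc 0 = 0 by have := desc_zmod 0 0; rewrite !subrr.
apply: cplx_eq; rewrite (cre_sum, cim_sum) /=.
  rewrite {1}(frame_decomp discrete (cre Z)); apply: eq_bigr => i _.
  by rewrite d0 scaler0 subr0.
rewrite {1}(frame_decomp discrete (cim Z)); apply: eq_bigr => i _.
by rewrite d0 scaler0 add0r.
Qed.

Lemma thetaC_frame p (Z : cplx vect) :
  thetaC p Z = \sum_i scR (evC p (coefC i Z)) (Cplx (X_ i) 0).
Proof.
apply: cplx_eq; rewrite (cre_sum, cim_sum) /=; apply: eq_bigr => i _.
  by rewrite scaler0 subr0.
by rewrite scaler0 add0r.
Qed.

Lemma formR_sum (w : seq (cplx g) -> cplx R^o) (I : Type) (r : seq I) c F s1 s2 :
  multilin mulR scR w ->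
  w (s1 ++ \sum_(i <- r) scR (c i) (F i) :: s2) =
  \sum_(i <- r) mulR (c i) (w (s1 ++ F i :: s2)).
Proof.
move=> wl; apply: (form_sum (e := Cplx 1 0) _ _ wl).
  by move=> b; apply: cplx_eq; rewrite /= ?mul1r ?mul0r ?subr0 ?addr0.
by move=> X; apply: cplx_eq; rewrite /= ?scale1r ?scale0r ?subr0 ?addr0.
Qed.

Lemma formM_sum (w : seq (cplx vect) -> cplx CM) (I : Type) (r : seq I) c F s1 s2 :
  multilin mulM scM w ->
  w (s1 ++ \sum_(i <- r) scM (c i) (F i) :: s2) =
  \sum_(i <- r) mulM (c i) (w (s1 ++ F i :: s2)).
Proof.
move=> wl; apply: (form_sum (e := Cplx 1 0) _ _ wl).
  by move=> b; apply: cplx_eq; rewrite /= ?mul1r ?mul0r ?subr0 ?addr0.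
by move=> X; apply: cplx_eq; rewrite /= ?scale1r ?scale0r ?subr0 ?addr0.
Qed.

Definition csmooth (f : G -> cplx R^o) :=
  lie_smooth (fun x => cre (f x) : R) /\ lie_smooth (fun x => cim (f x) : R).

Lemma lie_smoothD (f h : G -> R) : lie_smooth f -> lie_smooth h -> lie_smooth (fun x => f x + h x).
Proof.
move=> sf sh; have := lie_smooth_lin 1 sf sh.
by under eq_fun do rewrite mul1r.
Qed.

Lemma csmooth_sum (I : Type) (r : seq I) (F : I -> G -> cplx R^o) :
  (forall i, csmooth (F i)) -> csmooth (fun x => \sum_(i <- r) F i x).
Proof.
move=> sF; elim: r => [|i r [IH1 IH2]].
  by split; under eq_fun do rewrite big_nil; exact: lie_smooth_cst.
have [s1 s2] := sF i.
split; under eq_fun do rewrite big_cons cplxE; exact: lie_smoothD.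
Qed.

Lemma csmooth_mul (f h : G -> cplx R^o) : csmooth f -> csmooth h ->
  csmooth (fun x => mulR (f x) (h x)).
Proof.
move=> [f1 f2] [h1 h2]; split => /=; last first.
  by apply: lie_smoothD; exact: lie_smooth_mul.
have := lie_smooth_lin (-1) (lie_smooth_mul f2 h2) (lie_smooth_mul f1 h1).
by congr lie_smooth; apply/funext => x; rewrite mulN1r addrC.
Qed.

(** A form on the Lie algebra is evaluated pointwise through [theta]. The result is
    smooth in the point as the sum over the frame of products of coefficients with
    constants. *)
Lemma extend_form (phi : seq (cplx g) -> cplx R^o) : multilin mulR scR phi ->
  exists W : seq (cplx vect) -> cplx CM, forall s p, evC p (W s) = phi (map (thetaC p) s).
Proof.
move=> wl.
suff /choice[W HW] : forall s, exists z, forall p, evC p z = phi (map (thetaC p) s).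
  by exists W.
move=> s.
have H s0 t : csmooth (fun x => phi (s0 ++ map (thetaC (pi x)) t)).
  elim: t s0 => [|Z t IH] s0 /=.
    by split; exact: lie_smooth_cst.
  under eq_fun do rewrite thetaC_frame formR_sum//.
  apply: csmooth_sum => i; apply: csmooth_mul.
    by split; exact: smooth_valE.
  by have := IH (rcons s0 (Cplx (X_ i) 0)); under eq_fun do rewrite cat_rcons.
have [s1 s2] := H [::] s.
have i1 : invariant_fun Gamma (fun x => cre (phi (map (thetaC (pi x)) s)) : R).
  by move=> c x Gc; rewrite nil_projM.
have i2 : invariant_fun Gamma (fun x => cim (phi (map (thetaC (pi x)) s)) : R).
  by move=> c x Gc; rewrite nil_projM.
have [f1 f1E] := descend s1 i1; have [f2 f2E] := descend s2 i2.
exists (Cplx f1 f2) => p; have [x <-] := nil_proj_surj p.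
by apply: cplx_eq; rewrite /= (f1E, f2E).
Qed.

(** A multilinear F only depends on the values of its arguments at p. *)
Lemma eval_multilin (F : seq (cplx vect) -> cplx CM) p s0 s : multilin mulM scM F ->
  evC p (F (s0 ++ s)) = evC p (F (s0 ++ map dscC (map (thetaC p) s))).
Proof.
move=> Fl; elim: s s0 => [//|Z s IH] s0 /=.
rewrite -!cat_rcons -IH !cat_rcons {1}(frame_decompC Z) thetaC_frame.
have -> : dscC (\sum_i scR (evC p (coefC i Z)) (Cplx (X_ i) 0)) =
    \sum_i scM (Cplx (cre (coefC i Z) p)%:A (cim (coefC i Z) p)%:A) (dscC (Cplx (X_ i) 0)).
  have d0 : dsc 0 = 0 by have := desc_zmod 0 0; rewrite !subrr.
  have dD X Y : dsc (X + Y) = dsc X + dsc Y.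
    by have := descD Gamma 1 X Y; rewrite !scale1r.
  have ds (I : Type) (r : seq I) (H : I -> g) : dsc (\sum_(i <- r) H i) = \sum_(i <- r) dsc (H i).
    by apply: (big_morph dsc); [exact: dD|exact: d0].
  apply: cplx_eq; rewrite /= !(cre_sum, cim_sum) ds; apply: eq_bigr => i _ /=.
    by rewrite d0 !scaler0 !subr0 descZ.
  by rewrite d0 !scaler0 !add0r descZ.
rewrite !formM_sum// !evC_sum; apply: eq_bigr => i _.
rewrite !evCM; congr (mulR _ _).
by apply: cplx_eq => /=; exact/esym/mulr1.
Qed.

Let dscZ (k : R) X : dsc ((k%:A : R^o) *: X) = k%:A *: dsc X.
Proof. by rewrite -descZ; congr (dsc (_ *: _)); exact: mulr1. Qed.

Local Notation dM := (dform (fun (X : vect) f => X f) derivation_bracket).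
Local Notation dg := (dform (fun _ _ => 0 : R^o) (@lie_bracket R m G)).

Lemma dM_multilin W : @alternating_form R CM vect W -> multilin mulM scM (dM W).
Proof.
move=> aW; apply: dform_multilin => //.
- by move=> X a b; exact: derD.
- by move=> X a b; exact: derM.
- exact: vect_bracket_lin.
- exact: vect_bracket_anti.
Qed.

Definition constC (z : cplx R^o) : cplx CM := Cplx (cre z)%:A (cim z)%:A.

Lemma evC_const p z : evC p (constC z) = z.
Proof. by apply: cplx_eq => /=; exact: mulr1. Qed.

Lemma constC_zmod : zmod_morphism constC.
Proof. by move=> x y; apply: cplx_eq; rewrite /= -scalerBl. Qed.

Lemma der_const (Y : vect) (a : R) : Y a%:A = 0.
Proof.
have [lY mY] := derivationP Y.
have Y0 : Y 0 = 0 by have := lY (-1) 1 1; rewrite !scaleN1r !addNr.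
have Y1 : Y 1 = 0.
  by have := mY 1 1; rewrite !mulr1 mul1r => /eqP; rewrite -subr_eq0 opprD addNKr oppr_eq0 => /eqP.
by have := lY a 1 0; rewrite addr0 Y1 Y0 scaler0 addr0.
Qed.

Lemma anchor_const (Y : cplx vect) z :
  cplx_bilin (fun (X : vect) f => X f : CM) Y (constC z) = 0.
Proof. by apply: cplx_eq; rewrite /= !der_const ?subrr ?addr0. Qed.

Section Extension.
Variables (phi : seq (cplx g) -> cplx R^o) (W : seq (cplx vect) -> cplx CM).
Hypothesis HW : forall s p, evC p (W s) = phi (map (thetaC p) s).

Lemma ext_alternating : @alternating_form R R^o g phi -> alternating_form W.
Proof.
move=> [pl pa]; split=> [s1 s2 a X Y|s1 s2 s3 X]; apply: evC_ext => p.
  by rewrite evCD evCM !HW !map_cat /= thetaC_lin pl.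
by rewrite HW evC0 !map_cat /= map_cat /= pa.
Qed.

Lemma ext_pq p q : @pq_form R R^o g J p q phi -> pq_form JM p q W.
Proof.
move=> [aphi tphi]; split; first exact: ext_alternating.
move=> s1 s2 H1 H2 pq; apply: evC_ext => x; rewrite HW evC0 map_cat; apply: tphi.
- move=> Z /mapP [Y /H1 HY ->]; rewrite /type10.
  have [e1 e2] : JM (cre Y) = - cim Y /\ JM (cim Y) = cre Y.
    by split; [exact: (congr1 (@cre _) HY)|exact: (congr1 (@cim _) HY)].
  by apply: cplx_eq; rewrite /= -theta_J ?e1 ?e2 ?thetaN.
- move=> Z /mapP [Y /H2 HY ->]; rewrite /type01.
  have [e1 e2] : JM (cre Y) = - - cim Y /\ JM (cim Y) = - cre Y.
    by split; [exact: (congr1 (@cre _) HY)|exact: (congr1 (@cim _) HY)].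
  by apply: cplx_eq; rewrite /= -theta_J ?e1 ?e2 !thetaN.
- by rewrite !size_map.
Qed.

Lemma ext_real : @real_form R R^o g phi -> real_form W.
Proof.
move=> rphi s; apply: evC_ext => p; rewrite HW -map_comp.
have -> : map (thetaC p \o @cplx_conj vect) s = map (@cplx_conj g) (map (thetaC p) s).
  rewrite -map_comp; apply: eq_map => Z; apply: cplx_eq => //=; exact: thetaN.
rewrite rphi -HW.
by apply: cplx_eq.
Qed.

Lemma ext_desc s : W (map dscC s) = constC (phi s).
Proof.
apply: evC_ext => p; rewrite HW evC_const -map_comp.
congr phi; rewrite -[RHS]map_id; apply: eq_map => Z; exact: thetaC_desc.
Qed.

Lemma ext_pq_part_dform p q s :
  pq_part JM p q (dM W) (map dscC s) = constC (pq_part J p q (dg phi) s).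
Proof.
apply: (@transport_pq_part R CM R^o vect g JM J dsc desc_zmod dscZ desc_J _ id constC) => //.
  exact: constC_zmod.
move=> t; apply: (@transport_dform R CM R^o vect g _ _ _ dsc desc_zmod (@desc_bracket R m G Gamma) _ id constC) => //.
- exact: constC_zmod.
- by move=> r; exact: ext_desc.
- by move=> X r; rewrite ext_desc; exact: anchor_const.
Qed.

(** Both sides are equal on left-invariant fields, where the function on the left
    is constant; [eval_multilin] reduces the general case to this one. *)
Lemma ext_pq_partE p q s x : @alternating_form R R^o g phi ->
  evC x (pq_part JM p q (dM W) s) = pq_part J p q (dg phi) (map (thetaC x) s).
Proof.
move=> aphi; have [lJM _ _] := JMc.
have ml : multilin mulM scM (pq_part JM p q (dM W)).
  by apply: pq_part_multilin => //; apply: dM_multilin; exact: ext_alternating.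
by have /= -> := eval_multilin x [::] s ml; rewrite ext_pq_part_dform evC_const.
Qed.

End Extension.

Section Average.
Variable I : CM -> R.
Hypothesis I_lin : forall a f h, I (a *: f + h) = a * I f + I h.
Hypothesis I_desc : forall X f, I (dsc X f) = 0.
Hypothesis I_1 : I 1 = 1.

Definition IC (z : cplx CM) : cplx R^o := Cplx (I (cre z) : R^o) (I (cim z) : R^o).

Lemma I_zmod : zmod_morphism I.
Proof.
move=> x y; have := I_lin (-1) y x.
by rewrite scaleN1r mulN1r addrC => ->; rewrite addrC.
Qed.

Lemma IC_zmod : zmod_morphism IC.
Proof. by move=> x y; apply: cplx_eq; rewrite /= I_zmod. Qed.

Lemma IZ a f : I (a *: f) = a * I f.
Proof. by have := I_lin a f 0; rewrite addr0 (zmod_morphism0 I_zmod) addr0. Qed.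

Lemma IC_const z : IC (constC z) = z.
Proof. by apply: cplx_eq => /=; rewrite IZ I_1 mulr1. Qed.

Lemma IC_muli z : IC (cplx_muli z) = cplx_muli (IC z).
Proof. by apply: cplx_eq => //=; exact: (zmod_morphismN I_zmod). Qed.

Definition avg_form (W : seq (cplx vect) -> cplx CM) s : cplx R^o := IC (W (map dscC s)).

(** The anchor terms are killed by the mean. *)
Lemma avg_dform W : avg_form (dM W) = dg (avg_form W).
Proof.
apply/funext => s; apply: (@transport_dform R CM R^o vect g _ _ _ dsc desc_zmod (@desc_bracket R m G Gamma) _ IC id) => //.
- exact: IC_zmod.
- have I_desc' X f : I (desc_op X f) = 0 by exact: (I_desc X f).
  move=> X t; apply: cplx_eq; rewrite /=.
    by rewrite (zmod_morphismD I_zmod) (zmod_morphismN I_zmod) !I_desc' subrr.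
  by rewrite (zmod_morphismD I_zmod) !I_desc' addr0.
Qed.

Lemma avg_pq_part p q W : avg_form (pq_part JM p q W) = pq_part J p q (avg_form W).
Proof.
apply/funext => s.
apply: (@transport_pq_part R CM R^o vect g JM J dsc desc_zmod dscZ desc_J _ IC id) => //.
exact: IC_zmod.
Qed.

Lemma avg_pq p q W : pq_form JM p q W -> @pq_form R R^o g J p q (avg_form W).
Proof.
have dN := zmod_morphismN desc_zmod; have dD := zmod_morphismD desc_zmod.
move=> [[Wl Wa] tW]; split; first split.
- move=> s1 s2 a X Y; rewrite /avg_form !map_cat /=.
  have -> : dscC (scR a X + Y) = scM (constC a) (dscC X) + dscC Y.
    by apply: cplx_eq; rewrite /= ?cplxE /= ?(dD, dN) -!descZ.
  rewrite Wl (zmod_morphismD IC_zmod); congr (_ + _).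
  move: (W _) => z; apply: cplx_eq; rewrite /= ?cplxE /= -!scalerAl !mul1r.
    by rewrite (zmod_morphismD I_zmod) (zmod_morphismN I_zmod) !IZ.
  by rewrite (zmod_morphismD I_zmod) !IZ.
- move=> s1 s2 s3 X; rewrite /avg_form !map_cat /= map_cat /= Wa.
  exact: (zmod_morphism0 IC_zmod).
move=> s1 s2 H1 H2 pq; rewrite /avg_form map_cat tW ?(zmod_morphism0 IC_zmod) ?size_map//.
- move=> Z /mapP [Y /H1 HY ->]; rewrite /type10.
  have [e1 e2] : J (cre Y) = - cim Y /\ J (cim Y) = cre Y.
    by split; [exact: (congr1 (@cre _) HY)|exact: (congr1 (@cim _) HY)].
  by apply: cplx_eq; rewrite /= -desc_J ?e1 ?e2 ?dN.
- move=> Z /mapP [Y /H2 HY ->]; rewrite /type01.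
  have [e1 e2] : J (cre Y) = - - cim Y /\ J (cim Y) = - cre Y.
    by split; [exact: (congr1 (@cre _) HY)|exact: (congr1 (@cim _) HY)].
  by apply: cplx_eq; rewrite /= -desc_J ?e1 ?e2 !dN.
Qed.

End Average.

(** phi and eta extend to W and V on the quotient, and the mean of the solution
    found there is the solution sought. *)
Theorem nil_ddbar_descends n : nil_weak_ddbar JM n -> lie_weak_ddbar J n.
Proof.
move=> H N phi pphi rphi [eta [peta E]].
have [W HW] := extend_form pphi.1.1.
have [V HV] := extend_form peta.1.1.
have [I [I_lin I_desc I_1]] := invariant_functional cpt nilp.
have [|psi [ppsi Hpsi]] := H W (ext_pq HW pphi) (ext_real HW rphi).
  exists V; split; first exact: (ext_pq HV).
  move=> s; apply: evC_ext => x.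
  have EW := ext_pq_partE HW (N - 1) (N - 1 + 1) s x pphi.1.
  have EV := ext_pq_partE HV (N - 2 + 1) N s x peta.1.
  by move: (E (map (thetaC x) s)); rewrite /delbar /del -EW -EV.
exists (avg_form I psi); split; first exact: (avg_pq I_lin ppsi).
move=> s; have := congr1 (IC I) (Hpsi (map dscC s)).
rewrite (IC_muli I_lin) [in LHS]/delbar (ext_pq_part_dform HW) (IC_const I_lin I_1).
move=> EQ; apply: (etrans EQ); congr (cplx_muli _).
rewrite -[LHS]/(avg_form I (del _ _ _ _ _ _) s) /del /delbar.
by rewrite (avg_pq_part I_lin) (avg_dform I_lin I_desc) (avg_pq_part I_lin) (avg_dform I_lin I_desc).
Qed.


End Symmetrization.

Local Close Scope ring_scope.
Local Close Scope classical_set_scope.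

Theorem proposition3p2 (R : realType) (n : nat) (G : lieGroupType R (2 * n))
    (Gamma : subgroup G)
    (J : lie_algebra G -> lie_algebra G)
    (JM : derivation (smooth_fun (nil_proj Gamma)) ->
          derivation (smooth_fun (nil_proj Gamma))) :
  simply_connected R G -> nilpotent_group G -> lattice Gamma ->
  lie_complex_structure J ->
  nil_complex_structure JM -> induced_structure J JM ->
  ~ lie_weak_ddbar J n -> ~ nil_weak_ddbar JM n.
Proof.
move=> _ nilp [discrete cpt] Jc JMc JJM nJ nilM; apply: nJ.
exact: (nil_ddbar_descends discrete cpt nilp Jc JMc JJM nilM).
Qed.
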